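(* Let $(M,h,\nabla)$ and $(M',h',\nabla')$ be connected dually flat manifolds, and endow $TM$ and $TM'$ with their natural Kähler structures coming from Dombrowski's construction. Let $f:M\to M'$ be a smooth map. (1) The derivative $f_*:TM\to TM'$ is holomorphic if and only if $f$ is affine. (2) Suppose $f$ is affine. Then $f_*$ is isometric if and only if $f$ is isometric. Consequently, $f_*$ is a Kähler immersion (holomorphic isometric immersion) if and only if $f$ is an isometric affine immersion.
   Context: A linear connection is flat if its torsion and curvature both vanish. If $(M,h)$ is a Riemannian manifold with a linear connection $\nabla$, the dual connection $\nabla^*$ is the unique linear connection with $Xh(Y,Z)=h(\nabla_XY,Z)+h(Y,\nabla^*_XZ)$ for all vector fields $X,Y,Z$. The triple $(M,h,\nabla)$ is a dually flat manifold if $\nabla$ and $\nabla^*$ are both flat. A coordinate system $(x_1,\dots,x_n)$ is $\nabla$-affine if $\nabla_{\partial/\partial x_i}\partial/\partial x_j=0$ for all $i,j$. A smooth map $f:M\to M'$ is affine if for every $p\in M$ there are a $\nabla$-affine coordinate system $x$ on some open $U\ni p$ and a $\nabla'$-affine coordinate system $x'$ on some open $U'\supseteq f(U)$ such that $x'\circ f\circ x^{-1}$ is the restriction to $x(U)$ of an affine map $y\mapsto Ay+B$. A smooth map $f:(M,h)\to(M',h')$ is isometric if $f^*h'=h$. Dombrowski's construction. Let $(M,h,\nabla)$ be dually flat, $\pi:TM\to M$ the projection, and $K:TTM\to TM$ the connector of $\nabla$ (the map, linear on each $T_u(TM)$, with $K(Y_*X)=\nabla_XY$ for all vector fields $X,Y$).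 For $u\in T_pM$ the map $A\mapsto(\pi_*A,KA)$ identifies $T_u(TM)$ with $T_pM\oplus T_pM$; under it set $g_u((v,w),(v',w'))=h_p(v,v')+h_p(w,w')$, $J_u(v,w)=(-w,v)$, $\omega_u((v,w),(v',w'))=h_p(v,w')-h_p(w,v')$. Then $(TM,g,J,\omega)$ is a Kähler manifold. In the coordinates $(q,r)$ on $TM$ induced by $\nabla$-affine coordinates $x$ on $M$, $g$ is block diagonal with both blocks $[h_{ij}]$ and $J(u,v)=(-v,u)$. *)

(* Defs.v *)
(* MathComp-Analysis *)
From HB Require Import structures.
From mathcomp Require Import all_boot all_order all_algebra.
From mathcomp Require Import all_classical reals topology normedtype derive.

Set Implicit Arguments.
Unset Strict Implicit.
Unset Printing Implicit Defensive.
Import Order.TTheory GRing.Theory Num.Theory.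
Import numFieldNormedType.Exports.
Local Open Scope classical_set_scope.
Local Open Scope ring_scope.

(** * Smooth functions on subsets of R^n *)

(* Only meaningful, and only used, for open A. *)
Fixpoint Ck (R : realType) (V W : normedModType R) (k : nat) (A : set V)
    (F : V -> W) : Prop :=
  if k is k'.+1 then
    (forall x, A x -> differentiable F x) /\
    (forall v : V, Ck k' A (fun x => 'd F x v))
  else forall x, A x -> {for x, continuous F}.

Definition smooth_on (R : realType) (V W : normedModType R) (A : set V)
    (F : V -> W) : Prop := forall k, Ck k A F.

(** * Atlases and manifolds *)

(* A coordinate system: cmap is a total function, whose values outside cdom are
   irrelevant. *)
Record chart (R : realType) (T : Type) (n : nat) := Chart {
  cdom : set T;
  cmap :> T -> 'rV[R]_n
}.

HB.instance Definition _ (R : realType) (T : Type) (n : nat) :=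
  gen_eqMixin (chart R T n).
HB.instance Definition _ (R : realType) (T : Type) (n : nat) :=
  gen_choiceMixin (chart R T n).

(* A set with a family of charts. The axioms of an atlas are kept apart (see
   is_atlas), so that the tangent bundle can be formed as bare data. *)
Record atlas (R : realType) (n : nat) := Atlas {
  carrier :> Type;
  charts : set (chart R carrier n)
}.

Definition chart_around (R : realType) (n : nat) (M : atlas R n) (p : M)
    (c : chart R M n) : Prop := charts c /\ cdom c p.

(* The local expression F \o c^-1 : R^n -> V on c(cdom c); 0 elsewhere. *)
Definition in_chart (R : realType) (T : Type) (n : nat) (V : normedModType R)
    (c : chart R T n) (F : T -> V) (x : 'rV[R]_n) : V :=
  xget 0 (F @` (cdom c `&` c @^-1` [set x])).

Section AtlasTopology.
Variables (R : realType) (n : nat) (M : atlas R n).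

HB.instance Definition _ := gen_eqMixin (carrier M).
HB.instance Definition _ := gen_choiceMixin (carrier M).

(* When the charts are injective and have compatible open images, this says
   that c(A `&` cdom c) is open for all c. *)
Definition atlas_open (A : set M) : Prop :=
  forall (c : chart R M n) (p : M), charts c -> cdom c p -> A p ->
    \forall x \near c p, forall q, cdom c q -> c q = x -> A q.

Lemma atlas_openT : atlas_open setT.
Proof. by move=> c p _ _ _; near=> x. Unshelve. all: by end_near. Qed.

Lemma atlas_openI : setI_closed atlas_open.
Proof.
move=> A B oA oB c p cM cp [Ap Bp].
have hA := oA c p cM cp Ap; have hB := oB c p cM cp Bp.
by apply: filterS2 hA hB => x hA hB q cq qx; split; [exact: hA|exact: hB].
Qed.

Lemma atlas_open_bigU (I : Type) (f : I -> set M) :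
  (forall i, atlas_open (f i)) -> atlas_open (\bigcup_i f i).
Proof.
move=> of_ c p cM cp [i _ fip].
by apply: filterS (of_ i c p cM cp fip) => x h q cq qx; exists i => //; exact: h.
Qed.

HB.instance Definition _ :=
  isOpenTopological.Build (carrier M) atlas_openT atlas_openI atlas_open_bigU.

End AtlasTopology.

Definition is_chart (R : realType) (T : Type) (n : nat) (c : chart R T n) :
    Prop :=
  {in cdom c &, injective c} /\ open (c @` cdom c).

Definition compatible (R : realType) (T : Type) (n : nat)
    (c d : chart R T n) : Prop :=
  [/\ open (c @` (cdom c `&` cdom d)), open (d @` (cdom c `&` cdom d)),
      smooth_on (c @` (cdom c `&` cdom d)) (in_chart c d) &
      smooth_on (d @` (cdom c `&` cdom d)) (in_chart d c)].

Record is_atlas (R : realType) (n : nat) (M : atlas R n) : Prop := IsAtlas {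
  atlas_cover : forall p : M, exists c, chart_around p c;
  atlas_chart : forall c : chart R M n, charts c -> is_chart c;
  atlas_compatible : forall c d : chart R M n,
    charts c -> charts d -> compatible c d
}.

(* By maximality, the coordinate systems of the manifold are exactly its
   charts. *)
Record manifold (R : realType) (n : nat) := Manifold {
  manifold_atlas :> atlas R n;
  manifold_is_atlas : is_atlas manifold_atlas;
  manifold_maximal : forall c : chart R manifold_atlas n,
    is_chart c ->
    (forall d : chart R manifold_atlas n, charts d -> compatible c d) ->
    charts c;
  manifold_hausdorff : hausdorff_space (carrier manifold_atlas);
  manifold_second_countable : @second_countable (carrier manifold_atlas)
}.

Definition connected_manifold (R : realType) (n : nat) (M : manifold R n) :
    Prop := connected [set: carrier M].

Definition smooth_fun (R : realType) (n : nat) (M : atlas R n)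
    (V : normedModType R) (A : set M) (f : M -> V) : Prop :=
  forall c : chart R M n, charts c ->
    smooth_on (c @` (cdom c `&` A)) (in_chart c f).

Definition smooth_map (R : realType) (n n' : nat) (M : atlas R n)
    (M' : atlas R n') (f : M -> M') : Prop :=
  continuous f /\
  forall d : chart R M' n', charts d -> smooth_fun (f @^-1` cdom d) (d \o f).

(** * Tangent vectors *)

Section TangentSpace.
Variables (R : realType) (n : nat) (M : atlas R n) (p : M).

(* A tangent vector at p is the family (v c)_c of its components in the charts
   around p, related by the Jacobians of the transition maps. *)
Definition tangent_pred : {pred (chart R M n -> 'rV[R]_n)} :=
  [pred v | `[< (forall c, ~ chart_around p c -> v c = 0) /\
    (forall c d, chart_around p c -> chart_around p d ->
       v d = 'd (in_chart c d) (c p) (v c)) >]].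

Fact tangent_pred_submod : submod_closed tangent_pred.
Proof.
split=> [|a u v /asboolP[u0 u1] /asboolP[v0 v1]]; apply/asboolP; split=> //.
- by move=> c d _ _; rewrite /= linear0.
- by move=> c cp; rewrite !fctE /= u0// v0// addr0 scaler0.
- by move=> c d cp dp; rewrite !fctE /= linearP /= -u1// -v1.
Qed.

HB.instance Definition _ :=
  GRing.isSubmodClosed.Build _ _ tangent_pred tangent_pred_submod.

Record tangent := Tangent {
  components :> chart R M n -> 'rV[R]_n;
  _ : components \in tangent_pred
}.

HB.instance Definition _ := [isSub for components].
HB.instance Definition _ := [Choice of tangent by <:].
HB.instance Definition _ := [SubChoice_isSubLmodule of tangent by <:].

(* The tangent vector whose component in each chart c around p is v c, provided
   these transform correctly (0 otherwise). *)
Definition tangent_of (v : chart R M n -> 'rV[R]_n) : tangent :=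
  insubd (0 : tangent) (fun c => if `[< chart_around p c >] then v c else 0).

Definition chart_at : chart R M n :=
  xget (Chart set0 (fun=> 0)) (chart_around p).

(* The derivative v(F) of F along v; it does not depend on the chart. *)
Definition dfun (V : normedModType R) (v : tangent) (F : M -> V) : V :=
  'd (in_chart chart_at F) (chart_at p) (v chart_at).

End TangentSpace.

Definition pushforward (R : realType) (n n' : nat) (M : atlas R n)
    (M' : atlas R n') (f : M -> M') (p : M) (v : tangent p) : tangent (f p) :=
  tangent_of (f p) (fun d => dfun v (d \o f)).

Definition immersion (R : realType) (n n' : nat) (M : atlas R n)
    (M' : atlas R n') (f : M -> M') : Prop :=
  smooth_map f /\ forall p : M, injective (pushforward f (p := p)).

(** * Vector fields *)

(* A field X : vfield M is regarded as defined only where it is smooth: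
   smooth_vfield A X says that X restricts to a smooth vector field on A. *)
Definition vfield (R : realType) (n : nat) (M : atlas R n) :=
  forall p : M, tangent p.

Definition smooth_vfield (R : realType) (n : nat) (M : atlas R n)
    (A : set M) (X : vfield M) : Prop :=
  forall c : chart R M n, charts c ->
    smooth_on (c @` (cdom c `&` A)) (in_chart c (fun p => X p c)).

(* In each chart c, the components of [X, Y] are X(Y^c) - Y(X^c). *)
Definition bracket (R : realType) (n : nat) (M : atlas R n)
    (X Y : vfield M) : vfield M :=
  fun p => tangent_of p
    (fun c => dfun (X p) (fun q => Y q c) - dfun (Y p) (fun q => X q c)).

Definition coord_vfield (R : realType) (n : nat) (M : atlas R n)
    (c : chart R M n) (i : 'I_n) : vfield M :=
  fun p => tangent_of p (fun d => 'd (in_chart c d) (c p) (delta_mx 0 i)).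

(** * Metrics and connections *)

Record metric (R : realType) (n : nat) (M : manifold R n) := Metric {
  metric_fun :> forall p : M, tangent p -> tangent p -> R;
  metricC : forall (p : M) (v w : tangent p),
    metric_fun v w = metric_fun w v;
  metricP : forall (p : M) (a : R) (u v w : tangent p),
    metric_fun (a *: u + v) w = a * metric_fun u w + metric_fun v w;
  metric_gt0 : forall (p : M) (v : tangent p), v != 0 -> 0 < metric_fun v v;
  metric_smooth : forall (A : set M) (X Y : vfield M), open A ->
    smooth_vfield A X -> smooth_vfield A Y ->
    smooth_fun A (fun p => metric_fun (X p) (Y p))
}.

(* The covariant derivative, acting on the vector fields on all open subsets A
   of M compatibly with restriction. *)
Record connection (R : realType) (n : nat) (M : manifold R n) := Connection {
  nabla :> vfield M -> vfield M -> vfield M;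
  nabla_smooth : forall (A : set M) (X Y : vfield M), open A ->
    smooth_vfield A X -> smooth_vfield A Y -> smooth_vfield A (nabla X Y);
  nabla_local : forall (A : set M) (X X' Y Y' : vfield M), open A ->
    smooth_vfield A X -> smooth_vfield A X' ->
    smooth_vfield A Y -> smooth_vfield A Y' ->
    (forall p, A p -> X p = X' p) -> (forall p, A p -> Y p = Y' p) ->
    forall p, A p -> nabla X Y p = nabla X' Y' p;
  nabla_linear : forall (A : set M) (f : M -> R) (X X' Y : vfield M), open A ->
    smooth_fun A f ->
    smooth_vfield A X -> smooth_vfield A X' -> smooth_vfield A Y ->
    forall p, A p ->
      nabla (fun q => f q *: X q + X' q) Y p
      = f p *: nabla X Y p + nabla X' Y p;
  nabla_leibniz : forall (A : set M) (f : M -> R) (X Y Y' : vfield M), open A ->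
    smooth_fun A f ->
    smooth_vfield A X -> smooth_vfield A Y -> smooth_vfield A Y' ->
    forall p, A p ->
      nabla X (fun q => f q *: Y q + Y' q) p
      = dfun (X p) f *: Y p + f p *: nabla X Y p + nabla X Y' p
}.

Section Connections.
Variables (R : realType) (n : nat) (M : manifold R n).
Implicit Types (D : connection M) (h : metric M) (X Y Z : vfield M).

Definition torsion D X Y : vfield M :=
  fun p => D X Y p - D Y X p - bracket X Y p.

Definition curvature D X Y Z : vfield M :=
  fun p => D X (D Y Z) p - D Y (D X Z) p - D (bracket X Y) Z p.

Definition flat D : Prop :=
  forall (A : set M) X Y Z, open A ->
    smooth_vfield A X -> smooth_vfield A Y -> smooth_vfield A Z ->
    forall p, A p -> torsion D X Y p = 0 /\ curvature D X Y Z p = 0.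

Definition dual_connection h D D' : Prop :=
  forall (A : set M) X Y Z, open A ->
    smooth_vfield A X -> smooth_vfield A Y -> smooth_vfield A Z ->
    forall p, A p ->
      dfun (X p) (fun q => h q (Y q) (Z q))
      = h p (D X Y p) (Z p) + h p (Y p) (D' X Z p).

Definition dually_flat h D : Prop :=
  flat D /\ exists2 D', dual_connection h D D' & flat D'.

Definition affine_chart D (c : chart R M n) : Prop :=
  charts c /\
  forall p, cdom c p -> forall i j,
    D (coord_vfield c i) (coord_vfield c j) p = 0.

End Connections.

Definition affine_map (R : realType) (n n' : nat) (M : manifold R n)
    (M' : manifold R n') (D : connection M) (D' : connection M')
    (f : M -> M') : Prop :=
  smooth_map f /\
  forall p : M, exists (c : chart R M n) (c' : chart R M' n'),
    [/\ affine_chart D c, affine_chart D' c', cdom c p,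
        f @` cdom c `<=` cdom c' &
        exists (A : 'M[R]_(n, n')) (B : 'rV[R]_n'),
          forall q, cdom c q -> c' (f q) = c q *m A + B].

(** * The tangent bundle *)

Section TangentBundle.
Variables (R : realType) (n : nat) (M : atlas R n).

(* The coordinates (q, r) induced on TM by c. *)
Definition tangent_chart (c : chart R M n) :
    chart R {p : M & tangent p} (n + n) :=
  Chart [set u : {p : M & tangent p} | cdom c (projT1 u)]
        (fun u => row_mx (c (projT1 u)) (projT2 u c)).

Definition tangent_bundle : atlas R (n + n) :=
  Atlas [set tangent_chart c | c in charts (a := M)].

Definition TM_proj (u : tangent_bundle) : M := projT1 u.

Definition TM_section (Y : vfield M) (p : M) : tangent_bundle :=
  existT _ p (Y p).

End TangentBundle.

Definition tangent_map (R : realType) (n n' : nat) (M : atlas R n)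
    (M' : atlas R n') (f : M -> M') (u : tangent_bundle M) :
    tangent_bundle M' :=
  existT _ (f (projT1 u)) (pushforward f (projT2 u)).

(** * Dombrowski's construction *)

(* Only the tensor fields (g, J, omega) of a Kaehler manifold: that those of
   Dombrowski's construction satisfy the Kaehler axioms is a theorem, and the
   notions below do not depend on it. *)
Record kahler_tensors (R : realType) (n : nat) (N : atlas R n) :=
  KahlerTensors {
    kahler_g : forall u : N, tangent u -> tangent u -> R;
    kahler_J : forall u : N, tangent u -> tangent u;
    kahler_omega : forall u : N, tangent u -> tangent u -> R
  }.

Section Dombrowski.
Variables (R : realType) (n : nat) (M : manifold R n).
Variables (h : metric M) (D : connection M).

Definition is_connector
    (K : forall u : tangent_bundle M, tangent u -> tangent (TM_proj u)) :
    Prop :=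
  (forall u, linear (K u)) /\
  forall (A : set M) (X Y : vfield M), open A ->
    smooth_vfield A X -> smooth_vfield A Y ->
    forall p, A p ->
      K (TM_section Y p) (pushforward (TM_section Y) (X p)) = D X Y p.

Definition connector :
    forall u : tangent_bundle M, tangent u -> tangent (TM_proj u) :=
  xget (fun _ _ => 0) is_connector.

(* The components of a : T_u(TM) in T_p M (+) T_p M. *)
Definition horizontal (u : tangent_bundle M) (a : tangent u) :
    tangent (TM_proj u) := pushforward (@TM_proj R n M) a.

Definition vertical (u : tangent_bundle M) (a : tangent u) :
    tangent (TM_proj u) := connector a.

Definition dombrowski_g (u : tangent_bundle M) (a b : tangent u) : R :=
  h _ (horizontal a) (horizontal b) + h _ (vertical a) (vertical b).

Definition dombrowski_J (u : tangent_bundle M) (a : tangent u) : tangent u :=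
  xget 0 [set b | horizontal b = - vertical a /\ vertical b = horizontal a].

Definition dombrowski_omega (u : tangent_bundle M) (a b : tangent u) : R :=
  h _ (horizontal a) (vertical b) - h _ (vertical a) (horizontal b).

Definition dombrowski : kahler_tensors (tangent_bundle M) :=
  KahlerTensors dombrowski_g dombrowski_J dombrowski_omega.

End Dombrowski.

(** * Isometric and holomorphic maps *)

Definition isometric (R : realType) (n n' : nat) (M : atlas R n)
    (M' : atlas R n')
    (g : forall p : M, tangent p -> tangent p -> R)
    (g' : forall p : M', tangent p -> tangent p -> R) (f : M -> M') : Prop :=
  smooth_map f /\
  forall (p : M) (v w : tangent p),
    g' (f p) (pushforward f v) (pushforward f w) = g p v w.

Definition holomorphic (R : realType) (n n' : nat) (N : atlas R n)
    (N' : atlas R n')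
    (J : forall u : N, tangent u -> tangent u)
    (J' : forall u : N', tangent u -> tangent u) (F : N -> N') : Prop :=
  smooth_map F /\
  forall (u : N) (a : tangent u),
    pushforward F (J u a) = J' (F u) (pushforward F a).

Definition kahler_immersion (R : realType) (n n' : nat) (N : atlas R n)
    (N' : atlas R n') (S : kahler_tensors N) (S' : kahler_tensors N')
    (F : N -> N') : Prop :=
  [/\ holomorphic (kahler_J S) (kahler_J S') F,
      isometric (kahler_g S) (kahler_g S') F & immersion F].

(* Main.v *)
From HB Require Import structures.
From mathcomp Require Import all_boot all_order all_algebra.
From mathcomp Require Import all_classical reals topology normedtype landau derive.
From mathcomp Require Import constructive_ereal ereal sequences measure.
From mathcomp Require Import lebesgue_measure lebesgue_integral ftc.
From mathcomp Require Import lra ring.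
Require Import Defs.

(** Let [F] be the local expression of [f] in a chart of [M] and a chart of [M'].
    In the induced charts the tangent map of [f] is (x, r) |-> (F x, dF_x r), and
    its own derivative at (x, r) sends (v, b) to
      (dF_x v, D_v (dF r) + dF_x b),
    where D_v (dF r) is the second derivative of [F] in the directions r and v
    ([pushforward_tangent_map]). If the charts are affine, then (v, b) has
    horizontal part v and vertical part b ([horizontalE], [verticalE]), so that
    J (v, b) = (-b, v). Comparing J before and after the tangent map shows that
    the tangent map is holomorphic exactly when all D_v (dF r) vanish
    ([second_derivative_of_holomorphic], [holomorphic_of_affine]), that is, when
    [F] is affine on balls. In this case the tangent map acts as the push-forward
    by [f] on horizontal parts and on vertical parts ([horizontal_tangent_map],
    [vertical_affine]), so it is isometric, or an immersion, exactly when [f] is.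

    The substance is that affine charts exist around every point of a manifold
    with a flat connection ([affine_chart_exists]). In coordinates a parallel
    1-form g solves the total differential system
      d_l g_j = \sum_k Gam_(l j)^k g_k,
    whose integrability condition is that the curvature vanishes. It is solved by
    Picard iteration with the radial integral operator of the Poincare lemma
    ([radial]): by the homotopy formula [radial_homotopy], the failure of an
    iterate to satisfy the system is controlled by the failure of the previous
    one, so it tends to 0 ([picard_error], [total_system_solution]). Continuous
    differentiability is enough here, since the system itself makes its solutions
    smooth. The torsion vanishes, so parallel 1-forms are closed; the radial
    potentials of a parallel coframe, by the inverse function theorem
    ([inverse_function]), are coordinates in which the Christoffel symbols are 0
    ([flat_coordinates]).

    The connector of the construction is specified by its values on derivatives
    of vector fields; [connectorP] shows that it exists, and
    [connector_non_vertical] that these values determine it. *)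

Set Implicit Arguments.
Unset Strict Implicit.
Unset Printing Implicit Defensive.
Import Order.TTheory GRing.Theory Num.Theory.
Import numFieldNormedType.Exports.
Local Open Scope classical_set_scope.
Local Open Scope ring_scope.

(** * Differentials *)

(** Filter lemmas at the neighbourhoods of a point of an arbitrary topological
    space. Over row vectors, unification unfolds [nbhs] to the matrix filter, and
    the instance that makes it a filter is no longer found. *)
Section Near.

Lemma near_mono (T : topologicalType) (x : T) (P Q : T -> Prop) :
  (forall y, P y -> Q y) -> (\forall y \near x, P y) -> \forall y \near x, Q y.
Proof. exact: filterS. Qed.

Lemma near_mono2 (T : topologicalType) (x : T) (P Q S : T -> Prop) :
  (forall y, P y -> Q y -> S y) -> (\forall y \near x, P y) ->
  (\forall y \near x, Q y) -> \forall y \near x, S y.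
Proof. exact: filterS2. Qed.

Lemma near_forall (I : finType) (T : topologicalType) (x : T) (P : I -> T -> Prop) :
  (forall i, \forall y \near x, P i y) -> \forall y \near x, forall i, P i y.
Proof. exact: filter_forall. Qed.

Lemma near_open (T : topologicalType) (x : T) (A : set T) :
  open A -> A x -> \forall y \near x, A y.
Proof. by move=> oA Ax; exact: open_nbhs_nbhs. Qed.

Lemma near_eq_continuous (T U : topologicalType) (x : T) (f g : T -> U) :
  (\forall y \near x, f y = g y) -> {for x, continuous f} -> {for x, continuous g}.
Proof.
move=> fg; rewrite /prop_for /continuous_at -(nbhs_singleton fg).
by apply: cvg_trans; exact: near_eq_cvg.
Qed.

End Near.

Section Differentials.
Variable R : realType.
Implicit Types V W Z : normedModType R.

Lemma is_diff_eps V W (f : V -> W) (L : {linear V -> W}) (x : V) :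
  continuous L ->
  (forall e, 0 < e -> \forall y \near x, `|f y - f x - L (y - x)| <= e * `|y - x|) ->
  is_diff x f L.
Proof.
move=> cL h.
have key : f \o shift x = cst (f x) + L +o_ 0 id.
  apply/eqaddoP => e e0.
  have := h _ e0; rewrite (near_shift 0) /=; apply: filterS => y.
  by rewrite /= subr0 addrK opprD addrA.
have dE := diff_unique cL key.
by apply: DiffDef; [apply/diff_locallyP; rewrite dE|].
Qed.

Lemma is_diff_near V W (f : V -> W) (x : V) : differentiable f x ->
  forall e, 0 < e ->
  \forall y \near x, `|f y - f x - 'd f x (y - x)| <= e * `|y - x|.
Proof.
move=> df e e0; have [_ /eqaddoP/(_ e e0) h] := (diff_locallyP _ _).1 df.
rewrite (near_shift 0) /=; apply: filterS h => y.
by rewrite /= subr0 addrK opprD addrA.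
Qed.

Lemma near_eq_is_diff V W (f g : V -> W) (x : V) :
  (\forall y \near x, f y = g y) -> differentiable f x -> is_diff x g ('d f x).
Proof.
move=> fg df; apply: is_diff_eps => [|e e0]; first exact: diff_continuous.
have fgx := nbhs_singleton fg.
by apply: filterS2 fg (is_diff_near df e0) => y <-; rewrite fgx.
Qed.

Lemma near_eq_differentiable V W (f g : V -> W) (x : V) :
  (\forall y \near x, f y = g y) -> differentiable f x -> differentiable g x.
Proof. by move=> fg df; have [] := near_eq_is_diff fg df. Qed.

Lemma near_eq_diff V W (f g : V -> W) (x : V) :
  (\forall y \near x, f y = g y) -> differentiable f x ->
  'd g x = 'd f x :> (V -> W).
Proof. by move=> fg df; have [] := near_eq_is_diff fg df. Qed.

Lemma is_diff_unique V W (f df df' : V -> W) (x : V) :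
  is_diff x f df -> is_diff x f df' -> df =1 df'.
Proof. by move=> [_ <-] [_ <-]. Qed.

Lemma is_diffE V W (f df : V -> W) x v : is_diff x f df -> 'd f x v = df v.
Proof. by move=> [_ ->]. Qed.

Lemma near_is_diff V W (f g df : V -> W) x :
  (\forall y \near x, f y = g y) -> is_diff x f df -> is_diff x g df.
Proof. by move=> fg [df' e]; apply: is_diff_eq (near_eq_is_diff fg df') e. Qed.

Lemma scale_is_bilinear W :
  bilinear_for
    (GRing.Scale.Law.clone _ _ *:%R _) (GRing.Scale.Law.clone _ _ *:%R _)
    (@GRing.scale R W).
Proof.
split=> [u'|u] a x y /=; first by rewrite scalerDl scalerA.
by rewrite scalerDr !scalerA mulrC.
Qed.

Lemma is_diff_scale V W (k : V -> R) (f : V -> W) (x : V) :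
  differentiable k x -> differentiable f x ->
  is_diff x (fun y => k y *: f y) (fun v => k x *: 'd f x v + 'd k x v *: f x).
Proof.
move=> dk df.
pose sM := bilinear_isBilinear.Build R R W W _ _ (@GRing.scale R W)
  (@scale_is_bilinear W).
pose sB : {bilinear R -> W -> W} := HB.pack (@GRing.scale R W) sM.
have sc : continuous (fun p : R * W => sB p.1 p.2).
  by move=> p; apply: scale_continuous.
have := @dbilin _ _ _ _ sB (k x, f x) sc.
have dB := @differentiable_bilin _ _ _ _ sB (k x, f x) sc.
have BE := @diff_bilin _ _ _ _ sB (k x, f x) sc.
have dp := differentiable_pair dk df.
split; first exact: (differentiable_comp dp dB).
rewrite (_ : (fun y => _) = (fun p => sB p.1 p.2) \o (fun y => (k y, f y))) //.
rewrite diff_comp // (diff_pair dk df) BE.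
by apply/funext.
Qed.

Lemma is_diff_mul_fun V W (k dk : V -> R) (f df : V -> W) (x : V) :
  is_diff x k dk -> is_diff x f df ->
  is_diff x (fun y => k y *: f y) (fun v => k x *: df v + dk v *: f x).
Proof. by move=> [? <-] [? <-]; exact: is_diff_scale. Qed.

Lemma linear_rV_continuous n W (L : {linear 'rV[R]_n -> W}) : continuous L.
Proof.
have -> : (L : _ -> _) = fun x => \sum_i x 0 i *: L (delta_mx 0 i).
  by apply/funext => x; rewrite {1}(row_sum_delta x) linear_sum;
     apply: eq_bigr => i _; rewrite linearZ.
apply: continuous_big => [|i _]; first exact: add_continuous.
move=> x; apply: (@continuousZ _ _ _ (fun M : 'rV_n => M 0 i) (cst _)).
  exact: coord_continuous.
exact: cst_continuous.
Qed.

Lemma is_diff_linear n W (L : {linear 'rV[R]_n -> W}) x : is_diff x L L.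
Proof.
have cL := @linear_rV_continuous _ _ L.
by split; [exact: linear_differentiable|exact: diff_lin].
Qed.

Lemma diff_sum_coord n W (L : {linear 'rV[R]_n -> W}) v :
  L v = \sum_i v 0 i *: L (delta_mx 0 i).
Proof.
by rewrite {1}(row_sum_delta v) linear_sum; apply: eq_bigr => i _; rewrite linearZ.
Qed.

End Differentials.

(** * Functions of class C^k *)

Section Ck.
Variable R : realType.
Implicit Types (V W Z : normedModType R) (k : nat).

Lemma Ck_sub V W k (A B : set V) (F : V -> W) : B `<=` A -> Ck k A F -> Ck k B F.
Proof.
move=> BA; elim: k F => [|k IH] F /=; first by move=> h x /BA; exact: h.
by move=> [dF h]; split=> [x /BA /dF //|v]; exact: IH.
Qed.

Lemma CkS V W k (A : set V) (F : V -> W) : Ck k.+1 A F -> Ck k A F.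
Proof.
elim: k F => [|k IH] F /=; last by move=> [dF h]; split=> // v; exact: IH.
by move=> [dF _] x /dF; exact: differentiable_continuous.
Qed.

(** Openness of [A] makes an equality on [A] pass to the differentials. *)
Lemma Ck_eq V W k (A : set V) (F G : V -> W) : open A ->
  (forall x, A x -> F x = G x) -> Ck k A F -> Ck k A G.
Proof.
move=> oA; have nA x : A x -> \forall y \near x, A y by move=> Ax; exact: open_nbhs_nbhs.
elim: k F G => [|k IH] F G FG /=.
  by move=> cF x Ax; apply: near_eq_continuous (cF x Ax); apply: near_mono (nA x Ax) => y /FG.
have FGn x : A x -> \forall y \near x, F y = G y.
  by move=> Ax; apply: filterS (nA x Ax) => y /FG.
move=> [dF h]; split=> [x Ax|v].
  exact: near_eq_differentiable (FGn x Ax) (dF x Ax).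
by apply: IH (h v) => x Ax; rewrite (near_eq_diff (FGn x Ax) (dF x Ax)).
Qed.

Lemma Ck_cst V W k (A : set V) (a : W) : Ck k A (fun=> a).
Proof.
elim: k a => [|k IH] a /=; first by move=> x _; exact: cvg_cst.
split=> [x _|v]; first exact: differentiable_cst.
rewrite (_ : (fun x => _) = fun=> 0) //.
by apply/funext => x; rewrite (diff_cst a x).
Qed.


Lemma Ck_ext V W k (A : set V) (F G : V -> W) : F =1 G -> Ck k A F -> Ck k A G.
Proof. by move=> /funext ->. Qed.

Section rules.
Variables (V : normedModType R) (A : set V).
Hypothesis oA : open A.

Lemma CkD W k (F G : V -> W) : Ck k A F -> Ck k A G -> Ck k A (fun x => F x + G x).
Proof.
elim: k F G => [|k IH] F G /=.
  by move=> cF cG x Ax; apply: continuousD; [exact: cF|exact: cG].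
move=> [dF hF] [dG hG].
have dFG x (Ax : A x) : is_diff x (fun y => F y + G y) (fun h => 'd F x h + 'd G x h).
  exact: is_diffD (differentiableP (dF x Ax)) (differentiableP (dG x Ax)).
split=> [x Ax|v]; first by have [] := dFG x Ax.
by apply: Ck_eq (IH _ _ (hF v) (hG v)) => // x Ax; have [_ ->] := dFG x Ax.
Qed.

Lemma CkZ W k (f : V -> R) (G : V -> W) :
  Ck k A f -> Ck k A G -> Ck k A (fun x => f x *: G x).
Proof.
elim: k f G => [|k IH] f G.
  by move=> cF cG x Ax; apply: continuousZ; [exact: cF|exact: cG].
move=> cf cG; have [df hf] := cf; have [dG hG] := cG.
have dfG x (Ax : A x) := is_diff_scale (df x Ax) (dG x Ax).
split=> [x Ax|v]; first by have [] := dfG x Ax.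
have := CkD (IH _ _ (CkS cf) (hG v)) (IH _ _ (hf v) (CkS cG)).
by apply: Ck_eq => // x Ax; have [_ ->] := dfG x Ax.
Qed.

Lemma CkM k (f g : V -> R) : Ck k A f -> Ck k A g -> Ck k A (fun x => f x * g x).
Proof. exact: CkZ. Qed.

Lemma CkN W k (F : V -> W) : Ck k A F -> Ck k A (fun x => - F x).
Proof.
move=> cF; have := CkZ (Ck_cst k A (-1 : R)) cF.
by apply: Ck_eq => // x _; rewrite scaleN1r.
Qed.

Lemma CkB W k (F G : V -> W) : Ck k A F -> Ck k A G -> Ck k A (fun x => F x - G x).
Proof. by move=> cF cG; apply: CkD => //; exact: CkN. Qed.

Lemma Ck_sum W k (I : Type) (r : seq I) (P : pred I) (F : I -> V -> W) :
  (forall i, P i -> Ck k A (F i)) -> Ck k A (fun x => \sum_(i <- r | P i) F i x).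
Proof.
move=> h; elim: r => [|i r IH].
  by apply: Ck_ext (Ck_cst k A 0) => x; rewrite big_nil.
case Pi: (P i); last by apply: Ck_ext IH => x; rewrite big_cons Pi.
by apply: Ck_ext (CkD (h i Pi) IH) => x; rewrite big_cons Pi.
Qed.

Lemma Ck_prod k (I : Type) (r : seq I) (F : I -> V -> R) :
  (forall i, Ck k A (F i)) -> Ck k A (fun x => \prod_(i <- r) F i x).
Proof.
move=> h; elim: r => [|i r IH].
  by apply: Ck_ext (Ck_cst k A (1 : R)) => x; rewrite big_nil.
by apply: Ck_ext (CkM (h i) IH) => x; rewrite big_cons.
Qed.

(** The derivative of [f^-1] is built from [f^-1] and the derivative of [f], so
    regularity climbs one degree at a time. *)
Lemma CkV k (f : V -> R) : (forall x, A x -> f x != 0) -> Ck k A f ->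
  Ck k A (fun x => (f x)^-1).
Proof.
move=> f0; elim: k => [|k IH] cf.
  by move=> x Ax; apply: continuousV; [exact: f0|exact: cf].
have [df hf] := cf; have cV := IH (CkS cf).
split=> [x Ax|v]; first by apply: differentiableV; [exact: df|exact: f0].
have := CkM (CkN (CkM cV cV)) (hf v).
apply: Ck_eq => // x Ax; rewrite diffV ?f0 //; last exact: df.
by rewrite /= -expr2 exprVn.
Qed.

End rules.

Lemma Ck_linear n W k (A : set 'rV[R]_n) (L : {linear 'rV[R]_n -> W}) : Ck k A L.
Proof.
case: k => [|k /=]; first by move=> x _; exact: linear_rV_continuous.
split=> [x _|v]; first by have [] := is_diff_linear L x.
rewrite (_ : (fun x => _) = fun=> L v); first exact: Ck_cst.
by apply/funext => x; have [_ ->] := is_diff_linear L x.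
Qed.

Lemma Ck_id n k (A : set 'rV[R]_n) : Ck k A id.
Proof. exact: (Ck_linear k A (idfun : {linear 'rV[R]_n -> 'rV[R]_n})). Qed.

Lemma coord_is_linear m n i j : linear (fun M : 'M[R]_(m, n) => M i j : R).
Proof. by move=> a u v; rewrite !mxE. Qed.

Definition coord_linear m n i j : {linear 'M[R]_(m, n) -> R} :=
  HB.pack (fun M : 'M[R]_(m, n) => M i j : R)
    (GRing.isLinear.Build R 'M[R]_(m, n) R _ (fun M : 'M[R]_(m, n) => M i j : R)
      (@coord_is_linear m n i j)).

Lemma is_diff_coord V m n (F : V -> 'M[R]_(m, n)) x i j : differentiable F x ->
  is_diff x (fun y => F y i j) (fun v => 'd F x v i j).
Proof.
move=> dF; have dc := differentiable_coord (F x) i j.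
have cc : continuous (coord_linear i j) by exact: coord_continuous.
split; first exact: (differentiable_comp dF dc).
rewrite (_ : (fun y => F y i j) = coord_linear i j \o F) //.
by rewrite (diff_comp dF dc) (diff_lin _ cc).
Qed.

Lemma is_diff_entry V m n (F dF : V -> 'M[R]_(m, n)) x i j : is_diff x F dF ->
  is_diff x (fun y => F y i j) (fun v => dF v i j).
Proof. by move=> [? <-]; exact: is_diff_coord. Qed.

Lemma Ck_coord V m n k (A : set V) (F : V -> 'M[R]_(m, n)) i j : open A ->
  Ck k A F -> Ck k A (fun x => F x i j).
Proof.
move=> oA; elim: k F => [|k IH] F.
  move=> cF x Ax; apply: (@continuous_comp _ _ _ F (fun M => M i j)).
    exact: cF.
  exact: coord_continuous.
move=> [dF hF]; split=> [x Ax|v]; first by have [] := is_diff_coord i j (dF x Ax).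
apply: Ck_eq (IH _ (hF v)) => // x Ax.
by have [_ ->] := is_diff_coord i j (dF x Ax).
Qed.

Lemma Ck_row V n k (A : set V) (F : V -> 'rV[R]_n) : open A ->
  (forall i, Ck k A (fun x => F x 0 i)) -> Ck k A F.
Proof.
move=> oA h.
have : Ck k A (fun x => \sum_i F x 0 i *: delta_mx 0 i : 'rV[R]_n).
  by apply: Ck_sum => // i _; apply: CkZ => //; exact: Ck_cst.
by apply: Ck_eq => // x _; rewrite -row_sum_delta.
Qed.

(** The chain rule expresses the derivative of the composite through the
    partial derivatives of [G], which are again functions of the inner variable. *)
Lemma Ck_comp V n W k (A : set V) (B : set 'rV[R]_n) (F : V -> 'rV[R]_n)
    (G : 'rV[R]_n -> W) : open A -> (forall x, A x -> B (F x)) ->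
  Ck k A F -> Ck k B G -> Ck k A (fun x => G (F x)).
Proof.
move=> oA AB; elim: k F G AB => [|k IH] F G AB.
  move=> cF cG x Ax; apply: (@continuous_comp _ _ _ F G); first exact: cF.
  by apply: cG; exact: AB.
move=> cF [dG hG]; have [dF hF] := cF.
split=> [x Ax|v]; first exact: (differentiable_comp (dF x Ax) (dG _ (AB _ Ax))).
have : Ck k A (fun x => \sum_i 'd F x v 0 i *: 'd G (F x) (delta_mx 0 i)).
  apply: Ck_sum => // i _; apply: CkZ => //; first exact: (Ck_coord 0 i oA (hF v)).
  exact: (IH _ (fun y => 'd G y (delta_mx 0 i)) AB (CkS cF) (hG _)).
apply: Ck_eq => // x Ax.
rewrite (_ : (fun x => G (F x)) = G \o F) //.
rewrite (diff_comp (dF x Ax) (dG _ (AB _ Ax))) /=.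
by rewrite [RHS]diff_sum_coord.
Qed.

End Ck.

(** * Smooth functions *)

Section Smooth.
Variable R : realType.
Implicit Types (V W Z : normedModType R).

Lemma smooth_ext V W (A : set V) (F G : V -> W) : F =1 G ->
  smooth_on A F -> smooth_on A G.
Proof. by move=> /funext ->. Qed.

Lemma smooth_differentiable V W (A : set V) (F : V -> W) x :
  smooth_on A F -> A x -> differentiable F x.
Proof. by move=> sF Ax; have [dF _] := sF 1%N; exact: dF. Qed.

Lemma smooth_continuous V W (A : set V) (F : V -> W) x :
  smooth_on A F -> A x -> {for x, continuous F}.
Proof. by move=> sF Ax; exact: (sF 0%N x Ax). Qed.

Lemma smooth_diff V W (A : set V) (F : V -> W) v :
  smooth_on A F -> smooth_on A (fun x => 'd F x v).
Proof. by move=> sF k; have [_] := sF k.+1; exact. Qed.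

Lemma smooth_sub V W (A B : set V) (F : V -> W) : B `<=` A ->
  smooth_on A F -> smooth_on B F.
Proof. by move=> BA sF k; exact: Ck_sub (sF k). Qed.

Lemma smooth_cst V W (A : set V) (a : W) : smooth_on A (fun=> a).
Proof. by move=> k; exact: Ck_cst. Qed.

Lemma smooth_linear n W (A : set 'rV[R]_n) (L : {linear 'rV[R]_n -> W}) :
  smooth_on A L.
Proof. by move=> k; exact: Ck_linear. Qed.

Lemma smooth_id n (A : set 'rV[R]_n) : smooth_on A id.
Proof. by move=> k; exact: Ck_id. Qed.

Section rules.
Variables (V : normedModType R) (A : set V).
Hypothesis oA : open A.

Lemma smooth_eq W (F G : V -> W) : (forall x, A x -> F x = G x) ->
  smooth_on A F -> smooth_on A G.
Proof. by move=> FG sF k; exact: Ck_eq (sF k). Qed.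

Lemma smoothD W (F G : V -> W) : smooth_on A F -> smooth_on A G ->
  smooth_on A (fun x => F x + G x).
Proof. by move=> sF sG k; exact: CkD. Qed.

Lemma smoothB W (F G : V -> W) : smooth_on A F -> smooth_on A G ->
  smooth_on A (fun x => F x - G x).
Proof. by move=> sF sG k; exact: CkB. Qed.

Lemma smoothZ W (f : V -> R) (G : V -> W) : smooth_on A f -> smooth_on A G ->
  smooth_on A (fun x => f x *: G x).
Proof. by move=> sF sG k; exact: CkZ. Qed.

Lemma smoothM (f g : V -> R) : smooth_on A f -> smooth_on A g ->
  smooth_on A (fun x => f x * g x).
Proof. by move=> sF sG k; exact: CkM. Qed.

Lemma smooth_sum W (I : Type) (r : seq I) (P : pred I) (F : I -> V -> W) :
  (forall i, P i -> smooth_on A (F i)) ->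
  smooth_on A (fun x => \sum_(i <- r | P i) F i x).
Proof. by move=> sF k; apply: Ck_sum => // i /sF. Qed.

Lemma smooth_prod (I : Type) (r : seq I) (F : I -> V -> R) :
  (forall i, smooth_on A (F i)) -> smooth_on A (fun x => \prod_(i <- r) F i x).
Proof. by move=> sF k; apply: Ck_prod => // i; exact: sF. Qed.

Lemma smoothV (f : V -> R) : (forall x, A x -> f x != 0) -> smooth_on A f ->
  smooth_on A (fun x => (f x)^-1).
Proof. by move=> f0 sf k; exact: CkV. Qed.

Lemma smooth_coord m n (F : V -> 'M[R]_(m, n)) i j : smooth_on A F ->
  smooth_on A (fun x => F x i j).
Proof. by move=> sF k; exact: Ck_coord. Qed.

Lemma smooth_row n (F : V -> 'rV[R]_n) :
  (forall i, smooth_on A (fun x => F x 0 i)) -> smooth_on A F.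
Proof. by move=> sF k; apply: Ck_row => // i; exact: sF. Qed.

Lemma smooth_comp n W (B : set 'rV[R]_n) (F : V -> 'rV[R]_n) (G : 'rV[R]_n -> W) :
  (forall x, A x -> B (F x)) -> smooth_on A F -> smooth_on B G ->
  smooth_on A (fun x => G (F x)).
Proof. by move=> AB sF sG k; exact: (Ck_comp oA AB). Qed.

(** The derivative of a smooth function is smooth jointly in the point and in
    the direction. *)
Lemma smooth_diff_comp n W (B : set 'rV[R]_n) (F v : V -> 'rV[R]_n)
    (G : 'rV[R]_n -> W) : (forall x, A x -> B (F x)) ->
  smooth_on A F -> smooth_on A v -> smooth_on B G ->
  smooth_on A (fun x => 'd G (F x) (v x)).
Proof.
move=> AB sF sv sG.
apply: (@smooth_ext _ _ _ (fun x => \sum_i v x 0 i *: 'd G (F x) (delta_mx 0 i))).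
  by move=> x; rewrite [RHS]diff_sum_coord.
apply: smooth_sum => i _; apply: smoothZ; first exact: smooth_coord.
exact: (smooth_comp AB sF (smooth_diff (delta_mx 0 i) sG)).
Qed.

Lemma smooth_row_mx m n (F : V -> 'rV[R]_m) (G : V -> 'rV[R]_n) :
  smooth_on A F -> smooth_on A G -> smooth_on A (fun x => row_mx (F x) (G x)).
Proof.
move=> sF sG; apply: smooth_row => i.
case: (split_ordP i) => j ->.
  by apply: smooth_ext (smooth_coord 0 j sF) => x; rewrite row_mxEl.
by apply: smooth_ext (smooth_coord 0 j sG) => x; rewrite row_mxEr.
Qed.

Lemma smooth_mulmxr m n (F : V -> 'rV[R]_m) (B : 'M[R]_(m, n)) :
  smooth_on A F -> smooth_on A (fun x => F x *m B).
Proof.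
move=> sF.
exact: (smooth_comp (fun _ _ => I) sF (smooth_linear setT (mulmxr B))).
Qed.

Lemma smooth_det n (M : V -> 'M[R]_n) :
  (forall i j, smooth_on A (fun x => M x i j)) -> smooth_on A (fun x => \det (M x)).
Proof.
move=> sM; rewrite /determinant; apply: smooth_sum => s _.
by apply: smoothM; [exact: smooth_cst|apply: smooth_prod => i].
Qed.

(** By Cramer's rule. *)
Lemma smooth_invmx n (M : V -> 'M[R]_n) : (forall x, A x -> M x \in unitmx) ->
  (forall i j, smooth_on A (fun x => M x i j)) ->
  forall i j, smooth_on A (fun x => invmx (M x) i j).
Proof.
move=> uM sM i j.
have : smooth_on A (fun x => (\det (M x))^-1 * cofactor (M x) j i).
  apply: smoothM.
    apply: smoothV; last exact: smooth_det.
    by move=> x /uM; rewrite unitmxE unitfE.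
  apply: smoothM; first exact: smooth_cst.
  apply: smooth_det => k l.
  by apply: smooth_ext (sM (lift j k) (lift i l)) => x; rewrite !mxE.
by apply: smooth_eq => x Ax; rewrite /invmx uM // !mxE.
Qed.

End rules.
End Smooth.

(** * Coordinates, lines and the mean value inequality *)

Section Lines.
Variable R : realType.
Implicit Types V W : normedModType R.

Lemma ler_coord_norm n (x : 'rV[R]_n) i : `|x 0 i| <= `|x|.
Proof.
rewrite [leRHS]/Num.Def.normr/= mx_normrE.
by apply: (@le_bigmax _ _ _ _ (fun ij : 'I_1 * 'I_n => `|x ij.1 ij.2|) (0, i)).
Qed.

Lemma rV_norm_le n (x : 'rV[R]_n) C : 0 <= C -> (forall i, `|x 0 i| <= C) -> `|x| <= C.
Proof.
move=> C0 h; rewrite [leLHS]/Num.Def.normr/= mx_normrE.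
by apply: bigmax_le => // -[i j] _; rewrite ord1.
Qed.

Lemma is_diff_row V n (F : V -> 'rV[R]_n) (L : {linear V -> 'rV[R]_n}) x :
  (forall i, is_diff x (fun y => F y 0 i) (fun h => L h 0 i)) -> is_diff x F L.
Proof.
move=> h.
have cL : continuous L.
  rewrite (_ : (L : _ -> _) = fun y => \sum_i L y 0 i *: delta_mx 0 i); last first.
    by apply/funext => y; rewrite -row_sum_delta.
  apply: continuous_big => [|i _]; first exact: add_continuous.
  move=> y; apply: (@continuousZ _ _ _ (fun y => L y 0 i) (cst _)); last exact: cst_continuous.
  have [di <-] := h i; exact: diff_continuous.
apply: is_diff_eps => // e e0.
have : \forall y \near x, forall i, `|F y 0 i - F x 0 i - L (y - x) 0 i| <= e * `|y - x|.
  apply: filter_forall => i; have [di dE] := h i.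
  by apply: filterS (is_diff_near di e0) => y; rewrite dE.
apply: filterS => y hy; apply: rV_norm_le => [|i]; first by rewrite mulr_ge0 // ltW.
by rewrite !mxE.
Qed.

Lemma is_derive_line V W (F : V -> W) (a v : V) (s : R) :
  differentiable F (a + s *: v) ->
  is_derive s 1 (fun s => F (a + s *: v)) ('d F (a + s *: v) v).
Proof.
move=> dF.
have dl : is_diff s (fun s => a + s *: v) ( *:%R^~ v).
  have := is_diffD (is_diff_cst a s) (is_diff_scalel s v).
  by rewrite add0r.
have [dl1 dl2] := dl.
have dc := differentiable_comp dl1 dF.
apply: DeriveDef; first exact/derivable1_diffP.
rewrite deriveE // (diff_comp dl1 dF) /= dl2.
by rewrite scale1r.
Qed.

(** Comparing with a fixed value [l] gives at once bounds of increments and of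
    remainders. *)
Lemma mean_value_ineq V (F : V -> R) (a v : V) (l C : R) :
  (forall s : R, 0 <= s <= 1 -> differentiable F (a + s *: v)) ->
  (forall s : R, 0 <= s <= 1 -> `|'d F (a + s *: v) v - l| <= C) ->
  `|F (a + v) - F a - l| <= C.
Proof.
move=> dF hC; pose u s := F (a + s *: v).
have du (s : R) : 0 <= s <= 1 -> is_derive s 1 u ('d F (a + s *: v) v).
  by move=> /dF; exact: is_derive_line.
have [s||c cI] := @MVT_segment R u (fun s => 'd F (a + s *: v) v) 0 1 ler01.
- by rewrite in_itv /= => /andP[s0 s1]; apply: du; rewrite !ltW.
- apply: continuous_in_subspaceT => s; rewrite inE /= in_itv /= => sI.
  have [ds _] := du s sI.
  exact/differentiable_continuous/derivable1_diffP.
rewrite /u scale1r scale0r addr0 subr0 mulr1 => ->.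
by apply: hC; move: cI; rewrite in_itv.
Qed.

End Lines.

(** * Integrals over the unit interval depending on a parameter *)

Section UnitIntegral.
Variable R : realType.

Definition int01 (f : R -> R) : R :=
  \int[lebesgue_measure]_(t in `[0%R, 1%R]%classic) f t.

(** Continuity is two-sided at the end points as well: the integrands below are
    defined on open sets that contain the closed segment. *)
Definition continuous01 (f : R -> R) : Prop :=
  forall t : R, 0 <= t <= 1 -> {for t, continuous f}.

Lemma continuous01_within f : continuous01 f -> {within `[0, 1], continuous f}.
Proof.
move=> cf; apply: continuous_in_subspaceT => t.
by rewrite inE /= in_itv; exact: cf.
Qed.

Lemma continuous01_integrable f : continuous01 f ->
  lebesgue_measure.-integrable `[0%R, 1%R]%classic (EFin \o f).
Proof.
move=> cf; apply: continuous_compact_integrable; first exact: segment_compact.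
exact: continuous01_within.
Qed.

Lemma int01_derive (u du : R -> R) : continuous01 du ->
  (forall t : R, 0 <= t <= 1 -> is_derive t 1 u (du t)) -> int01 du = u 1 - u 0.
Proof.
move=> cdu hu.
have cu (t : R) : 0 <= t <= 1 -> {for t, continuous u}.
  by move=> /hu[dt _]; exact/differentiable_continuous/derivable1_diffP.
rewrite /int01 /Rintegral (@continuous_FTC2 _ du u 0 1) //.
- exact: continuous01_within.
- split=> [t||].
  + by rewrite in_itv /= => /andP[t0 t1]; have [] : is_derive t 1 u (du t) by apply: hu; rewrite !ltW.
  + by apply: cvg_at_right_filter; apply: cu; rewrite lexx ler01.
  + by apply: cvg_at_left_filter; apply: cu; rewrite lexx ler01.
- move=> t; rewrite in_itv /= => /andP[t0 t1].
  have [_ <-] : is_derive t 1 u (du t) by apply: hu; rewrite !ltW.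
  by rewrite derive1E.
Qed.

Lemma continuous01Z a f : continuous01 f -> continuous01 (fun t => a * f t).
Proof. by move=> cf t /cf ct; apply: continuousM => //; exact: cst_continuous. Qed.

Lemma continuous01B f g : continuous01 f -> continuous01 g ->
  continuous01 (fun t => f t - g t).
Proof. by move=> cf cg t tI; apply: continuousB; [exact: cf|exact: cg]. Qed.

Lemma continuous01D f g : continuous01 f -> continuous01 g ->
  continuous01 (fun t => f t + g t).
Proof. by move=> cf cg t tI; apply: continuousD; [exact: cf|exact: cg]. Qed.

Lemma continuous01_sum (I : Type) (r : seq I) (F : I -> R -> R) :
  (forall i, continuous01 (F i)) -> continuous01 (fun t => \sum_(i <- r) F i t).
Proof.
move=> cF; elim: r => [|i r IH].
  rewrite (_ : (fun t => _) = fun=> 0); first by move=> t _; exact: cst_continuous.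
  by apply/funext => t; rewrite big_nil.
rewrite (_ : (fun t => _) = fun t => F i t + \sum_(i <- r) F i t).
  exact: continuous01D.
by apply/funext => t; rewrite big_cons.
Qed.

Lemma int01Z a f : continuous01 f -> int01 (fun t => a * f t) = a * int01 f.
Proof. by move=> cf; apply: RintegralZl => //; exact: continuous01_integrable. Qed.

Lemma int01B f g : continuous01 f -> continuous01 g ->
  int01 (fun t => f t - g t) = int01 f - int01 g.
Proof. by move=> cf cg; apply: RintegralB => //; exact: continuous01_integrable. Qed.

Lemma int01D f g : continuous01 f -> continuous01 g ->
  int01 (fun t => f t + g t) = int01 f + int01 g.
Proof. by move=> cf cg; apply: RintegralD => //; exact: continuous01_integrable. Qed.

Lemma int01_sum (I : Type) (r : seq I) (F : I -> R -> R) :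
  (forall i, continuous01 (F i)) ->
  int01 (fun t => \sum_(i <- r) F i t) = \sum_(i <- r) int01 (F i).
Proof.
move=> cF; elim: r => [|i r IH].
  rewrite big_nil (_ : (fun t => _) = fun t => 0 * (0 : R)).
    by rewrite (int01Z 0 (f := fun=> 0)) ?mul0r // => t _; exact: cst_continuous.
  by apply/funext => t; rewrite big_nil mul0r.
rewrite big_cons -IH -int01D //; last exact: continuous01_sum.
by congr int01; apply/funext => t; rewrite big_cons.
Qed.

Lemma int01_bound f C : continuous01 f ->
  (forall t : R, 0 <= t <= 1 -> `|f t| <= C) -> `|int01 f| <= C.
Proof.
move=> cf fC.
have C1 : int01 (fun=> C) = C.
  rewrite /int01 Rintegral_cst //= lebesgue_measure_itv /= lte_fin ltr01 oppr0 addr0.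
  by rewrite /= mulr1.
apply: (le_trans (le_normr_Rintegral _ (continuous01_integrable cf))) => //.
rewrite -[leRHS]C1; apply: le_Rintegral => //.
- apply: (@continuous01_integrable (fun t => `|f t|)) => t tI.
  by apply: continuous_comp; [exact: cf|exact: norm_continuous].
- by apply: (@continuous01_integrable (fun=> C)) => t tI; exact: cst_continuous.
Qed.

Lemma int01_dist f g C : continuous01 f -> continuous01 g ->
  (forall t : R, 0 <= t <= 1 -> `|f t - g t| <= C) -> `|int01 f - int01 g| <= C.
Proof.
by move=> cf cg h; rewrite -int01B //; apply: int01_bound => //; exact: continuous01B.
Qed.

End UnitIntegral.

(** * Differentiation under the integral sign and the radial potential *)

Section LinComb.
Variable R : realType.

Lemma lincomb_is_linear n (W : normedModType R) (c : 'I_n -> W) :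
  linear (fun h : 'rV[R]_n => \sum_j h 0 j *: c j).
Proof.
move=> a u v; rewrite scaler_sumr -big_split /=; apply: eq_bigr => j _.
by rewrite !mxE scalerDl scalerA.
Qed.

Definition lincomb n (W : normedModType R) (c : 'I_n -> W) :
    {linear 'rV[R]_n -> W} :=
  HB.pack (fun h : 'rV[R]_n => \sum_j h 0 j *: c j)
    (GRing.isLinear.Build R 'rV[R]_n W _ (fun h : 'rV[R]_n => \sum_j h 0 j *: c j)
      (lincomb_is_linear c)).

Lemma is_diff_lincomb n (W : normedModType R) (F : 'rV[R]_n -> W) D x :
  is_diff x F D -> is_diff x F (lincomb (fun j => D (delta_mx 0 j))).
Proof.
move=> [dF dE]; split=> //; apply/funext => h.
by rewrite [LHS]diff_sum_coord dE.
Qed.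

Lemma is_diff_sum (V W : normedModType R) (I : Type) (r : seq I)
    (F dF : I -> V -> W) x : (forall i, is_diff x (F i) (dF i)) ->
  is_diff x (fun y => \sum_(i <- r) F i y) (fun h => \sum_(i <- r) dF i h).
Proof.
move=> dFx; elim: r => [|i r IH].
  have nil (G : I -> V -> W) : (fun y => \sum_(i <- [::]) G i y) = cst 0.
    by apply/funext => y; rewrite big_nil.
  by rewrite !nil; exact: is_diff_cst.
have cons (G : I -> V -> W) : (fun y => \sum_(j <- i :: r) G j y)
    = G i + (fun y => \sum_(j <- r) G j y).
  by apply/funext => y; rewrite big_cons.
rewrite !cons.
exact: is_diffD.
Qed.

Lemma near_norm (V : normedModType R) (x : V) (P : V -> Prop) :
  (\forall y \near x, P y) -> exists2 d : R, 0 < d & forall y, `|y - x| < d -> P y.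
Proof.
move=> /nbhs_ballP[d /= d0 h]; exists d => // y yx; apply: h.
by rewrite -ball_normE /= distrC.
Qed.

End LinComb.

Section ParameterIntegral.
Variables (R : realType) (n : nat) (B : set 'rV[R]_n).
Hypothesis oB : open B.
Implicit Types q : R -> 'rV[R]_n -> R.

Definition jointly_continuous (W : normedModType R) (q : R -> 'rV[R]_n -> W) : Prop :=
  forall (t : R) x, 0 <= t <= 1 -> B x ->
    {for (t, x), continuous (fun p : R * 'rV[R]_n => q p.1 p.2)}.

Lemma jointly_continuous01 q x : jointly_continuous q -> B x ->
  continuous01 (fun t => q t x).
Proof.
move=> cq Bx t tI.
apply: (@continuous_comp _ _ _ (fun t => (t, x)) (fun p : R * 'rV[R]_n => q p.1 p.2)).
  rewrite /prop_for /continuous_at; exact: (cvg_pair cvg_id (cvg_cst x)).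
exact: cq.
Qed.

(** Compactness of the unit interval makes joint continuity uniform in the
    variable of integration. *)
Lemma jointly_continuous_uniform q x (e : R) : jointly_continuous q -> B x ->
  0 < e ->
  \forall y \near x, forall t : R, 0 <= t <= 1 -> `|q t y - q t x| <= e.
Proof.
move=> cq Bx e0.
have /compact_near_coveringP cov := @segment_compact R 0 1.
have := cov _ (nbhs x) (fun y t => `|q t y - q t x| <= e) _ _.
move=> /(_ _ _)/filterS; apply.
  by move=> y h t tI; apply: h; rewrite /= in_itv.
move=> t; rewrite /= in_itv /= => tI.
have e20 : 0 < e / 2 by rewrite divr_gt0.
have c1 : \forall p \near (t, x), `|q t x - q p.1 p.2| < e / 2.
  have /cvgrPdist_lt := cq t x tI Bx; exact.
have c2 : \forall s \near t, `|q t x - q s x| < e / 2.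
  have /cvgrPdist_lt := jointly_continuous01 cq Bx tI; exact.
have c3 : \forall s \near t & y \near x, `|q t x - q s x| < e / 2.
  exact: (filterS (P := fun p : R * 'rV[R]_n => `|q t x - q p.1 x| < e / 2)
            _ (cvg_fst c2)).
apply: filterS2 c1 c3 => -[s y] /= h1 h2.
rewrite (_ : q s y - q s x = (q t x - q s x) - (q t x - q s y)); last by ring.
apply: (le_trans (ler_normB _ _)).
by rewrite (splitr e) lerD // ltW.
Qed.

Lemma continuous_int01 q : jointly_continuous q ->
  forall x, B x -> {for x, continuous (fun y => int01 (fun t => q t y))}.
Proof.
move=> cq x Bx; apply/(@cvgrPdist_le _ _ _ (nbhs x) (nbhs_filter x)) => e e0.
have Bn : \forall y \near x, B y by exact: open_nbhs_nbhs.
apply: filterS2 Bn (jointly_continuous_uniform cq Bx e0) => y By h.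
apply: int01_dist; [exact: jointly_continuous01|exact: jointly_continuous01|].
by move=> t /h; rewrite distrC.
Qed.

(** The mean value inequality turns the uniform continuity of the partial
    derivatives into a bound of the remainder that is uniform in the variable of
    integration. *)
Lemma is_diff_int01 q (dq : R -> 'rV[R]_n -> 'I_n -> R) :
  jointly_continuous q -> (forall j, jointly_continuous (fun t x => dq t x j)) ->
  (forall (t : R) x, 0 <= t <= 1 -> B x -> is_diff x (q t) (lincomb (dq t x))) ->
  forall x, B x -> is_diff x (fun y => int01 (fun t => q t y))
    (lincomb (fun j => int01 (fun t => dq t x j))).
Proof.
move=> cq cdq dqP x Bx; apply: is_diff_eps => [|e e0].
  exact: linear_rV_continuous.
pose e1 := e / n.+1%:R.
have e10 : 0 < e1 by rewrite divr_gt0.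
have near1 : \forall y \near x, B y /\
    forall j (t : R), 0 <= t <= 1 -> `|dq t y j - dq t x j| <= e1.
  have Bn : \forall y \near x, B y by exact: open_nbhs_nbhs.
  have un : \forall y \near x, forall j (t : R), 0 <= t <= 1 ->
      `|dq t y j - dq t x j| <= e1.
    apply: (@filter_forall _ _ (fun j y => forall t : R, 0 <= t <= 1 ->
      `|dq t y j - dq t x j| <= e1) (nbhs x) (nbhs_filter x)) => j.
    exact: jointly_continuous_uniform.
  by apply: filterS2 Bn un => y By h; split.
have [d d0 hd] := near_norm near1.
apply/nbhs_ballP; exists d => //= y; rewrite -ball_normE /= distrC => yd.
have [By _] := hd y yd.
set v := y - x.
have cd j : continuous01 (fun t => dq t x j) := jointly_continuous01 (cdq j) Bx.
have cdv j : continuous01 (fun t => v 0 j * dq t x j) by exact: continuous01Z.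
under eq_bigr do rewrite -[_ *: _]int01Z //.
rewrite -int01_sum // -int01B; try exact: jointly_continuous01.
have cqB : continuous01 (fun t => q t y - q t x).
  by apply: continuous01B; exact: jointly_continuous01.
rewrite -int01B //; last exact: continuous01_sum.
apply: int01_bound => [|t tI].
  by apply: continuous01B => //; exact: continuous01_sum.
have seg (s : R) : 0 <= s <= 1 -> `|x + s *: v - x| < d.
  move=> /andP[s0 s1]; rewrite addrAC subrr add0r normrZ ger0_norm //.
  by apply: le_lt_trans yd; rewrite ler_piMl.
rewrite -[y](subrK x) -/v [v + x]addrC.
apply: mean_value_ineq => s sI; have [Bs hs] := hd _ (seg s sI).
  by have [] := dqP t _ tI Bs.
have [_ ->] := dqP t _ tI Bs.
rewrite -sumrB; apply: (le_trans (ler_norm_sum _ _ _)).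
have hj j : `|v 0 j *: dq t (x + s *: v) j - v 0 j * dq t x j| <= e1 * `|v|.
  rewrite [_ *: _]/(v 0 j * _) -mulrBr normrM mulrC ler_pM //; first exact: hs.
  exact: ler_coord_norm.
apply: (le_trans (ler_sum _ (fun j _ => hj j))).
rewrite sumr_const card_ord -mulr_natl mulrA ler_wpM2r //.
rewrite /e1 mulrCA; apply: ler_piMr; first exact: ltW.
by rewrite ler_pdivrMr // mul1r ler_nat.
Qed.

End ParameterIntegral.

Section JointlyContinuous.
Variables (R : realType) (n : nat) (B : set 'rV[R]_n).
Implicit Types q : R -> 'rV[R]_n -> R.
Local Notation jcont := (@jointly_continuous R n B R).

Lemma jcontM q1 q2 : jcont q1 -> jcont q2 -> jcont (fun t x => q1 t x * q2 t x).
Proof.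
by move=> c1 c2 t x tI Bx; apply: continuousM; [exact: c1|exact: c2].
Qed.

Lemma jcontD q1 q2 : jcont q1 -> jcont q2 -> jcont (fun t x => q1 t x + q2 t x).
Proof.
by move=> c1 c2 t x tI Bx; apply: continuousD; [exact: c1|exact: c2].
Qed.

Lemma jcont_cst a : jcont (fun _ _ => a).
Proof. by move=> t x tI Bx; exact: cst_continuous. Qed.

Lemma jcont_sum (I : Type) (r : seq I) (q : I -> R -> 'rV[R]_n -> R) :
  (forall i, jcont (q i)) -> jcont (fun t x => \sum_(i <- r) q i t x).
Proof.
move=> cq; elim: r => [|i r IH].
  rewrite (_ : (fun t x => _) = fun _ _ => 0); first exact: jcont_cst.
  by apply/funext => t; apply/funext => x; rewrite big_nil.
rewrite (_ : (fun t x => _) = fun t x => q i t x + \sum_(i <- r) q i t x).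
  exact: jcontD.
by apply/funext => t; apply/funext => x; rewrite big_cons.
Qed.

Lemma jcont_time : jcont (fun t _ => t).
Proof. by move=> t x tI Bx; exact: cvg_fst. Qed.

Lemma jcont_coord i : jcont (fun _ x => x 0 i).
Proof.
move=> t x tI Bx.
apply: (@continuous_comp _ _ _ (fun p : R * 'rV[R]_n => p.2) (fun y => y 0 i)).
  exact: cvg_snd.
exact: coord_continuous.
Qed.

Lemma jcont_ray m (f : 'rV[R]_n -> 'rV[R]_m) j :
  (forall (t : R) x, 0 <= t <= 1 -> B x -> B (t *: x)) ->
  (forall x, B x -> {for x, continuous f}) -> jcont (fun t x => f (t *: x) 0 j).
Proof.
move=> starB cf t x tI Bx.
apply: (@continuous_comp _ _ _ (fun p : R * 'rV[R]_n => p.1 *: p.2) (fun y => f y 0 j)).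
  exact: scale_continuous.
apply: (@continuous_comp _ _ _ f (fun y => y 0 j)); last exact: coord_continuous.
exact: cf (starB _ _ tI Bx).
Qed.

End JointlyContinuous.

Section RadialPotential.
Variables (R : realType) (n : nat) (B : set 'rV[R]_n).
Hypotheses (oB : open B)
  (starB : forall (t : R) x, 0 <= t <= 1 -> B x -> B (t *: x)).
Implicit Types w : 'rV[R]_n -> 'rV[R]_n.

(** The integral of the 1-form with components [w] along the segment from the
    origin to [x]. *)
Definition radial w x : R := int01 (fun t => \sum_i w (t *: x) 0 i * x 0 i).

Lemma radial0 w : radial w 0 = 0.
Proof.
rewrite /radial (_ : (fun t => _) = fun t => 0 * (0 : R)); last first.
  by apply/funext => t; rewrite big1 ?mulr0 // => i _; rewrite mxE mulr0.
by rewrite (int01Z 0 (f := fun=> 0)) ?mul0r // => t _; exact: cst_continuous.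
Qed.

Lemma radial_integrand_continuous w : (forall x, B x -> {for x, continuous w}) ->
  jointly_continuous B (fun t x => \sum_i w (t *: x) 0 i * x 0 i).
Proof.
move=> cw; apply: jcont_sum => i; apply: jcontM; last exact: jcont_coord.
exact: jcont_ray.
Qed.

Lemma radial_dist w w' x C :
  (forall x, B x -> {for x, continuous w}) ->
  (forall x, B x -> {for x, continuous w'}) -> B x ->
  (forall y, B y -> `|\sum_i (w y 0 i - w' y 0 i) * x 0 i| <= C) ->
  `|radial w x - radial w' x| <= C.
Proof.
move=> cw cw' Bx h; apply: int01_dist.
- exact: (jointly_continuous01 (radial_integrand_continuous cw) Bx).
- exact: (jointly_continuous01 (radial_integrand_continuous cw') Bx).
move=> t tI; rewrite -sumrB.
under eq_bigr do rewrite -mulrBl.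
exact: h (starB tI Bx).
Qed.

Definition radial_diff w (t : R) (x h : 'rV[R]_n) : R :=
  \sum_i (w (t *: x) 0 i * h 0 i + t * ('d w (t *: x) h 0 i * x 0 i)).

Lemma is_diff_radial_integrand w (t : R) x : 0 <= t <= 1 -> B x -> Ck 1 B w ->
  is_diff x (fun y => \sum_i w (t *: y) 0 i * y 0 i) (radial_diff w t x).
Proof.
move=> tI Bx [dw _]; apply: is_diff_sum => i.
have dwx := differentiableP (dw _ (starB tI Bx)).
have dc := is_diff_entry 0 i (is_diff_comp (is_diff_scaler t x) dwx).
have d3 : is_diff x (fun y : 'rV[R]_n => y 0 i : R) (fun h => h 0 i).
  exact: (@is_diff_linear R n R (@coord_linear R 1 n 0 i) x).
apply: is_diff_eq (is_diff_mul_fun dc d3) _; apply/funext => h.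
by rewrite /= linearZ /= mxE; congr (_ + _); exact/esym/mulrA.
Qed.

Lemma radial_diff_continuous w h : Ck 1 B w ->
  jointly_continuous B (fun t x => radial_diff w t x h).
Proof.
move=> cw; have [dw hw] := cw; apply: jcont_sum => i; apply: jcontD.
  apply: jcontM; last exact: jcont_cst.
  by apply: jcont_ray => // x Bx; exact: differentiable_continuous (dw x Bx).
apply: jcontM; first exact: jcont_time.
apply: jcontM; last exact: jcont_coord.
exact: (@jcont_ray _ _ _ _ (fun x => 'd w x h) _ starB (hw h)).
Qed.

Lemma is_diff_radial w x : Ck 1 B w -> B x ->
  is_diff x (radial w) (fun h => int01 (fun t => radial_diff w t x h)).
Proof.
move=> cw Bx.
have cw0 y (By : B y) : {for y, continuous w} := CkS cw y By.
have [d e] := is_diff_int01 oB (radial_integrand_continuous cw0)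
  (fun j => radial_diff_continuous (h := delta_mx 0 j) cw)
  (fun t y tI By => is_diff_lincomb (is_diff_radial_integrand tI By cw)) Bx.
split=> //; rewrite e; apply/funext => h /=.
have cd v : continuous01 (fun t => radial_diff w t x v).
  exact: (jointly_continuous01 (radial_diff_continuous (h := v) cw) Bx).
under eq_bigr do rewrite -[_ *: _]int01Z //.
rewrite -int01_sum; last by move=> j; exact: continuous01Z.
apply/eqP; rewrite -subr_eq0 -normr_le0; apply: int01_dist => //.
  by apply: continuous01_sum => j; exact: continuous01Z.
move=> t tI; rewrite normr_le0 subr_eq0; apply/eqP.
have [_ dE] := is_diff_radial_integrand tI Bx cw.
by rewrite -dE [RHS]diff_sum_coord; apply: eq_bigr => j _; rewrite dE.
Qed.

Lemma radial_C1 w : Ck 1 B w -> Ck 1 B (radial w).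
Proof.
move=> cw; split=> [x Bx|v x Bx]; first by have [] := is_diff_radial cw Bx.
have nB : \forall y \near x, B y by exact: open_nbhs_nbhs.
have dE y : B y -> int01 (fun t => radial_diff w t y v) = 'd (radial w) y v.
  by move=> By; have [_ ->] := is_diff_radial cw By.
have := continuous_int01 oB (radial_diff_continuous (h := v) cw) Bx.
by apply: near_eq_continuous; apply: near_mono nB => y; exact: dE.
Qed.

(** The homotopy formula behind the Poincare lemma: up to the exterior
    derivative of [w], the differential of the radial potential is [w], because
    [t * w (t x)] is a primitive of the closed part of the integrand. *)
Lemma radial_homotopy w x h C : Ck 1 B w -> B x ->
  (forall y, B y ->
     `|\sum_i ('d w y h 0 i * x 0 i - 'd w y x 0 i * h 0 i)| <= C) ->
  `|'d (radial w) x h - \sum_i w x 0 i * h 0 i| <= C.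
Proof.
move=> cw Bx hC; have [_ ->] := is_diff_radial cw Bx.
have [dw hw] := cw.
pose u t := t * \sum_i w (t *: x) 0 i * h 0 i.
pose du (t : R) := \sum_i (w (t *: x) 0 i * h 0 i + t * ('d w (t *: x) x 0 i * h 0 i)).
have cdu : continuous01 du.
  have : jointly_continuous B (fun t x' => \sum_i (w (t *: x') 0 i * h 0 i
      + t * ('d w (t *: x') x 0 i * h 0 i))).
    apply: jcont_sum => i; apply: jcontD.
      apply: jcontM; last exact: jcont_cst.
      by apply: jcont_ray => // y By; exact: differentiable_continuous (dw y By).
    apply: jcontM; first exact: jcont_time.
    apply: jcontM; last exact: jcont_cst.
    exact: (@jcont_ray _ _ _ _ (fun y => 'd w y x) _ starB (hw x)).
  by move=> /jointly_continuous01; exact.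
have duP (t : R) : 0 <= t <= 1 -> is_derive t 1 u (du t).
  move=> tI.
  have dwx := differentiableP (dw _ (starB tI Bx)).
  have d2 : is_diff t (fun s => \sum_i w (s *: x) 0 i * h 0 i)
     (fun s => \sum_i 'd w (t *: x) (s *: x) 0 i * h 0 i).
    apply: is_diff_sum => i.
    have dc := is_diff_entry 0 i (is_diff_comp (is_diff_scalel t x) dwx).
    apply: is_diff_eq (is_diff_mul_fun dc (is_diff_cst (h 0 i) t)) _.
    by apply/funext => s; rewrite scaler0 add0r.
  have d5 : is_diff t u _ := is_diff_mul_fun (is_diff_id t) d2.
  have [d6 e6] := d5.
  apply: DeriveDef; first exact/derivable1_diffP.
  have e7 := congr1 (@^~ (1 : R)) e6; rewrite /= in e7.
  rewrite deriveE // e7 scale1r [X in _ = X]big_split /= -mulr_sumr addrC.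
  by rewrite scale1r.
have <- : int01 du = \sum_i w x 0 i * h 0 i.
  by rewrite (int01_derive cdu duP) /u mul1r mul0r subr0 scale1r.
apply: int01_dist => //.
  exact: (jointly_continuous01 (radial_diff_continuous (h := h) cw) Bx).
move=> t tI; rewrite /radial_diff /du -sumrB.
under eq_bigr do rewrite opprD addrACA subrr add0r -mulrBr.
rewrite -mulr_sumr normrM; have /andP[t0 t1] := tI.
have := hC _ (starB tI Bx) => le1.
apply: le_trans le1; rewrite ger0_norm //.
by rewrite ler_piMl.
Qed.

End RadialPotential.

(** * Total differential systems with vanishing curvature *)

Section GeometricLimits.
Variable R : realType.

Definition halfpow (m : nat) : R := 2^-1 ^+ m.

Lemma halfpow_ge0 m : 0 <= halfpow m.
Proof. by rewrite exprn_ge0. Qed.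

Lemma halfpowS m : halfpow m.+1 = halfpow m / 2.
Proof. by rewrite /halfpow exprS mulrC. Qed.

Lemma halfpow_small (C e : R) : 0 < e -> exists m, C * halfpow m <= e.
Proof.
move=> e0; pose m := Num.bound (`|C| / e); exists m.
have hm : `|C| / e < m%:R by apply: archi_boundP; rewrite divr_ge0 // ltW.
have h2 : m%:R <= 2 ^+ m :> R by rewrite -natrX ler_nat ltnW // ltn_expl.
apply: (le_trans (ler_wpM2r (halfpow_ge0 m) (ler_norm C))).
rewrite /halfpow exprVn ler_pdivrMr ?exprn_gt0 // mulrC -ler_pdivrMr //.
exact: le_trans (ltW hm) h2.
Qed.

Lemma le_halfpow (a b C : R) : (forall m, a <= b + C * halfpow m) -> a <= b.
Proof.
move=> h; apply/ler_addgt0Pr => e e0.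
have [m hm] := halfpow_small C e0.
by apply: le_trans (h m) _; rewrite lerD2l.
Qed.

(** The intervals of radius [C * halfpow m] around [u m] are nested. *)
Lemma geometric_limit (u : nat -> R) (C : R) :
  (forall m, `|u m.+1 - u m| <= C * halfpow m.+1) ->
  exists l, forall m, `|u m - l| <= C * halfpow m.
Proof.
move=> hu.
pose a m := u m - C * halfpow m; pose b m := u m + C * halfpow m.
have C0 : 0 <= C.
  have := le_trans (normr_ge0 _) (hu 0%N).
  by rewrite pmulr_lge0 // halfpowS divr_gt0 // /halfpow expr0.
have step m : a m <= a m.+1 /\ b m.+1 <= b m.
  have := hu m; rewrite /a /b halfpowS ler_norml => /andP[h1 h2].
  by split; lra.
have amono m k : a m <= a (m + k)%N.
  by elim: k => [|k IH]; [rewrite addn0|rewrite addnS; apply: le_trans IH (step _).1].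
have bmono m k : b (m + k)%N <= b m.
  by elim: k => [|k IH]; [rewrite addn0|rewrite addnS; apply: le_trans (step _).2 IH].
have ab m : a m <= b m.
  by rewrite /a /b lerD2l ge0_cp // mulr_ge0 // halfpow_ge0.
have amb m k : a m <= b k.
  apply: le_trans (amono m k) _; apply: le_trans (ab _) _.
  by rewrite addnC; exact: bmono.
have ubA k : ubound (range a) (b k) by move=> _ [m _ <-].
have hsA : has_sup (range a) by split; [exists (a 0%N), 0%N|exists (b 0%N)].
exists (sup (range a)) => m.
have h1 : a m <= sup (range a) by apply: ub_le_sup; [exists (b 0%N)|exists m].
have h2 : sup (range a) <= b m by apply: ge_sup; [exists (a 0%N), 0%N|].
by rewrite ler_norml; move: h1 h2; rewrite /a /b; lra.
Qed.

Section UniformLimits.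
Variables (n : nat) (B : set 'rV[R]_n) (oB : open B).
Variables (G : nat -> 'rV[R]_n -> R) (g : 'rV[R]_n -> R) (C : R).
Hypothesis Gg : forall m x, B x -> `|G m x - g x| <= C * halfpow m.

Lemma uniform_limit_continuous :
  (forall m x, B x -> {for x, continuous (G m)}) ->
  forall x, B x -> {for x, continuous g}.
Proof.
move=> cG x Bx; apply/(@cvgrPdist_le _ _ _ (nbhs x) (nbhs_filter x)) => e e0.
have [m hm] : exists m, C * halfpow m <= e / 3 by apply: halfpow_small; rewrite divr_gt0.
have cGx : \forall y \near x, `|G m x - G m y| <= e / 3.
  have /cvgrPdist_le := cG m x Bx; apply; by rewrite divr_gt0.
apply: near_mono2 (near_open oB Bx) cGx => y By hy.
have h1 := Gg m Bx; have h2 := Gg m By.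
by move: h1 h2 hy; rewrite !ler_norml => /andP[? ?] /andP[? ?] /andP[? ?]; lra.
Qed.

(** The mean value inequality bounds the remainders of the approximants
    uniformly, and this bound survives the limit. *)
Lemma uniform_limit_diff (s : 'I_n -> 'rV[R]_n -> R) (C' : R) :
  (forall m x, B x -> differentiable (G m) x) ->
  (forall m x j, B x -> `|'d (G m) x (delta_mx 0 j) - s j x| <= C' * halfpow m) ->
  (forall j x, B x -> {for x, continuous (s j)}) ->
  forall x, B x -> is_diff x g (lincomb (fun j => s j x)).
Proof.
move=> dG dGs cs x Bx; apply: is_diff_eps => [|e e0].
  exact: linear_rV_continuous.
pose e1 := e / n.+1%:R.
have e10 : 0 < e1 by rewrite divr_gt0.
have ns : \forall y \near x, forall j, `|s j x - s j y| <= e1.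
  by apply: near_forall => j; have /cvgrPdist_le := cs j x Bx; exact.
have [d d0 hd] := near_norm (near_mono2 (fun _ => @conj _ _) (near_open oB Bx) ns).
apply/nbhs_ballP; exists d => //= y; rewrite -ball_normE /= distrC => yd.
have [By _] := hd y yd.
set v := y - x; apply: (@le_halfpow _ _ (n%:R * `|v| * C' + 2 * C)) => m.
have seg (t : R) : 0 <= t <= 1 -> `|x + t *: v - x| < d.
  move=> /andP[t0 t1]; rewrite addrAC subrr add0r normrZ ger0_norm //.
  by apply: le_lt_trans yd; rewrite ler_piMl.
have key : `|G m (x + v) - G m x - \sum_j v 0 j *: s j x|
    <= n%:R * `|v| * (C' * halfpow m + e1).
  apply: mean_value_ineq => t tI; have [Bt ht] := hd _ (seg t tI); first exact: dG.
  rewrite diff_sum_coord -sumrB; apply: (le_trans (ler_norm_sum _ _ _)).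
  have hj j : `|v 0 j *: 'd (G m) (x + t *: v) (delta_mx 0 j) - v 0 j *: s j x|
      <= `|v| * (C' * halfpow m + e1).
    rewrite -scalerBr normrM ler_pM // ?ler_coord_norm //.
    have h1 := dGs m _ j Bt; have h2 := ht j.
    by move: h1 h2; rewrite !ler_norml => /andP[? ?] /andP[? ?]; lra.
  apply: (le_trans (ler_sum _ (fun j _ => hj j))).
  by rewrite sumr_const card_ord -[X in X <= _]mulr_natl mulrA.
have ne1 : n%:R * `|v| * e1 <= e * `|v|.
  rewrite mulrAC ler_wpM2r // /e1 mulrCA; apply: ler_piMr; first exact: ltW.
  by rewrite ler_pdivrMr // mul1r ler_nat.
have vE : x + v = y by rewrite /v addrC subrK.
rewrite vE in key.
have h1 := Gg m Bx; have h2 := Gg m By.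
move: key h1 h2; rewrite mulrDr /= => key h1 h2.
set S := \sum_j _ in key *.
rewrite (_ : g y - g x - S = (G m y - G m x - S) + ((G m x - g x) - (G m y - g y))); last by ring.
apply: (le_trans (ler_normD _ _)).
have h3 := ler_normB (G m x - g x) (G m y - g y).
lra.
Qed.

End UniformLimits.
End GeometricLimits.

Section Picard.
Variables (R : realType) (n : nat) (B : set 'rV[R]_n).
Hypotheses (oB : open B)
  (starB : forall (t : R) x, 0 <= t <= 1 -> B x -> B (t *: x)).
Variables (Gam : 'I_n -> 'I_n -> 'I_n -> 'rV[R]_n -> R) (K r : R).
Hypotheses (C1Gam : forall i j k, Ck 1 B (Gam i j k))
  (boundGam : forall i j k x, B x -> `|Gam i j k x| <= K)
  (boundB : forall x, B x -> `|x| <= r)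
  (K0 : 0 <= K)
  (* The distance of successive iterates shrinks under a weaker bound; the factor
     1/8 makes the error of an iterate enter that of the next one with weight at
     most 1/4. *)
  (small : n%:R * (n%:R * K) * r <= 8^-1).
(** The integrability condition of the system [d_l g_j = \sum_k Gam l j k * g_k]
    that is solved here. *)
Hypothesis curvature0 : forall x (l i j m : 'I_n), B x ->
  'd (Gam i j m) x (delta_mx 0 l) - 'd (Gam l j m) x (delta_mx 0 i)
  + \sum_k (Gam i j k x * Gam l k m x - Gam l j k x * Gam i k m x) = 0.
Variable c : 'rV[R]_n.

Lemma sum_bound (F : 'I_n -> R) C : (forall i, `|F i| <= C) ->
  `|\sum_i F i| <= n%:R * C.
Proof.
move=> h; apply: (le_trans (ler_norm_sum _ _ _)).
apply: (le_trans (ler_sum _ (fun j _ => h j))).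
by rewrite sumr_const card_ord mulr_natl.
Qed.

(** The right-hand side of the system for the [j]-th component, as a 1-form. *)
Definition rhs_form (g : 'rV[R]_n -> 'rV[R]_n) j x : 'rV[R]_n :=
  \row_i \sum_k Gam i j k x * g x 0 k.

(** The constant 0 solves the homogeneous system, so the iteration starts with no
    error in [picard_error]; the value [c] at the origin enters at the first step. *)
Fixpoint picard (m : nat) : 'rV[R]_n -> 'rV[R]_n :=
  if m is m'.+1 then
    fun x => \row_j (c 0 j + radial (rhs_form (picard m') j) x)
  else fun=> 0.

Lemma rhs_form_C1 g j : Ck 1 B g -> Ck 1 B (rhs_form g j).
Proof.
move=> cg; apply: (Ck_row oB) => i.
apply: (@Ck_ext _ _ _ _ _ (fun x => \sum_k Gam i j k x * g x 0 k)).
  by move=> x; rewrite mxE.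
apply: (Ck_sum oB) => k _.
exact: (CkM oB (C1Gam i j k) (Ck_coord 0 k oB cg)).
Qed.

Lemma picard_C1 m : Ck 1 B (picard m).
Proof.
elim: m => [|m IH]; first exact: Ck_cst.
apply: (Ck_row oB) => j.
apply: (@Ck_ext _ _ _ _ _ (fun x => c 0 j + radial (rhs_form (picard m) j) x)).
  by move=> x; rewrite mxE.
exact: (CkD oB (Ck_cst 1 B (c 0 j)) (radial_C1 oB starB (rhs_form_C1 j IH))).
Qed.

Lemma rhs_form_continuous m j x : B x -> {for x, continuous (rhs_form (picard m) j)}.
Proof. exact: (CkS (rhs_form_C1 j (picard_C1 m))). Qed.

Lemma rhs_dist (g g' : 'I_n -> R) (d : R) l j x : B x ->
  (forall k, `|g k - g' k| <= d) ->
  `|\sum_k Gam l j k x * g k - \sum_k Gam l j k x * g' k| <= n%:R * (K * d).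
Proof.
move=> Bx h; rewrite -sumrB; apply: sum_bound => k.
by rewrite -mulrBr normrM ler_pM //; exact: boundGam.
Qed.

Let C := 2 * `|c|.
Let M := 2 * (n%:R * (K * C)).

Let C0 : 0 <= C. Proof. by rewrite mulr_ge0. Qed.

Lemma picard_step m x j : B x ->
  `|picard m.+1 x 0 j - picard m x 0 j| <= C * halfpow R m.+1.
Proof.
elim: m x j => [|m IH] x j Bx.
  rewrite !mxE subr0 (_ : radial _ x = 0); last first.
    rewrite /radial (_ : (fun t => _) = fun t => 0 * (0 : R)); last first.
      apply/funext => t; rewrite mul0r big1 // => i _.
      by rewrite mxE big1 ?mul0r // => k _; rewrite mxE mulr0.
    by rewrite (int01Z 0 (f := fun=> 0)) ?mul0r // => t _; exact: cst_continuous.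
  rewrite addr0 /C halfpowS /halfpow expr0 mul1r mulrAC mulfV // mul1r.
  exact: ler_coord_norm.
rewrite [picard m.+2 _ _ _]mxE [picard m.+1 _ _ _]mxE opprD addrACA subrr add0r.
set d := C * halfpow R m.+1 in IH.
apply: (@le_trans _ _ (n%:R * (n%:R * (K * d) * r))).
  apply: (radial_dist starB _ _ Bx) => [y By|y By|y By].
  - exact: (@rhs_form_continuous m.+1 j y By).
  - exact: (@rhs_form_continuous m j y By).
  apply: sum_bound => i; rewrite normrM; apply: ler_pM => //.
    by rewrite !mxE; apply: rhs_dist => // k; exact: IH.
  exact: le_trans (ler_coord_norm x i) (boundB Bx).
rewrite halfpowS (mulrA C) -/d.
have d0 : 0 <= d by rewrite mulr_ge0 // halfpow_ge0.
rewrite (_ : n%:R * _ = n%:R * (n%:R * K) * r * d); last by ring.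
apply: (le_trans (ler_wpM2r d0 small)).
by rewrite mulrC ler_wpM2l // lef_pV2 ?posrE // ler_nat.
Qed.

(** Closedness of the iterated 1-form fails only through the error of the
    previous iterate, because the curvature cancels the remaining terms. *)
Lemma rhs_form_curl m x (l i j : 'I_n) : B x ->
  'd (rhs_form (picard m) j) x (delta_mx 0 l) 0 i
  - 'd (rhs_form (picard m) j) x (delta_mx 0 i) 0 l
  = \sum_k (Gam i j k x * ('d (picard m) x (delta_mx 0 l) 0 k
                           - \sum_p Gam l k p x * picard m x 0 p)
           - Gam l j k x * ('d (picard m) x (delta_mx 0 i) 0 k
                           - \sum_p Gam i k p x * picard m x 0 p)).
Proof.
move=> Bx; set g := picard m.
have [dg _] : Ck 1 B g := picard_C1 m.
have [dr _] : Ck 1 B (rhs_form g j) := rhs_form_C1 j (picard_C1 m).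
have dE (a b : 'I_n) : 'd (rhs_form g j) x (delta_mx 0 b) 0 a
    = \sum_k (Gam a j k x * 'd g x (delta_mx 0 b) 0 k
              + 'd (Gam a j k) x (delta_mx 0 b) * g x 0 k).
  have d2 : is_diff x (fun y => rhs_form g j y 0 a)
      (fun h => \sum_k (Gam a j k x * 'd g x h 0 k + 'd (Gam a j k) x h * g x 0 k)).
    rewrite (_ : (fun y => _) = fun y => \sum_k Gam a j k y *: g y 0 k); last first.
      by apply/funext => y; rewrite mxE.
    apply: is_diff_sum => k; apply: is_diff_mul_fun.
      by apply: differentiableP; have [+ _] := C1Gam a j k; exact.
    by apply: is_diff_entry; exact: differentiableP (dg x Bx).
  exact: (is_diff_unique (is_diff_coord 0 a (dr x Bx)) d2 (delta_mx 0 b)).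
apply: (etrans (congr2 (fun a b => a - b) (dE i l) (dE l i))).
cbv beta; rewrite -sumrB.
have cur p := curvature0 l i j p Bx.
have : \sum_p g x 0 p * ('d (Gam i j p) x (delta_mx 0 l) - 'd (Gam l j p) x (delta_mx 0 i)
  + \sum_k (Gam i j k x * Gam l k p x - Gam l j k x * Gam i k p x)) = 0.
  by rewrite big1 // => p _; rewrite cur mulr0.
under eq_bigr do rewrite mulrDr mulr_sumr.
rewrite big_split /= exchange_big /= -big_split /= => cur0.
rewrite -[LHS]subr0 -[X in _ - X = _]cur0 -sumrB; apply: eq_bigr => k _.
rewrite !mulrBr !mulr_sumr.
have -> : \sum_p g x 0 p * (Gam i j k x * Gam l k p x - Gam l j k x * Gam i k p x)
   = \sum_p Gam i j k x * (Gam l k p x * g x 0 p)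
     - \sum_p Gam l j k x * (Gam i k p x * g x 0 p).
  by rewrite -sumrB; apply: eq_bigr => p _; ring.
ring.
Qed.

(** With [e m] for the error of the [m]-th iterate, [rhs_form_curl] and
    [radial_homotopy] give [e m.+1 <= e m / 4 + n * K * C * halfpow m.+1]; the
    constant [M] is chosen so that the bound [M * halfpow m] reproduces itself. *)
Lemma picard_error m x l j : B x ->
  `|'d (picard m) x (delta_mx 0 l) 0 j - \sum_k Gam l j k x * picard m x 0 k|
  <= M * halfpow R m.
Proof.
elim: m x l j => [|m IH] x l j Bx.
  rewrite /= (diff_cst (0 : 'rV[R]_n) x) mxE big1 => [|k _]; last by rewrite mxE mulr0.
  by rewrite subrr normr0 !mulr_ge0 // halfpow_ge0.
have [dp _] : Ck 1 B (picard m.+1) := picard_C1 m.+1.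
have cr : Ck 1 B (rhs_form (picard m) j) := rhs_form_C1 j (picard_C1 m).
have -> : 'd (picard m.+1) x (delta_mx 0 l) 0 j
    = 'd (radial (rhs_form (picard m) j)) x (delta_mx 0 l).
  have d2 : is_diff x (fun y => picard m.+1 y 0 j)
      ('d (radial (rhs_form (picard m) j)) x).
    rewrite (_ : (fun y => _) = cst (c 0 j) + radial (rhs_form (picard m) j)); last first.
      by apply/funext => y; rewrite mxE.
    have [dR _] := is_diff_radial oB starB cr Bx.
    by apply: is_diff_eq (is_diffD (is_diff_cst (c 0 j) x) (differentiableP dR)) _;
       rewrite add0r.
  exact: (is_diff_unique (is_diff_coord 0 j (dp x Bx)) d2 (delta_mx 0 l)).
set d := M * halfpow R m in IH *; set d' := C * halfpow R m.+1.
have d0 : 0 <= d by rewrite !mulr_ge0 // halfpow_ge0.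
have h1 : `|'d (radial (rhs_form (picard m) j)) x (delta_mx 0 l)
    - \sum_i rhs_form (picard m) j x 0 i * (delta_mx 0 l : 'rV_n) 0 i|
    <= n%:R * (n%:R * (2 * (K * d)) * r).
  apply: (radial_homotopy oB starB cr Bx) => y By.
  have -> : \sum_i ('d (rhs_form (picard m) j) y (delta_mx 0 l) 0 i * x 0 i
      - 'd (rhs_form (picard m) j) y x 0 i * (delta_mx 0 l : 'rV_n) 0 i)
      = \sum_i ('d (rhs_form (picard m) j) y (delta_mx 0 l) 0 i
         - 'd (rhs_form (picard m) j) y (delta_mx 0 i) 0 l) * x 0 i.
    rewrite sumrB [X in _ - X](bigD1 l) //= [X in _ - (_ + X)]big1; last first.
      by move=> i il; rewrite mxE eqxx (negbTE il) mulr0.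
    rewrite addr0 mxE !eqxx mulr1.
    rewrite (diff_sum_coord ('d (rhs_form (picard m) j) y) x) summxE -sumrB.
    by apply: eq_bigr => i _; rewrite mxE; ring.
  apply: sum_bound => i; rewrite normrM; apply: ler_pM => //; last first.
    exact: le_trans (ler_coord_norm x i) (boundB Bx).
  rewrite rhs_form_curl //; apply: sum_bound => k.
  apply: (le_trans (ler_normB _ _)).
  rewrite mulr_natl mulr2n lerD // normrM ler_pM //; try exact: boundGam; exact: IH.
have h2 : `|\sum_i rhs_form (picard m) j x 0 i * (delta_mx 0 l : 'rV_n) 0 i
    - \sum_k Gam l j k x * picard m.+1 x 0 k| <= n%:R * (K * d').
  have -> : \sum_i rhs_form (picard m) j x 0 i * (delta_mx 0 l : 'rV_n) 0 i
     = \sum_k Gam l j k x * picard m x 0 k.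
    rewrite (bigD1 l) //= big1 => [|i il]; last first.
      by rewrite [X in _ * X]mxE eqxx (negbTE il) mulr0.
    by rewrite addr0 [X in _ * X]mxE !eqxx mulr1 mxE.
  apply: rhs_dist => // k; rewrite distrC; exact: picard_step.
rewrite -(subrKA (\sum_i rhs_form (picard m) j x 0 i * (delta_mx 0 l : 'rV_n) 0 i)).
apply: (le_trans (ler_normD _ _)).
apply: (le_trans (lerD h1 h2)).
have h3 : n%:R * (n%:R * (2 * (K * d)) * r) <= d / 4.
  rewrite (_ : n%:R * _ = n%:R * (n%:R * K) * r * (2 * d)); last by ring.
  have d20 : 0 <= 2 * d by rewrite mulr_ge0.
  by apply: (le_trans (ler_wpM2r d20 small)); lra.
have h4 : n%:R * (K * d') = d / 4.
  by rewrite /d /d' halfpowS /M; field.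
rewrite h4 halfpowS (mulrA M) -/d; lra.
Qed.

(** The iterates and their differentials converge uniformly at a geometric
    rate, so the limit satisfies the system that the iterates satisfy up to an
    error tending to 0. *)
Lemma total_system_solution : B 0 -> exists g : 'rV[R]_n -> 'rV[R]_n,
  g 0 = c /\ forall x, B x ->
    forall j, is_diff x (fun y => g y 0 j)
      (lincomb (fun l => \sum_k Gam l j k x * g x 0 k)).
Proof.
move=> B0.
have ex (xj : 'rV[R]_n * 'I_n) : exists l, B xj.1 ->
    forall m, `|picard m xj.1 0 xj.2 - l| <= C * halfpow R m.
  have [Bx|nB] := pselect (B xj.1); last by exists 0.
  by have [l hl] := geometric_limit (fun m => picard_step m xj.2 Bx); exists l.
pose g x : 'rV[R]_n := \row_j sval (cid (ex (x, j))).
have gP x j m : B x -> `|picard m x 0 j - g x 0 j| <= C * halfpow R m.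
  by rewrite mxE; case: cid => l /= h Bx; exact: h.
exists g; split.
  apply/rowP => j; apply/eqP; rewrite -subr_eq0 -normr_le0.
  apply: (@le_halfpow _ _ _ (C / 2)) => m; rewrite add0r.
  have e0 : picard m.+1 0 0 j = c 0 j by rewrite /= mxE radial0 addr0.
  have := gP 0 j m.+1 B0; rewrite e0 halfpowS distrC.
  by rewrite (_ : C * (_ / 2) = C / 2 * halfpow R m) //; field.
move=> x Bx j.
have cg k y : B y -> {for y, continuous (fun y => g y 0 k)}.
  apply: (uniform_limit_continuous oB (G := fun m y => picard m y 0 k) (C := C)).
    by move=> m z Bz; exact: gP.
  by move=> m z Bz; apply: (Ck_coord 0 k oB (CkS (picard_C1 m))).
apply: (@uniform_limit_diff _ _ _ oB (fun m y => picard m y 0 j) _ C _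
  (fun l x => \sum_k Gam l j k x * g x 0 k) (M + n%:R * (K * C))); last exact: Bx.
- by move=> m z Bz; exact: gP.
- move=> m z Bz; have [dp _] := picard_C1 m.
  by have [] := is_diff_coord 0 j (dp z Bz).
- move=> m z l Bz; have [dp _] := picard_C1 m.
  have [_ ->] := is_diff_coord 0 j (dp z Bz).
  rewrite -(subrKA (\sum_k Gam l j k z * picard m z 0 k)).
  apply: (le_trans (ler_normD _ _)); rewrite mulrDl; apply: lerD.
    exact: picard_error.
  rewrite (_ : _ * halfpow R m = n%:R * (K * (C * halfpow R m))); last by ring.
  by apply: rhs_dist => // k; exact: gP.
- move=> l z Bz.
  have : Ck 0 B (fun x => \sum_k Gam l j k x * g x 0 k).
    apply: (Ck_sum oB) => k _; apply: (CkM oB (CkS (C1Gam l j k))).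
    by move=> y By; exact: cg.
  by move=> h; exact: h.
Qed.

End Picard.

(** * The inverse function theorem *)

Section InverseFunction.
Variables (R : realType) (n : nat).
Implicit Types x y z v : 'rV[R]_n.

Lemma contraction_fixed_point (T : 'rV[R]_n -> 'rV[R]_n) (x0 : 'rV[R]_n) (r : R) :
  0 <= r -> (forall x, `|x0 - x| <= r -> `|x0 - T x| <= r) ->
  (forall x y, `|x0 - x| <= r -> `|x0 - y| <= r -> `|T x - T y| <= 2^-1 * `|x - y|) ->
  exists2 p, `|x0 - p| <= r & T p = p.
Proof.
move=> r0 TU Tc.
pose U : set 'rV[R]_n := closed_ball_ Num.Def.normr x0 r.
have TUU : set_fun U U T by move=> x; exact: TU.
pose F : {fun U >-> U} := HB.pack T (isFun.Build _ _ U U T TUU).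
have ctr : is_contraction F.
  exists 2^-1%:nng; split=> /=; first by rewrite invf_lt1 // ltr1n.
  by move=> [x y] [Ux Uy]; exact: Tc.
pose X : completeNormedModType R := HB.pack 'rV[R]_n.
have [||p Up pE] := @banach_fixed_point R X U F ctr.
- exact: closed_closed_ball_.
- by exists x0; rewrite /U /closed_ball_ /= subrr normr0.
by exists p => //; rewrite [RHS]pE.
Qed.

Definition jac (F : 'rV[R]_n -> 'rV[R]_n) x : 'M[R]_n :=
  \matrix_(i, j) 'd F x (delta_mx 0 i) 0 j.

Lemma mul_jac F x v : v *m jac F x = 'd F x v.
Proof.
apply/rowP => j; rewrite (diff_sum_coord ('d F x) v) summxE mxE.
by apply: eq_bigr => i _; rewrite !mxE.
Qed.

Section Inverse.
Variables (phi : 'rV[R]_n -> 'rV[R]_n) (V : set 'rV[R]_n).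
Hypotheses (oV : open V) (sphi : smooth_on V phi).
Hypothesis lip : forall x y, V x -> V y -> `|(phi x - x) - (phi y - y)| <= 2^-1 * `|x - y|.
Hypothesis dlip : forall x v, V x -> `|'d phi x v - v| <= 2^-1 * `|v|.

(** [phi] differs from the identity by a map with Lipschitz constant 1/2. *)
Lemma phi_expands x y : V x -> V y -> `|x - y| <= 2 * `|phi x - phi y|.
Proof.
move=> Vx Vy; have := lip Vx Vy.
rewrite (_ : phi x - x - (phi y - y) = (phi x - phi y) - (x - y)); last first.
  by apply/rowP => j; rewrite !mxE; ring.
have := lerB_normD (x - y) (phi x - phi y - (x - y)).
rewrite [x - y + _]addrC subrK; lra.
Qed.

Lemma jac_unit x : V x -> jac phi x \in unitmx.
Proof.
move=> Vx; rewrite -row_free_unit; apply/inj_row_free => v.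
rewrite mul_jac => v0; have := dlip v Vx; rewrite v0 sub0r normrN => h.
by apply/eqP; rewrite -normr_le0; have := normr_ge0 v; lra.
Qed.

(** [phi x = z] says that [x] is a fixed point of [x |-> z - (phi x - x)], which
    maps a small closed ball to itself when [z] is close to the image of its
    centre. *)
Lemma open_image : open (phi @` V).
Proof.
rewrite openE => _ [x1 Vx1 <-].
have [d d0 hd] := near_norm (near_open oV Vx1).
pose r := d / 2; have r0 : 0 < r by rewrite divr_gt0.
have sub x : `|x1 - x| <= r -> V x.
  move=> h; apply: hd; rewrite distrC; apply: le_lt_trans h _.
  by rewrite ltr_pdivrMr // ltr_pMr // ltr1n.
apply/nbhs_ballP; exists (r / 2) => /=; first by rewrite divr_gt0.
move=> z; rewrite -ball_normE /= => zr.
have [|||x x1x pE] := @contraction_fixed_point (fun x => z - (phi x - x)) x1 r.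
- exact: ltW.
- move=> x hx; have := lip (sub _ hx) Vx1.
  rewrite (_ : x1 - (z - (phi x - x))
      = (phi x1 - z) + ((phi x - x) - (phi x1 - x1))); last first.
    by apply/rowP => j; rewrite !mxE; ring.
  have := ler_normD (phi x1 - z) ((phi x - x) - (phi x1 - x1)).
  rewrite [`|x - x1|]distrC; lra.
- move=> x y hx hy.
  rewrite (_ : z - _ - _ = (phi y - y) - (phi x - x)); last by apply/rowP => j; rewrite !mxE; ring.
  by rewrite distrC; exact: lip (sub _ hx) (sub _ hy).
exists x; first exact: sub.
move: pE; rewrite opprB addrCA -[RHS]addr0 => /addrI/eqP.
by rewrite subr_eq0 => /eqP.
Qed.

Definition inverse_on (z : 'rV[R]_n) : 'rV[R]_n := xget 0 [set x | V x /\ phi x = z].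

Lemma inverse_onK x : V x -> inverse_on (phi x) = x.
Proof.
move=> Vx; rewrite /inverse_on.
case: xgetP => [y _ [Vy yx]|/(_ x) []//].
apply/eqP; rewrite -subr_eq0 -normr_le0.
by have := phi_expands Vy Vx; rewrite yx subrr normr0 mulr0.
Qed.

(** By [phi_expands] the inverse is Lipschitz, so the remainder of [phi] at [x],
    carried over by the inverse of the differential, remains negligible against
    [z - phi x]. *)
Lemma is_diff_inverse x : V x ->
  is_diff (phi x) inverse_on (mulmxr (invmx (jac phi x))).
Proof.
move=> Vx; set L := mulmxr _; have cL : continuous L by exact: linear_rV_continuous.
apply: is_diff_eps => // e e0.
have [k k0 hk] := linear_lipschitz cL.
pose e1 := e / (2 * k); have e10 : 0 < e1 by rewrite divr_gt0 // mulr_gt0.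
have dphi := smooth_differentiable sphi Vx.
have [d d0 hd] := near_norm (is_diff_near dphi e10).
have ophi := near_open open_image (ex_intro2 _ _ x Vx erefl : (phi @` V) (phi x)).
have [d' d'0 hd'] := near_norm ophi.
apply/nbhs_ballP; exists (Num.min d' (d / 2)) => /=.
  by rewrite lt_min d'0 divr_gt0.
move=> z; rewrite -ball_normE /= distrC lt_min => /andP[zd' zd].
have [y Vy yz] := hd' _ zd'; rewrite -yz in zd *.
rewrite !inverse_onK //.
have yx := phi_expands Vy Vx.
have yd : `|y - x| < d by move: zd yx; lra.
have -> : y - x - L (phi y - phi x) = L ('d phi x (y - x) - (phi y - phi x)).
  by rewrite [RHS]linearB; congr (_ - _); rewrite /L /= -mul_jac mulmxK // jac_unit.
apply: (le_trans (hk _)); rewrite distrC.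
have := hd y yd => h.
apply: (le_trans (ler_wpM2l (ltW k0) h)).
rewrite mulrA; apply: (@le_trans _ _ (k * e1 * (2 * `|phi y - phi x|))).
  by apply: ler_wpM2l yx; rewrite mulr_ge0 // ltW.
rewrite mulrA ler_wpM2r //.
rewrite (_ : k * e1 * 2 = e) //; rewrite /e1; field.
by rewrite gt_eqF.
Qed.

(** The differential of the inverse is a smooth function of the inverse itself,
    so its regularity climbs one degree at a time. *)
Lemma smooth_inverse : smooth_on (phi @` V) inverse_on.
Proof.
have oW := open_image.
have dpsi z : (phi @` V) z ->
    is_diff z inverse_on (mulmxr (invmx (jac phi (inverse_on z)))).
  by move=> [x Vx <-]; rewrite inverse_onK //; exact: is_diff_inverse.
have VW z : (phi @` V) z -> V (inverse_on z) by move=> [x Vx <-]; rewrite inverse_onK.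
elim=> [|k IH].
  by move=> z Wz; have [d _] := dpsi z Wz; exact: differentiable_continuous.
split=> [z Wz|v]; first by have [] := dpsi z Wz.
have sJ i j : smooth_on V (fun x => invmx (jac phi x) i j).
  apply: (smooth_invmx oV jac_unit) => a b.
  apply: (@smooth_ext _ _ _ _ (fun x => 'd phi x (delta_mx 0 a) 0 b)).
    by move=> x; rewrite mxE.
  exact: (smooth_coord oV 0 b (smooth_diff (delta_mx 0 a) sphi)).
have cJ j : Ck k (phi @` V) (fun z => \sum_i v 0 i * invmx (jac phi (inverse_on z)) i j).
  apply: (Ck_sum oW) => i _; apply: (CkM oW (Ck_cst k _ (v 0 i))).
  exact: (Ck_comp oW VW IH (sJ i j k)).
have : Ck k (phi @` V) (fun z => v *m invmx (jac phi (inverse_on z))).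
  apply: (Ck_row oW) => j; apply: Ck_ext (cJ j) => z; by rewrite mxE.
by apply: (Ck_eq oW) => z Wz; have [_ ->] := dpsi z Wz.
Qed.

End Inverse.

(** Near a point where the differential is the identity, [phi] is a Lipschitz
    perturbation of the identity with constant 1/2. *)
Lemma inverse_function (phi : 'rV[R]_n -> 'rV[R]_n) (B : set 'rV[R]_n) x0 :
  open B -> B x0 -> smooth_on B phi -> (forall v, 'd phi x0 v = v) ->
  exists (V : set 'rV[R]_n) (psi : 'rV[R]_n -> 'rV[R]_n), [/\ open V /\ V x0, V `<=` B,
    (open (phi @` V) /\ smooth_on (phi @` V) psi),
    (forall x, V x -> psi (phi x) = x) &
    (forall x, V x -> jac phi x \in unitmx)].
Proof.
move=> oB Bx0 sphi dphi0.
(* When [e] bounds the entries of the Jacobian matrix of [phi - id], sums of [n]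
   of them stay below 1/2. *)
pose e := (2 * n.+1%:R)^-1 : R.
have e0 : 0 < e by rewrite invr_gt0 mulr_gt0.
have near1 : \forall x \near x0, forall i j, `|'d phi x (delta_mx 0 i) 0 j - (delta_mx 0 i : 'rV_n) 0 j| <= e.
  apply: near_forall => i; apply: near_forall => j.
  have c := smooth_continuous (smooth_coord oB 0 j (smooth_diff (delta_mx 0 i) sphi)) Bx0.
  have E : (delta_mx 0 i : 'rV_n) 0 j = 'd phi x0 (delta_mx 0 i) 0 j.
    by congr (fun_of_matrix _ 0 j); exact: esym (dphi0 _).
  have /cvgrPdist_le/(_ e e0) := c; apply: near_mono => x h.
  by rewrite E distrC; exact: h.
have [d d0 hd] := near_norm (near_mono2 (fun _ => @conj _ _) (near_open oB Bx0) near1).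
pose V := [set x | `|x - x0| < d].
have VB : V `<=` B by move=> x /hd[].
have oV : open V.
  rewrite (_ : V = ball x0 d); first exact: ball_open.
  by apply/seteqP; split=> x; rewrite -ball_normE /V /= distrC.
have bound (F : 'I_n -> 'I_n -> R) v j : (forall i j, `|F i j| <= e) ->
    `|\sum_i v 0 i * F i j| <= 2^-1 * `|v|.
  move=> hF; apply: (@le_trans _ _ (n%:R * (`|v| * e))).
    apply: sum_bound => i; rewrite normrM ler_pM //; exact: ler_coord_norm.
  rewrite mulrCA mulrC ler_wpM2r // /e invfM mulrCA ler_piMr ?invr_ge0 //.
  by rewrite ler_pdivrMr // mul1r ler_nat.
have dlip x v : V x -> `|'d phi x v - v| <= 2^-1 * `|v|.
  move=> /hd[_ h]; apply: rV_norm_le => [|j]; first by rewrite mulr_ge0 ?invr_ge0.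
  have := bound (fun i j => 'd phi x (delta_mx 0 i) 0 j - (delta_mx 0 i : 'rV_n) 0 j) v j h.
  congr (`|_| <= _).
  under eq_bigr do rewrite mulrBr.
  rewrite sumrB !mxE; congr (_ - _).
    rewrite (diff_sum_coord ('d phi x) v) summxE.
    by apply: eq_bigr => i _; rewrite mxE.
  by rewrite [in RHS](row_sum_delta v) summxE; apply: eq_bigr => i _; rewrite [RHS]mxE.
have lip x y : V x -> V y -> `|(phi x - x) - (phi y - y)| <= 2^-1 * `|x - y|.
  move=> Vx Vy; apply: rV_norm_le => [|j]; first by rewrite mulr_ge0 ?invr_ge0.
  have seg (t : R) : 0 <= t <= 1 -> V (y + t *: (x - y)).
    move=> /andP[t0 t1]; rewrite /V /=.
    have -> : y + t *: (x - y) - x0 = (1 - t) *: (y - x0) + t *: (x - x0).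
      by apply/rowP => i; rewrite !mxE; ring.
    apply: (le_lt_trans (ler_normD _ _)); rewrite !normrZ !ger0_norm ?subr_ge0 //.
    have [->|tn0] := eqVneq t 0; first by rewrite subr0 mul1r mul0r addr0.
    have tp : 0 < t by rewrite lt_neqAle eq_sym tn0.
    have h1 : t * `|x - x0| < t * d by rewrite ltr_pM2l.
    have h2 : (1 - t) * `|y - x0| <= (1 - t) * d by rewrite ler_wpM2l ?subr_ge0 // ltW.
    by move: h1 h2; lra.
  have dcomp (z : 'rV[R]_n) : V z -> is_diff z (fun x => phi x 0 j - x 0 j) (fun v => 'd phi z v 0 j - v 0 j).
    move=> /VB Bz; have dz := differentiableP (smooth_differentiable sphi Bz).
    exact: is_diffB (is_diff_entry 0 j dz) (is_diff_entry 0 j (is_diff_id z)).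
  have := @mean_value_ineq R _ (fun x => phi x 0 j - x 0 j) y (x - y) 0 (2^-1 * `|x - y|).
  rewrite subr0 [y + _]addrC subrK !mxE; apply.
    by move=> t /seg /dcomp[].
  move=> t /seg Vt; have [_ ->] := dcomp _ Vt; rewrite subr0.
  apply: le_trans (dlip _ (x - y) Vt).
  by have := ler_coord_norm ('d phi (y + t *: (x - y)) (x - y) - (x - y)) j; rewrite !mxE.
exists V, (inverse_on phi V); split=> //.
- by split=> //; rewrite /V /= subrr normr0.
- split; first exact: open_image.
  by apply: smooth_inverse => //; exact: smooth_sub sphi.
- by move=> x Vx; exact: inverse_onK.
- by move=> x Vx; exact: (jac_unit dlip).
Qed.

End InverseFunction.

(** * Flat coordinates for symmetric coefficients with vanishing curvature *)

Section FlatCoordinates.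
Variables (R : realType) (n : nat).
Implicit Types x y z v : 'rV[R]_n.

Lemma lincomb_delta (W : normedModType R) (c : 'I_n -> W) i :
  lincomb c (delta_mx 0 i) = c i.
Proof.
rewrite /= (bigD1 i) //= big1 => [|l li]; last by rewrite mxE eqxx (negbTE li) scale0r.
by rewrite mxE !eqxx scale1r addr0.
Qed.

Lemma is_diff_translate (V W : normedModType R) (F : V -> W) (a x : V) :
  differentiable F (x + a) -> is_diff x (fun u => F (u + a)) ('d F (x + a)).
Proof.
move=> dF.
have dt : is_diff x (fun u => u + a) id.
  by apply: is_diff_eq (is_diffD (is_diff_id x) (is_diff_cst a x)) _; rewrite addr0.
exact: is_diff_comp dt (differentiableP dF).
Qed.

Lemma open_translate (V : normedModType R) (a : V) (A : set V) : open A ->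
  open [set u | A (u + a)].
Proof.
move=> oA; apply: (@open_comp _ _ (fun u => u + a)) => // u _.
by apply: continuousD; [exact: cvg_id|exact: cst_continuous].
Qed.

Lemma smooth_translate (W : normedModType R) (F : 'rV[R]_n -> W) a (A : set 'rV[R]_n) :
  open A -> smooth_on A F -> smooth_on [set x | A (x + a)] (fun x => F (x + a)).
Proof.
move=> oA sF; have oA' := open_translate a oA.
apply: (smooth_comp oA' (B := A)) => //.
exact: (smoothD oA' (smooth_id _) (smooth_cst _ a)).
Qed.

Section Origin.
Variables (U : set 'rV[R]_n) (Gam : 'I_n -> 'I_n -> 'rV[R]_n -> 'rV[R]_n).
Hypotheses (oU : open U) (U0 : U 0) (sGam : forall i j, smooth_on U (Gam i j)).
Hypothesis symGam : forall i j x, U x -> Gam i j x = Gam j i x.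
Hypothesis curvature0 : forall l i j x, U x ->
  'd (Gam i j) x (delta_mx 0 l) + \sum_k Gam i j x 0 k *: Gam l k x
  = 'd (Gam l j) x (delta_mx 0 i) + \sum_k Gam l j x 0 k *: Gam i k x.

Let Gamc i j k x : R := Gam i j x 0 k.

Lemma small_ball : exists r K : R, [/\ 0 < r, 0 <= K, ball 0 r `<=` U,
  (forall i j k x, ball 0 r x -> `|Gamc i j k x| <= K) &
  n%:R * (n%:R * K) * r <= 8^-1].
Proof.
pose K := \sum_i \sum_j \sum_k `|Gamc i j k 0| + 1.
have K0 : 0 <= K.
  by rewrite addr_ge0 // !sumr_ge0 // => i _; rewrite sumr_ge0 // => j _; rewrite sumr_ge0.
have near1 : \forall x \near (0 : 'rV[R]_n), forall i j k, `|Gamc i j k x| <= K.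
  apply: near_forall => i; apply: near_forall => j; apply: near_forall => k.
  have c := smooth_continuous (smooth_coord oU 0 k (sGam i j)) U0.
  have /cvgrPdist_le/(_ 1 ltr01) := c; apply: near_mono => x h.
  apply: (@le_trans _ _ (`|Gamc i j k 0| + 1)).
    rewrite -[X in `|X|](subKr (Gamc i j k 0)).
    by apply: (le_trans (ler_normB _ _)); rewrite lerD2l.
  rewrite lerD2r (bigD1 i) //= (bigD1 j) //= (bigD1 k) //= -!addrA lerDl.
  rewrite !addr_ge0 // sumr_ge0 // => i' _; rewrite sumr_ge0 // => j' _; exact: sumr_ge0.
have [d d0 hd] := near_norm (near_mono2 (fun _ => @conj _ _) (near_open oU U0) near1).
(* The summand 1 keeps [c] positive when [n] or [K] is 0. *)
pose c : R := 8 * (n%:R * (n%:R * K) + 1).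
have nK : 0 <= n%:R * (n%:R * K) :> R by rewrite !mulr_ge0.
have c0 : 0 < c by rewrite mulr_gt0 // ltr_wpDl.
exists (Num.min d c^-1), K; split => //.
- by rewrite lt_min d0 invr_gt0.
- move=> x; rewrite -ball_normE /= sub0r normrN lt_min => /andP[xd _].
  by have [|Ux _] := hd x; first by rewrite subr0.
- move=> i j k x; rewrite -ball_normE /= sub0r normrN lt_min => /andP[xd _].
  by have [|_ h] := hd x; [rewrite subr0|exact: h].
apply: (@le_trans _ _ (n%:R * (n%:R * K) * c^-1)).
  by rewrite ler_wpM2l // ge_min lexx orbT.
rewrite ler_pdivrMr // /c mulKf //; lra.
Qed.

(** Vanishing curvature provides, for each basis vector, a 1-form [G a] with that
    value at the origin and with components satisfying the total system: a
    parallel coframe. The symmetry of [Gam] in its lower indices makes these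
    1-forms closed, and their radial potentials are the coordinates of [phi].
    The last equation says that the coefficients [Gam] become 0 in these
    coordinates. *)
Lemma flat_coordinates_at0 : exists (B : set 'rV[R]_n) (phi : 'rV[R]_n -> 'rV[R]_n),
  [/\ open B /\ B 0, B `<=` U, smooth_on B phi, (forall v, 'd phi 0 v = v) &
   forall x, B x -> forall i j,
     'd (fun y => 'd phi y (delta_mx 0 j)) x (delta_mx 0 i) = 'd phi x (Gam i j x)].
Proof.
have [r [K [r0 K0 BU bGam small]]] := small_ball.
set B := ball 0 r in BU bGam *.
have B0 : B 0 by exact: ballxx.
have BE x : B x <-> `|x| < r by rewrite /B -ball_normE /= sub0r normrN.
have oB : open B by exact: ball_open.
have starB (t : R) x : 0 <= t <= 1 -> B x -> B (t *: x).
  move=> /andP[t0 t1] /BE xr; apply/BE; rewrite normrZ ger0_norm //.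
  by apply: le_lt_trans xr; rewrite ler_piMl.
have sG i j k : smooth_on B (Gamc i j k).
  exact: smooth_sub BU (smooth_coord oU 0 k (sGam i j)).
have cur x (l i j m : 'I_n) : B x ->
    'd (Gamc i j m) x (delta_mx 0 l) - 'd (Gamc l j m) x (delta_mx 0 i)
    + \sum_k (Gamc i j k x * Gamc l k m x - Gamc l j k x * Gamc i k m x) = 0.
  move=> /BU Ux.
  have dE a b v : 'd (Gamc a b m) x v = 'd (Gam a b) x v 0 m.
    have dc : is_diff x (Gamc a b m) (fun v => 'd (Gam a b) x v 0 m).
      exact: (is_diff_coord 0 m (smooth_differentiable (sGam a b) Ux)).
    exact: is_diffE dc.
  have alg (a b s1 s2 a' b' : R) : a = a' -> b = b' -> a' + s1 = b' + s2 ->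
      a - b + (s1 - s2) = 0 by move=> -> -> h; apply/eqP; rewrite addrACA h; lra.
  rewrite sumrB; apply: alg (dE i j _) (dE l j _) _.
  have := congr1 (fun u : 'rV[R]_n => u 0 m) (curvature0 l i j Ux).
  rewrite [X in X = _ -> _]mxE [X in _ = X -> _]mxE !summxE.
  by congr (_ + _ = _ + _); apply: eq_bigr => k _; rewrite mxE.
have bB x : B x -> `|x| <= r by move=> /BE /ltW.
have sol a := total_system_solution oB starB (fun i j k => sG i j k 1%N) bGam bB
  K0 small cur (delta_mx 0 a) B0.
have /choice[G GP] : forall a : 'I_n, exists g : 'rV[R]_n -> 'rV[R]_n,
    g 0 = delta_mx 0 a /\ forall x, B x -> forall j, is_diff x (fun y => g y 0 j)
      (lincomb (fun l => \sum_k Gamc l j k x * g x 0 k)).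
  exact: sol.
have G0 a : G a 0 = delta_mx 0 a by have [] := GP a.
pose S a x l i : R := \sum_k Gamc l i k x * G a x 0 k.
have dG a x : B x -> is_diff x (G a) (lincomb (fun l => \row_j S a x l j)).
  move=> Bx; apply: is_diff_row => j; have [_ h] := GP a.
  apply: is_diff_eq (h x Bx j) _; apply/funext => v.
  by rewrite /= summxE; apply: eq_bigr => l _; rewrite !mxE.
have sGa a : smooth_on B (G a).
  elim=> [|k IH].
    by move=> x Bx; have [d _] := dG a x Bx; exact: differentiable_continuous.
  split=> [x Bx|v]; first by have [] := dG a x Bx.
  have : Ck k B (fun x => \sum_l v 0 l *: (\row_j S a x l j)).
    apply: (Ck_sum oB) => l _; apply: (CkZ oB (Ck_cst k B (v 0 l))).
    apply: (Ck_row oB) => j.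
    apply: (@Ck_ext _ _ _ _ _ (fun x => S a x l j)) => [x|]; first by rewrite mxE.
    apply: (Ck_sum oB) => p _.
    exact: (CkM oB (sG l j p k) (Ck_coord 0 p oB IH)).
  by apply: (Ck_eq oB) => x Bx; have [_ ->] := dG a x Bx.
have dR a x : B x -> is_diff x (radial (G a)) (fun h => \sum_i G a x 0 i * h 0 i).
  move=> Bx; have [d _] := is_diff_radial oB starB (sGa a 1%N) Bx.
  split=> //; apply/funext => h; apply/eqP; rewrite -subr_eq0 -normr_le0.
  apply: (radial_homotopy oB starB (sGa a 1%N) Bx) => y By.
  have dE v i : 'd (G a) y v 0 i = \sum_l v 0 l * S a y l i.
    have [_ e] := dG a y By.
    apply: (etrans (congr1 (fun u : 'rV[R]_n => u 0 i) (congr1 (@^~ v) e))).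
    by rewrite /= summxE; apply: eq_bigr => l _; rewrite !mxE.
  have symS l i : S a y l i = S a y i l.
    by apply: eq_bigr => k _; rewrite /Gamc symGam //; exact: BU.
  rewrite sumrB normr_le0 subr_eq0; apply/eqP.
  transitivity (\sum_i \sum_l h 0 l * S a y l i * x 0 i).
    by apply: eq_bigr => i _; rewrite -mulr_suml; congr (_ * _); exact: dE.
  rewrite exchange_big /=; apply: eq_bigr => i _.
  transitivity ((\sum_l x 0 l * S a y l i) * h 0 i); last first.
    by congr (_ * _); exact: esym (dE _ _).
  by rewrite mulr_suml; apply: eq_bigr => l _; rewrite (symS i l); ring.
pose phi x : 'rV[R]_n := \row_a radial (G a) x.
pose row_G j x : 'rV[R]_n := \row_a G a x 0 j.
have dphi x : B x -> is_diff x phi (lincomb (fun i => row_G i x)).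
  move=> Bx; apply: is_diff_row => a.
  rewrite (_ : (fun y => phi y 0 a) = radial (G a)); last first.
    by apply/funext => y; rewrite mxE.
  apply: is_diff_eq (dR a x Bx) _; apply/funext => h.
  by rewrite /= summxE; apply: eq_bigr => i _; rewrite !mxE mulrC.
have srow j : smooth_on B (row_G j).
  apply: (smooth_row oB) => a.
  apply: (@smooth_ext _ _ _ _ (fun x => G a x 0 j)) => [x|]; first by rewrite mxE.
  exact: (smooth_coord oB 0 j (sGa a)).
have sphi : smooth_on B phi.
  case=> [|k].
    by move=> x Bx; have [d _] := dphi x Bx; exact: differentiable_continuous.
  split=> [x Bx|v]; first by have [] := dphi x Bx.
  have : Ck k B (fun x => \sum_i v 0 i *: row_G i x).
    apply: (Ck_sum oB) => i _; exact: (CkZ oB (Ck_cst k B (v 0 i)) (srow i k)).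
  by apply: (Ck_eq oB) => x Bx; have [_ ->] := dphi x Bx.
exists B, phi; split=> //.
  move=> v; have [_ e] := dphi 0 B0; apply: (etrans (congr1 (@^~ v) e)).
  rewrite [RHS]row_sum_delta; apply: eq_bigr => i _; congr (_ *: _).
  by apply/rowP => a; rewrite mxE G0 !mxE eq_sym.
move=> x Bx i j.
have dj : is_diff x (row_G j) (lincomb (fun l => \row_a S a x l j)).
  apply: is_diff_row => a; have [_ h] := GP a.
  rewrite (_ : (fun y => row_G j y 0 a) = fun y => G a y 0 j); last first.
    by apply/funext => y; rewrite mxE.
  apply: is_diff_eq (h x Bx j) _; apply/funext => v.
  by rewrite /= summxE; apply: eq_bigr => l _; rewrite !mxE.
have ej : \forall y \near x, row_G j y = 'd phi y (delta_mx 0 j).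
  apply: near_mono (near_open oB Bx) => y By; have [_ e] := dphi y By.
  by rewrite e lincomb_delta.
have [d1 e1] := dj.
have [_ e2] := near_eq_is_diff ej d1.
apply: (etrans (congr1 (@^~ (delta_mx 0 i)) (etrans e2 e1))).
rewrite lincomb_delta; have [_ e] := dphi x Bx.
apply: (etrans _ (esym (congr1 (@^~ (Gam i j x)) e))).
by apply/rowP => a; rewrite !mxE summxE; apply: eq_bigr => k _; rewrite !mxE.
Qed.

End Origin.

(** The same around an arbitrary point, by translation; the inverse function
    theorem turns the solution into a change of coordinates. *)
Lemma flat_coordinates (U : set 'rV[R]_n)
    (Gam : 'I_n -> 'I_n -> 'rV[R]_n -> 'rV[R]_n) (x0 : 'rV[R]_n) :
  open U -> U x0 -> (forall i j, smooth_on U (Gam i j)) ->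
  (forall i j x, U x -> Gam i j x = Gam j i x) ->
  (forall l i j x, U x ->
    'd (Gam i j) x (delta_mx 0 l) + \sum_k Gam i j x 0 k *: Gam l k x
    = 'd (Gam l j) x (delta_mx 0 i) + \sum_k Gam l j x 0 k *: Gam i k x) ->
  exists (V : set 'rV[R]_n) (phi psi : 'rV[R]_n -> 'rV[R]_n), [/\ open V /\ V x0, V `<=` U, smooth_on V phi,
    [/\ open (phi @` V), smooth_on (phi @` V) psi, forall x, V x -> psi (phi x) = x &
        forall x, V x -> jac phi x \in unitmx] &
   forall x, V x -> forall i j,
     'd (fun y => 'd phi y (delta_mx 0 j)) x (delta_mx 0 i) = 'd phi x (Gam i j x)].
Proof.
move=> oU Ux0 sGam symGam cur.
pose U' : set 'rV[R]_n := [set y | U (y + x0)].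
pose Gam' i j (y : 'rV[R]_n) := Gam i j (y + x0).
have dGam' i j y v : U' y -> 'd (Gam' i j) y v = 'd (Gam i j) (y + x0) v.
  move=> Uy; have dy : is_diff y (Gam' i j) ('d (Gam i j) (y + x0)).
    exact: is_diff_translate (smooth_differentiable (sGam i j) Uy).
  exact: is_diffE dy.
have cur' l i j x : U' x ->
    'd (Gam' i j) x (delta_mx 0 l) + \sum_k Gam' i j x 0 k *: Gam' l k x
    = 'd (Gam' l j) x (delta_mx 0 i) + \sum_k Gam' l j x 0 k *: Gam' i k x.
  move=> Ux; apply: (etrans (congr1 (+%R^~ _) (dGam' i j x _ Ux))).
  apply: (etrans (cur l i j _ Ux)).
  by apply: (congr1 (+%R^~ _)); exact: esym (dGam' l j x _ Ux).
have U'0 : U' 0 by rewrite /U' /= add0r.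
have [B' [phi' [[oB' B'0] B'U sphi' dphi'0 dd]]] := flat_coordinates_at0
  (open_translate x0 oU) U'0 (fun i j => smooth_translate x0 oU (sGam i j))
  (fun i j x Ux => symGam i j _ Ux) cur'.
pose B : set 'rV[R]_n := [set x | B' (x - x0)].
pose phi (x : 'rV[R]_n) := phi' (x - x0).
have oB : open B := open_translate (- x0) oB'.
have Bx0 : B x0 by rewrite /B /= subrr.
have sphi : smooth_on B phi := smooth_translate (- x0) oB' sphi'.
have dphi x : B x -> is_diff x phi ('d phi' (x - x0)).
  by move=> Bx; apply: is_diff_translate; exact: smooth_differentiable sphi' Bx.
have dphi0 v : 'd phi x0 v = v.
  apply: (etrans (is_diffE v (dphi x0 Bx0))).
  by rewrite subrr; exact: dphi'0.
have [V [psi [[oV Vx0] VB [oW spsi] psiK Ju]]] := inverse_function oB Bx0 sphi dphi0.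
exists V, phi, psi; split; first by split.
- by move=> x /VB /B'U; rewrite /U' /= subrK.
- exact: smooth_sub VB sphi.
- by split.
move=> x /VB Bx i j.
have dj := smooth_differentiable (smooth_diff (delta_mx 0 j) sphi') (Bx : B' (x - x0)).
have ej : \forall y \near x, 'd phi' (y - x0) (delta_mx 0 j) = 'd phi y (delta_mx 0 j).
  apply: near_mono (near_open oB Bx) => y By; exact: esym (is_diffE _ (dphi y By)).
have [d1 e1] := is_diff_translate dj.
have [_ e2] := near_eq_is_diff ej d1.
apply: (etrans (congr1 (@^~ (delta_mx 0 i)) (etrans e2 e1))).
apply: (etrans (dd _ Bx i j)); rewrite /Gam' subrK.
exact: esym (is_diffE _ (dphi x Bx)).
Qed.

End FlatCoordinates.

(** * Functions read in charts *)

Section Charts.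
Variables (R : realType) (n : nat).

Lemma in_chartE (T : Type) (c : chart R T n) (V : normedModType R) (F : T -> V) q :
  is_chart c -> cdom c q -> in_chart c F (c q) = F q.
Proof.
move=> [ic _] cq; rewrite /in_chart.
case: xgetP => [_ _ [q' [cq' qq'] <-]|/(_ (F q))[]]; last by exists q.
by rewrite (ic q' q) ?inE.
Qed.

Variables (M : atlas R n) (hM : is_atlas M).
Implicit Types (c d e : chart R M n) (p q : M) (A : set M) (V : normedModType R).

Lemma in_atlasE c V (F : M -> V) q : charts c -> cdom c q ->
  in_chart c F (c q) = F q.
Proof. by move=> cM; apply: in_chartE; exact: atlas_chart cM. Qed.

Lemma chart_inj c p q : charts c -> cdom c p -> cdom c q -> c p = c q -> p = q.
Proof.
move=> cM cp cq h; have [ic _] := atlas_chart hM cM.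
by apply: ic h; rewrite inE.
Qed.

Lemma chart_open_image c A : charts c -> open A -> open (c @` (cdom c `&` A)).
Proof.
move=> cM oA; rewrite openE => _ [p [cp Ap] <-].
have [_ oc] := atlas_chart hM cM.
have n1 := near_open oc (ex_intro2 _ _ p cp erefl : (c @` cdom c) (c p)).
have n2 := oA c p cM cp Ap.
apply: near_mono2 n1 n2 => _ [q cq <-] /(_ q cq erefl) Aq.
by exists q.
Qed.

Lemma chart_open c A : charts c -> A `<=` cdom c -> open (c @` A) -> open A.
Proof.
move=> cM Ac oA; suff : atlas_open A by [].
move=> d p dM dp Ap.
have [_ od _ sd] := atlas_compatible hM cM dM.
have cp := Ac p Ap.
have dcp : (d @` (cdom c `&` cdom d)) (d p) by exists p.
have ct := smooth_continuous sd dcp.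
have n1 := near_open od dcp.
have E : in_chart d c (d p) = c p by exact: in_atlasE.
have n2 : \forall x \near d p, (c @` A) (in_chart d c x).
  by apply: ct; rewrite E; apply: near_open oA _; exists p.
apply: near_mono2 n1 n2 => _ [q [cq dq] <-].
rewrite in_atlasE // => -[q' Aq' qq'] q'' dq'' qq''.
have <- : q = q'' by apply: (chart_inj dM) => //.
by have <- : q' = q by apply: (chart_inj cM) => //; exact: Ac.
Qed.

Lemma cdom_open c : charts c -> open (cdom c).
Proof. by move=> cM; apply: (chart_open cM) => //; have [] := atlas_chart hM cM. Qed.

Lemma chart_near c p A : charts c -> cdom c p -> open A -> A p ->
  \forall x \near c p, exists2 q, cdom c q /\ A q & c q = x.
Proof.
move=> cM cp oA Ap; have oI := chart_open_image cM oA.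
have hp : (c @` (cdom c `&` A)) (c p) by exists p.
by apply: near_mono (near_open oI hp) => x [q cq <-]; exists q.
Qed.

Lemma transition_smooth c d : charts c -> charts d ->
  smooth_on (c @` (cdom c `&` cdom d)) (in_chart c d).
Proof. by move=> cM dM; have [] := atlas_compatible hM cM dM. Qed.

Lemma transition_differentiable c d p : chart_around p c -> chart_around p d ->
  differentiable (in_chart c d) (c p).
Proof.
move=> [cM cp] [dM dp].
by apply: smooth_differentiable (transition_smooth cM dM) _; exists p.
Qed.

Lemma is_diff_change_chart c d V (F : M -> V) p :
  chart_around p c -> chart_around p d -> differentiable (in_chart d F) (d p) ->
  is_diff (c p) (in_chart c F)
    (fun h => 'd (in_chart d F) (d p) ('d (in_chart c d) (c p) h)).
Proof.
move=> pc pd dF; have [cM cp] := pc; have [dM dp] := pd.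
have dt := differentiableP (transition_differentiable pc pd).
have E : in_chart c d (c p) = d p by exact: in_atlasE.
have dF' : is_diff (in_chart c d (c p)) (in_chart d F) ('d (in_chart d F) (d p)).
  by rewrite E; exact: differentiableP.
have nr : \forall x \near c p, (in_chart d F \o in_chart c d) x = in_chart c F x.
  apply: near_mono (chart_near cM cp (cdom_open dM) dp) => x [q [cq dq] <-] /=.
  by rewrite /= in_atlasE // in_atlasE // in_atlasE.
exact: near_is_diff nr (is_diff_comp dt dF').
Qed.

Lemma is_diff_chart_self c p : chart_around p c -> is_diff (c p) (in_chart c c) id.
Proof.
move=> [cM cp].
have nr : \forall x \near c p, id x = in_chart c c x.
  apply: near_mono (chart_near cM cp (cdom_open cM) cp) => x [q [cq _] <-].
  by rewrite in_atlasE.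
exact: near_is_diff nr (is_diff_id (c p)).
Qed.

Lemma chart_atP p : chart_around p (chart_at p).
Proof. by have [c pc] := atlas_cover hM p; exact: (xgetPex _ (ex_intro _ c pc)). Qed.

(** * Tangent vectors *)

Lemma tangentE p (v : tangent p) c d : chart_around p c -> chart_around p d ->
  v d = 'd (in_chart c d) (c p) (v c).
Proof.
by case: v => v /= /asboolP[_ h]; exact: h.
Qed.

Lemma tangent_ext p (v w : tangent p) c : chart_around p c -> v c = w c -> v = w.
Proof.
move=> pc vw; apply: val_inj; apply/funext => d /=.
have [pd|npd] := pselect (chart_around p d).
  by rewrite (tangentE v pc pd) (tangentE w pc pd) vw.
case: v w {vw} => [v /=/asboolP[v0 _]] [w /=/asboolP[w0 _]].
by rewrite v0 // w0.
Qed.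

Lemma tangent_ofE p (u : chart R M n -> 'rV[R]_n) c :
  (forall c d, chart_around p c -> chart_around p d ->
     u d = 'd (in_chart c d) (c p) (u c)) ->
  chart_around p c -> tangent_of p u c = u c.
Proof.
move=> hu pc; rewrite /tangent_of /insubd insubT; last first.
  by move=> h /=; rewrite asboolT.
apply/asboolP; split=> [d nd|d e pd pe]; first by rewrite asboolF.
by rewrite !asboolT //; exact: hu.
Qed.

Lemma tangent0E p c : (0 : tangent p) c = 0. Proof. by []. Qed.
Lemma tangentDE p (v w : tangent p) c : (v + w) c = v c + w c. Proof. by []. Qed.
Lemma tangentNE p (v : tangent p) c : (- v) c = - v c. Proof. by []. Qed.
Lemma tangentZE p a (v : tangent p) c : (a *: v) c = a *: v c. Proof. by []. Qed.

Lemma tangent_sumE p (I : Type) (r : seq I) (v : I -> tangent p) c :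
  (\sum_(i <- r) v i) c = \sum_(i <- r) v i c.
Proof.
by elim: r => [|i r IH]; rewrite ?big_nil // !big_cons tangentDE IH.
Qed.

Definition tangent_in c p (w : 'rV[R]_n) : tangent p :=
  tangent_of p (fun d => 'd (in_chart c d) (c p) w).

Lemma tangent_inE c d p w : chart_around p c -> chart_around p d ->
  tangent_in c p w d = 'd (in_chart c d) (c p) w.
Proof.
move=> pc pd; apply: tangent_ofE => // e e' pe pe'.
exact: is_diffE (is_diff_change_chart pc pe (transition_differentiable pe pe')).
Qed.

Lemma tangent_inK c p w : chart_around p c -> tangent_in c p w c = w.
Proof.
by move=> pc; rewrite tangent_inE //; exact: is_diffE (is_diff_chart_self pc).
Qed.

Lemma tangent_in_components c p (v : tangent p) : chart_around p c ->
  tangent_in c p (v c) = v.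
Proof. by move=> pc; apply: (tangent_ext pc); rewrite tangent_inK. Qed.

Lemma dfunE c V (F : M -> V) p (v : tangent p) : chart_around p c ->
  differentiable (in_chart c F) (c p) -> dfun v F = 'd (in_chart c F) (c p) (v c).
Proof.
move=> pc dF; have pa := chart_atP p.
apply: (etrans (is_diffE _ (is_diff_change_chart pa pc dF))).
exact: (congr1 ('d (in_chart c F) (c p)) (esym (tangentE v pa pc))).
Qed.

End Charts.

(** * Push-forward in charts *)

Section Pushforward.
Variables (R : realType) (n n' : nat) (M : atlas R n) (M' : atlas R n').
Hypotheses (hM : is_atlas M) (hM' : is_atlas M').
Variable f : M -> M'.

(** Smoothness near a point, which also makes sense for maps such as a section
    given by a vector field that is smooth on an open set only. *)
Definition smooth_near (p : M) : Prop :=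
  forall d : chart R M' n', chart_around (f p) d -> exists A : set M,
    [/\ open A, A p, forall q, A q -> cdom d (f q) & smooth_fun A (d \o f)].

Lemma smooth_near_differentiable p c d : smooth_near p ->
  chart_around p c -> chart_around (f p) d ->
  differentiable (in_chart c (d \o f)) (c p).
Proof.
move=> sf [cM cp] /sf[A [oA Ap _ sA]].
by apply: smooth_differentiable (sA c cM) _; exists p.
Qed.

Lemma pushforwardE p (v : tangent p) c d : smooth_near p ->
  chart_around p c -> chart_around (f p) d ->
  pushforward f v d = 'd (in_chart c (d \o f)) (c p) (v c).
Proof.
move=> sf pc pd; have [cM cp] := pc.
have dfE e (pe : chart_around (f p) e) :=
  dfunE hM v pc (smooth_near_differentiable sf pc pe).
apply: (etrans (tangent_ofE _ pd)); last exact: dfE.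
move=> d1 d2 p1 p2; apply: (etrans (dfE d2 p2)).
apply: (etrans _ (congr1 ('d (in_chart d1 d2) (d1 (f p))) (esym (dfE d1 p1)))).
have dt := transition_differentiable hM' p1 p2.
have E : in_chart c (d1 \o f) (c p) = d1 (f p) by exact: in_atlasE.
have dt' : is_diff (in_chart c (d1 \o f) (c p)) (in_chart d1 d2) ('d (in_chart d1 d2) (d1 (f p))).
  by rewrite E; exact: differentiableP.
have [A [oA Ap Ad _]] := sf d1 p1; have [M1 _] := p1.
have nr : \forall x \near c p, (in_chart d1 d2 \o in_chart c (d1 \o f)) x = in_chart c (d2 \o f) x.
  apply: near_mono (chart_near hM cM cp oA Ap) => x [q [cq Aq] <-] /=.
  by rewrite (in_atlasE hM) // (in_atlasE hM) //= (in_atlasE hM') //; exact: Ad.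
have d1c := differentiableP (smooth_near_differentiable sf pc p1).
exact: is_diffE (near_is_diff nr (is_diff_comp d1c dt')).
Qed.

Lemma smooth_map_near p : smooth_map f -> smooth_near p.
Proof.
move=> [cf sf] d [dM dp]; exists (f @^-1` cdom d); split => //.
  by apply: open_comp => [q _|]; [exact: cf|exact: cdom_open].
exact: sf.
Qed.

End Pushforward.

(** * The tangent bundle *)

Section LinearProjections.
Variables (R : realType) (m n : nat).

Lemma smooth_lsubmx (A : set 'rV[R]_(m + n)) :
  smooth_on A (lsubmx : 'rV[R]_(m + n) -> 'rV[R]_m).
Proof. exact: (smooth_linear A (lsubmx : {linear 'rV[R]_(m + n) -> 'rV[R]_m})). Qed.

Lemma smooth_rsubmx (A : set 'rV[R]_(m + n)) :
  smooth_on A (rsubmx : 'rV[R]_(m + n) -> 'rV[R]_n).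
Proof. exact: (smooth_linear A (rsubmx : {linear 'rV[R]_(m + n) -> 'rV[R]_n})). Qed.

Lemma open_lsubmx (A : set 'rV[R]_m) : open A ->
  open [set z : 'rV[R]_(m + n) | A (lsubmx z)].
Proof.
move=> oA; apply: (@open_comp _ _ (lsubmx : 'rV[R]_(m + n) -> 'rV[R]_m)) => // z _.
exact: (@smooth_continuous _ _ _ setT _ z (@smooth_lsubmx setT)).
Qed.

End LinearProjections.

Section TangentBundleAtlas.
Variables (R : realType) (n : nat) (M : atlas R n) (hM : is_atlas M).
Local Notation TM := (tangent_bundle M).
Implicit Types (c d : chart R M n) (u : TM).

Lemma tangent_chart_around u c : chart_around (TM_proj u) c ->
  chart_around (M := TM) u (tangent_chart c).
Proof. by move=> [cM cu]; split=> //; exists c. Qed.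

(** Every vector is the component of some tangent vector, so the image is a full
    cylinder. *)
Lemma tangent_chart_image c (A : set M) : charts c -> A `<=` cdom c ->
  tangent_chart c @` [set u | A (projT1 u)]
  = [set z : 'rV[R]_(n + n) | (c @` A) (lsubmx z)].
Proof.
move=> cM Ac; apply/seteqP; split=> [_ [[p v] /= Ap <-]|z [p Ap pz]] /=.
  by exists p => //; rewrite row_mxKl.
exists (existT _ p (tangent_in c p (rsubmx z))) => //=.
by rewrite tangent_inK // ?pz ?hsubmxK //; split=> //; exact: Ac.
Qed.

Lemma tangent_chart_is_chart c : charts c -> is_chart (tangent_chart c).
Proof.
move=> cM; split.
  move=> [p v] [q w]; rewrite !inE /= => cp cq /eq_row_mx[cpq vw].
  have pq := chart_inj hM cM cp cq cpq.
  case: q / pq in w cq cpq vw *.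
  by rewrite (tangent_ext (conj cM cp) vw).
rewrite (_ : cdom (tangent_chart c) = [set u | cdom c (projT1 u)]) //.
rewrite tangent_chart_image //; apply: open_lsubmx.
by have [] := atlas_chart hM cM.
Qed.

Lemma tangent_transition c d z : charts c -> charts d ->
  (c @` (cdom c `&` cdom d)) (lsubmx z) ->
  in_chart (tangent_chart c) (tangent_chart d) z
  = row_mx (in_chart c d (lsubmx z)) ('d (in_chart c d) (lsubmx z) (rsubmx z)).
Proof.
move=> cM dM [p [cp dp] pz].
pose u : {p : M & tangent p} := existT _ p (tangent_in c p (rsubmx z)).
have uz : tangent_chart c u = z by rewrite /= tangent_inK // pz hsubmxK.
rewrite -[in LHS]uz in_chartE //; last exact: tangent_chart_is_chart.
rewrite /= -pz in_atlasE //; congr row_mx.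
by rewrite tangent_inE.
Qed.

Lemma tangent_transition_smooth c d : charts c -> charts d ->
  smooth_on [set z | (c @` (cdom c `&` cdom d)) (lsubmx z)]
    (in_chart (tangent_chart c) (tangent_chart d)).
Proof.
move=> cM dM; have [oc _ _ _] := atlas_compatible hM cM dM.
have oA := open_lsubmx (n := n) oc; have st := transition_smooth hM cM dM.
have sl := smooth_lsubmx (n := n) [set z | (c @` (cdom c `&` cdom d)) (lsubmx z)].
have sr := smooth_rsubmx (m := n) (n := n) [set z | (c @` (cdom c `&` cdom d)) (lsubmx z)].
pose A := [set z : 'rV[R]_(n + n) | (c @` (cdom c `&` cdom d)) (lsubmx z)].
have AB z : A z -> (c @` (cdom c `&` cdom d)) (lsubmx z) by [].
have := smooth_row_mx oA (smooth_comp oA AB sl st) (smooth_diff_comp oA AB sl sr st).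
by apply: (smooth_eq oA) => z Az; rewrite tangent_transition.
Qed.

Lemma tangent_bundle_is_atlas : is_atlas TM.
Proof.
split.
- move=> u; have [c pc] := atlas_cover hM (TM_proj u).
  by exists (tangent_chart c); exact: tangent_chart_around.
- by move=> _ [c cM <-]; exact: tangent_chart_is_chart.
- move=> _ _ [c cM <-] [d dM <-].
  have E : cdom (tangent_chart c) `&` cdom (tangent_chart d)
    = [set u | (cdom c `&` cdom d) (projT1 u)] by [].
  have [oc od _ _] := atlas_compatible hM cM dM.
  have Ec := tangent_chart_image cM (@subIsetl _ (cdom c) (cdom d)).
  have Ed := tangent_chart_image dM (@subIsetr _ (cdom c) (cdom d)).
  rewrite /compatible E Ec Ed; split; try exact: open_lsubmx.
    exact: tangent_transition_smooth.
  by rewrite setIC; exact: tangent_transition_smooth.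
Qed.

Lemma TM_proj_open (A : set M) : open A -> open [set u : TM | A (TM_proj u)].
Proof.
move=> oA; suff : atlas_open [set u : TM | A (TM_proj u)] by [].
move=> _ u [c cM <-] cu Au.
have h := oA c _ cM cu Au.
have cl : {for tangent_chart c u, continuous (lsubmx : 'rV[R]_(n + n) -> 'rV[R]_n)}.
  exact: (@smooth_continuous _ _ _ setT _ _ (@smooth_lsubmx _ _ _ setT)).
have := cl _ (_ : nbhs (lsubmx (tangent_chart c u)) _).
rewrite /= row_mxKl => /(_ _ h); apply: near_mono => z hz q cq qz.
by apply: hz => //; rewrite -qz /= row_mxKl.
Qed.

Lemma TM_proj_smooth_near u : smooth_near (@TM_proj R n M) u.
Proof.
move=> d [dM du]; exists [set u : TM | cdom d (TM_proj u)]; split=> //.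
  exact: TM_proj_open (cdom_open hM dM).
move=> _ [c cM <-].
have oc : open (c @` (cdom c `&` cdom d)) by have [] := atlas_compatible hM cM dM.
have -> : tangent_chart c @` (cdom (tangent_chart c) `&` [set u : TM | cdom d (TM_proj u)])
   = [set z | (c @` (cdom c `&` cdom d)) (lsubmx z)].
  exact: (tangent_chart_image cM (@subIsetl _ (cdom c) (cdom d))).
have oA := open_lsubmx (n := n) oc.
pose A := [set z : 'rV[R]_(n + n) | (c @` (cdom c `&` cdom d)) (lsubmx z)].
have AB z : A z -> (c @` (cdom c `&` cdom d)) (lsubmx z) by [].
have := smooth_comp oA AB (smooth_lsubmx (n := n) A) (transition_smooth hM cM dM).
apply: (smooth_eq oA) => z; rewrite -(tangent_chart_image cM (@subIsetl _ _ _)).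
move=> [w [cw dw] <-]; rewrite in_chartE //; last exact: tangent_chart_is_chart.
by rewrite /= row_mxKl in_atlasE.
Qed.

End TangentBundleAtlas.

(** * Maps between tangent bundles *)

Section TangentLift.
Variables (R : realType).

Lemma is_diff_row_mx (V : normedModType R) m n (F dF : V -> 'rV[R]_m)
    (G dG : V -> 'rV[R]_n) x : is_diff x F dF -> is_diff x G dG ->
  is_diff x (fun y => row_mx (F y) (G y)) (fun h => row_mx (dF h) (dG h)).
Proof.
move=> dFx dGx.
pose A : 'M[R]_(m, m + n) := row_mx 1%:M 0; pose B : 'M[R]_(n, m + n) := row_mx 0 1%:M.
have E (a : 'rV[R]_m) (b : 'rV[R]_n) : a *m A + b *m B = row_mx a b.
  by rewrite !mul_mx_row !mulmx1 !mulmx0 add_row_mx addr0 add0r.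
have d := is_diffD (is_diff_comp dFx (is_diff_linear (mulmxr A) (F x)))
  (is_diff_comp dGx (is_diff_linear (mulmxr B) (G x))).
have -> : (fun y => row_mx (F y) (G y)) = (mulmxr A \o F) + (mulmxr B \o G).
  by apply/funext => y; rewrite -E.
by apply: is_diff_eq d _; apply/funext => h; rewrite -E.
Qed.

Variables (m n : nat) (F : 'rV[R]_m -> 'rV[R]_n) (I : set 'rV[R]_m).
Hypotheses (oI : open I) (sF : smooth_on I F).

(** The tangent map of [F] in coordinates, position and velocity side by side. *)
Definition tangent_lift (z : 'rV[R]_(m + m)) : 'rV[R]_(n + n) :=
  row_mx (F (lsubmx z)) ('d F (lsubmx z) (rsubmx z)).

Lemma tangent_lift_smooth : smooth_on [set z | I (lsubmx z)] tangent_lift.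
Proof.
have oA := open_lsubmx (n := m) oI.
pose A := [set z : 'rV[R]_(m + m) | I (lsubmx z)].
have AI z : A z -> I (lsubmx z) by [].
have sl := smooth_lsubmx (n := m) A; have sr := smooth_rsubmx (m := m) (n := m) A.
exact: (smooth_row_mx oA (smooth_comp oA AI sl sF) (smooth_diff_comp oA AI sl sr sF)).
Qed.

(** The second component is bilinear in the partial derivatives of [F] and the
    velocity; the product rule gives the second derivative of [F] and [F] itself
    differentiated along the new velocity. *)
Lemma is_diff_tangent_lift z : I (lsubmx z) ->
  is_diff z tangent_lift
    (fun a => row_mx ('d F (lsubmx z) (lsubmx a))
      ('d (fun x => 'd F x (rsubmx z)) (lsubmx z) (lsubmx a)
       + 'd F (lsubmx z) (rsubmx a))).
Proof.
move=> Iz.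
have dl : is_diff z (lsubmx : 'rV[R]_(m + m) -> 'rV[R]_m) lsubmx.
  exact: (is_diff_linear (lsubmx : {linear 'rV[R]_(m + m) -> 'rV[R]_m}) z).
have dr : is_diff z (rsubmx : 'rV[R]_(m + m) -> 'rV[R]_m) rsubmx.
  exact: (is_diff_linear (rsubmx : {linear 'rV[R]_(m + m) -> 'rV[R]_m}) z).
apply: is_diff_row_mx.
  exact: is_diff_comp dl (differentiableP (smooth_differentiable sF Iz)).
pose P i x := 'd F x (delta_mx 0 i).
have dP i : is_diff (lsubmx z) (P i) ('d (P i) (lsubmx z)).
  apply: differentiableP; exact: smooth_differentiable (smooth_diff (delta_mx 0 i) sF) Iz.
have d1 : is_diff z (fun y => \sum_i rsubmx y 0 i *: P i (lsubmx y))
    (fun a => \sum_i (rsubmx z 0 i *: 'd (P i) (lsubmx z) (lsubmx a)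
                      + rsubmx a 0 i *: P i (lsubmx z))).
  apply: is_diff_sum => i.
  exact: is_diff_mul_fun (is_diff_entry 0 i dr) (is_diff_comp dl (dP i)).
have E : (fun y => 'd F (lsubmx y) (rsubmx y))
    = (fun y => \sum_i rsubmx y 0 i *: P i (lsubmx y)).
  by apply/funext => y; exact: (diff_sum_coord ('d F (lsubmx y)) (rsubmx y)).
rewrite E; apply: is_diff_eq d1 _; apply/funext => a.
rewrite big_split /=; congr (_ + _); last first.
  exact: esym (diff_sum_coord ('d F (lsubmx z)) (rsubmx a)).
have d2 : is_diff (lsubmx z) (fun x => \sum_i rsubmx z 0 i *: P i x)
    (fun a => \sum_i rsubmx z 0 i *: 'd (P i) (lsubmx z) a).
  have dc i : is_diff (lsubmx z) (fun x => rsubmx z 0 i *: P i x)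
    (fun a => rsubmx z 0 i *: 'd (P i) (lsubmx z) a) := is_diffZ _ (dP i).
  exact: (is_diff_sum _ dc).
have E2 : (fun x => 'd F x (rsubmx z)) = (fun x => \sum_i rsubmx z 0 i *: P i x).
  by apply/funext => y; exact: (diff_sum_coord ('d F y) (rsubmx z)).
by rewrite E2; exact: esym (is_diffE _ d2).
Qed.

End TangentLift.

Section TangentMap.
Variables (R : realType) (n n' : nat) (M : atlas R n) (M' : atlas R n').
Hypotheses (hM : is_atlas M) (hM' : is_atlas M').
Variables (f : M -> M') (sf : smooth_map f).
Local Notation TM := (tangent_bundle M).
Local Notation TM' := (tangent_bundle M').
Implicit Types (c : chart R M n) (d : chart R M' n').

Let hTM := tangent_bundle_is_atlas hM.
Let hTM' := tangent_bundle_is_atlas hM'.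

Definition chart_overlap c d : set 'rV[R]_n := c @` (cdom c `&` f @^-1` cdom d).

Lemma preimage_cdom_open d : charts d -> open (f @^-1` cdom d).
Proof.
move=> dM; have [cf _] := sf.
by apply: open_comp => [q _|]; [exact: cf|exact: cdom_open].
Qed.

Lemma chart_overlap_open c d : charts c -> charts d -> open (chart_overlap c d).
Proof. by move=> cM dM; apply: chart_open_image => //; exact: preimage_cdom_open. Qed.

Lemma chart_overlap_smooth c d : charts c -> charts d ->
  smooth_on (chart_overlap c d) (in_chart c (d \o f)).
Proof. by move=> cM dM; have [_ h] := sf; exact: h. Qed.

Lemma tangent_map_chart (u : TM) c d : chart_around (TM_proj u) c ->
  chart_around (f (TM_proj u)) d ->
  tangent_chart d (tangent_map f u)
  = tangent_lift (in_chart c (d \o f)) (tangent_chart c u).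
Proof.
case: u => p v /= pc pd; have [cM cp] := pc.
rewrite /tangent_lift /= row_mxKl row_mxKr in_atlasE //; congr row_mx.
by apply: pushforwardE => //; exact: smooth_map_near.
Qed.

Lemma tangent_chart_overlap c d : charts c ->
  tangent_chart c @` (cdom (tangent_chart c) `&`
     tangent_map f @^-1` cdom (tangent_chart d))
  = [set z | chart_overlap c d (lsubmx z)].
Proof.
by move=> cM; exact: (tangent_chart_image hM cM (@subIsetl _ (cdom c) (f @^-1` cdom d))).
Qed.

Lemma in_tangent_chart c d z : charts c -> charts d ->
  chart_overlap c d (lsubmx z) ->
  in_chart (tangent_chart c) (tangent_chart d \o tangent_map f) z
  = tangent_lift (in_chart c (d \o f)) z.
Proof.
move=> cM dM h; have : [set z | chart_overlap c d (lsubmx z)] z by [].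
rewrite -tangent_chart_overlap // => -[u [cu du] <-].
rewrite in_chartE //; last exact: tangent_chart_is_chart.
by apply: tangent_map_chart.
Qed.

Lemma tangent_map_smooth : smooth_map (tangent_map f : TM -> TM').
Proof.
split; last first.
  move=> _ [d dM <-] _ [c cM <-]; rewrite tangent_chart_overlap //.
  have oI := chart_overlap_open cM dM; have sI := chart_overlap_smooth cM dM.
  apply: (smooth_eq (open_lsubmx oI) _ (tangent_lift_smooth oI sI)) => z Iz.
  by rewrite in_tangent_chart.
apply/continuousP => O oO.
suff : atlas_open (tangent_map f @^-1` O : set TM) by [].
move=> _ u [c cM <-] cu Ou.
have [d pd] := atlas_cover hM' (f (TM_proj u)); have [dM du] := pd.
have oI := chart_overlap_open cM dM; have sI := chart_overlap_smooth cM dM.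
have Iu : chart_overlap c d (lsubmx (tangent_chart c u)).
  by rewrite /= row_mxKl; exists (TM_proj u).
have cL : {for tangent_chart c u, continuous (tangent_lift (in_chart c (d \o f)))}.
  exact: (smooth_continuous (tangent_lift_smooth oI sI) Iu).
have nO := oO (tangent_chart d) (tangent_map f u) (ex_intro2 _ _ d dM erefl) du Ou.
have E := @tangent_map_chart u c d (conj cM cu) pd.
rewrite E in nO.
have n1 := cL _ nO.
have n2 := near_open (open_lsubmx (n := n) oI) Iu.
apply: near_mono2 n1 n2 => z hz Iz w cw wz.
have dw : cdom d (f (TM_proj w)).
  move: Iz; rewrite /= -wz /= row_mxKl => -[q [cq dq]] qw.
  have -> : TM_proj w = q by exact: esym (chart_inj hM cM cq cw qw).
  exact: dq.
by apply: hz => //; rewrite -wz -tangent_map_chart.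
Qed.

Lemma pushforward_tangent_map (u : TM) (a : tangent u) c d :
  chart_around (TM_proj u) c -> chart_around (f (TM_proj u)) d ->
  pushforward (tangent_map f) a (tangent_chart d)
  = row_mx ('d (in_chart c (d \o f)) (c (TM_proj u)) (lsubmx (a (tangent_chart c))))
      ('d (fun x => 'd (in_chart c (d \o f)) x (projT2 u c)) (c (TM_proj u))
          (lsubmx (a (tangent_chart c)))
       + 'd (in_chart c (d \o f)) (c (TM_proj u)) (rsubmx (a (tangent_chart c)))).
Proof.
move=> pc pd; have [cM cu] := pc; have [dM du] := pd.
apply: (etrans (pushforwardE hTM hTM' a (smooth_map_near hTM' tangent_map_smooth)
  (tangent_chart_around pc) (tangent_chart_around (u := tangent_map f u) pd))).
have oI := chart_overlap_open cM dM; have sI := chart_overlap_smooth cM dM.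
have Iu : chart_overlap c d (lsubmx (tangent_chart c u)).
  by rewrite /= row_mxKl; exists (TM_proj u).
have nr : \forall z \near tangent_chart c u,
    tangent_lift (in_chart c (d \o f)) z
    = in_chart (tangent_chart c) (tangent_chart d \o tangent_map f) z.
  apply: near_mono (near_open (open_lsubmx (n := n) oI) Iu) => z Iz.
  by rewrite in_tangent_chart.
apply: (etrans (is_diffE _ (near_is_diff nr (is_diff_tangent_lift sI Iu)))).
by rewrite /= row_mxKl row_mxKr.
Qed.

End TangentMap.

Section ProjectionAndSections.
Variables (R : realType) (n : nat) (M : atlas R n) (hM : is_atlas M).
Local Notation TM := (tangent_bundle M).
Implicit Types (c : chart R M n).

Let hTM := tangent_bundle_is_atlas hM.

Lemma pushforward_TM_proj (u : TM) (a : tangent u) c : chart_around (TM_proj u) c ->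
  pushforward (@TM_proj R n M) a c = lsubmx (a (tangent_chart c)).
Proof.
move=> pc; have [cM cu] := pc.
apply: (etrans (pushforwardE hTM hM a (@TM_proj_smooth_near _ _ _ hM u)
  (tangent_chart_around pc) pc)).
have [_ oc] := tangent_chart_is_chart hM cM.
have hu : (tangent_chart c @` cdom (tangent_chart c)) (tangent_chart c u) by exists u.
have nr : \forall z \near tangent_chart c u,
    lsubmx z = in_chart (tangent_chart c) (c \o @TM_proj R n M) z.
  apply: near_mono (near_open oc hu) => _ [w cw <-].
  by rewrite in_chartE ?/= ?row_mxKl //; exact: tangent_chart_is_chart.
have dl := is_diff_linear (lsubmx : {linear 'rV[R]_(n + n) -> 'rV[R]_n}) (tangent_chart c u).
exact: is_diffE (near_is_diff nr dl).
Qed.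

Variables (A : set M) (Y : vfield M).
Hypotheses (oA : open A) (sY : smooth_vfield A Y).

Lemma TM_section_smooth_near p : A p -> smooth_near (TM_section Y) p.
Proof.
move=> Ap _ [[d dM <-] dp]; exists (A `&` cdom d); split=> //.
- by apply: openI => //; exact: cdom_open.
- by move=> q [].
move=> c cM.
have oI : open (c @` (cdom c `&` (A `&` cdom d))).
  by apply: chart_open_image => //; apply: openI => //; exact: cdom_open.
have s1 : smooth_on (c @` (cdom c `&` (A `&` cdom d))) (in_chart c d).
  apply: smooth_sub (transition_smooth hM cM dM).
  by move=> _ [q [cq [Aq dq]] <-]; exists q.
have s2 : smooth_on (c @` (cdom c `&` (A `&` cdom d))) (in_chart c (fun q => Y q d)).
  pose I := c @` (cdom c `&` (A `&` cdom d)).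
  have sd : smooth_on I (in_chart c (fun q => Y q c)).
    by apply: smooth_sub (sY cM) => _ [q [cq [Aq dq]] <-]; exists q.
  have := smooth_diff_comp oI (fun x (h : I x) => h) (smooth_id I) sd s1.
  apply: (smooth_eq oI) => _ [q [cq [Aq dq]] <-].
  by rewrite !in_atlasE // -tangentE.
have := smooth_row_mx oI s1 s2.
by apply: (smooth_eq oI) => _ [q [cq [Aq dq]] <-]; rewrite !in_atlasE.
Qed.

Lemma pushforward_TM_section p (v : tangent p) c : A p -> chart_around p c ->
  pushforward (TM_section Y) v (tangent_chart c)
  = row_mx (v c) ('d (in_chart c (fun q => Y q c)) (c p) (v c)).
Proof.
move=> Ap pc; have [cM cp] := pc.
have pt : chart_around (M := TM) (TM_section Y p) (tangent_chart c).
  exact: (@tangent_chart_around _ _ _ (TM_section Y p) c pc).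
apply: (etrans (pushforwardE hM hTM v (TM_section_smooth_near Ap) pc pt)).
have dY : differentiable (in_chart c (fun q => Y q c)) (c p).
  by apply: smooth_differentiable (sY cM) _; exists p.
have nr : \forall x \near c p, row_mx x (in_chart c (fun q => Y q c) x)
   = in_chart c (tangent_chart c \o TM_section Y) x.
  apply: near_mono (chart_near hM cM cp oA Ap) => _ [q [cq Aq] <-].
  by rewrite !in_atlasE.
exact: is_diffE (near_is_diff nr (is_diff_row_mx (is_diff_id (c p)) (differentiableP dY))).
Qed.

End ProjectionAndSections.

(** * Smooth fields and connections in charts *)

Section SmoothFields.
Variables (R : realType) (n : nat) (M : atlas R n) (hM : is_atlas M).
Implicit Types (c d : chart R M n) (A B : set M) (X Y : vfield M).

Lemma smooth_vfield_sub A B X : B `<=` A -> smooth_vfield A X -> smooth_vfield B X.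
Proof.
move=> BA sX c cM; apply: smooth_sub (sX c cM).
by move=> _ [q [cq Bq] <-]; exists q => //; split=> //; exact: BA.
Qed.

Lemma smooth_in_chart_eq (V : normedModType R) A c (F G : M -> V) : open A -> charts c ->
  (forall q, A q -> F q = G q) ->
  smooth_on (c @` (cdom c `&` A)) (in_chart c F) ->
  smooth_on (c @` (cdom c `&` A)) (in_chart c G).
Proof.
move=> oA cM FG; apply: (smooth_eq (chart_open_image hM cM oA)).
by move=> _ [q [cq Aq] <-]; rewrite !(in_atlasE hM) // FG.
Qed.

Lemma smooth_vfield_eq A X Y : open A -> (forall q, A q -> X q = Y q) ->
  smooth_vfield A X -> smooth_vfield A Y.
Proof.
by move=> oA XY sX c cM; apply: smooth_in_chart_eq (sX c cM) => // q /XY ->.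
Qed.

Lemma smooth_fun_cst (V : normedModType R) A (a : V) : open A -> smooth_fun A (fun=> a).
Proof.
move=> oA c cM; apply: (smooth_eq (chart_open_image hM cM oA) _ (smooth_cst _ a)).
by move=> _ [q [cq Aq] <-]; rewrite in_atlasE.
Qed.

Lemma smooth_fun_in c (V : normedModType R) A (F : M -> V) : charts c -> open A ->
  A `<=` cdom c -> smooth_on (c @` A) (in_chart c F) -> smooth_fun A F.
Proof.
move=> cM oA Ac sF d dM; have oI := chart_open_image hM dM oA.
have st : smooth_on (d @` (cdom d `&` A)) (in_chart d c).
  apply: smooth_sub (transition_smooth hM dM cM).
  by move=> _ [q [dq Aq] <-]; exists q => //; split=> //; exact: Ac.
have IB x : (d @` (cdom d `&` A)) x -> (c @` A) (in_chart d c x).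
  by move=> [q [dq Aq] <-]; rewrite in_atlasE //; exists q.
apply: (smooth_eq oI _ (smooth_comp oI IB st sF)) => _ [q [dq Aq] <-].
by rewrite !in_atlasE //; exact: Ac.
Qed.

Lemma smooth_vfield_in c A X : charts c -> open A ->
  A `<=` cdom c -> smooth_on (c @` A) (in_chart c (fun q => X q c)) ->
  smooth_vfield A X.
Proof.
move=> cM oA Ac sX d dM; have oI := chart_open_image hM dM oA.
have oA' : open (c @` A).
  by rewrite (_ : A = cdom c `&` A); [exact: chart_open_image|rewrite setIidr].
have oAd : open (A `&` cdom d) by apply: openI => //; exact: cdom_open.
have sAd : smooth_on (c @` (A `&` cdom d)) (in_chart c (fun q => X q d)).
  have oJ : open (c @` (A `&` cdom d)).
    rewrite (_ : A `&` cdom d = cdom c `&` (A `&` cdom d)); first exact: chart_open_image.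
    by rewrite [RHS]setIidr // => q [/Ac].
  have st : smooth_on (c @` (A `&` cdom d)) (in_chart c d).
    apply: smooth_sub (transition_smooth hM cM dM).
    by move=> _ [q [Aq dq] <-]; exists q => //; split=> //; exact: Ac.
  have sX' : smooth_on (c @` (A `&` cdom d)) (in_chart c (fun q => X q c)).
    by apply: smooth_sub sX => _ [q [Aq dq] <-]; exists q.
  have JJ x : (c @` (A `&` cdom d)) x -> (c @` (A `&` cdom d)) x by [].
  have := smooth_diff_comp oJ JJ (smooth_id _) sX' st.
  apply: (smooth_eq oJ) => _ [q [Aq dq] <-]; have cq := Ac q Aq.
  by rewrite !in_atlasE // -tangentE.
have := smooth_fun_in cM oAd _ sAd dM.
rewrite (_ : cdom d `&` (A `&` cdom d) = cdom d `&` A); last first.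
  by apply/seteqP; split=> q; [move=> [? [? ?]]|move=> [? ?]].
by apply; move=> q [/Ac].
Qed.

Lemma smooth_vfield0 A : open A -> smooth_vfield A (fun=> 0).
Proof. by move=> oA c cM; exact: (smooth_fun_cst (0 : 'rV[R]_n) oA). Qed.

Lemma smooth_vfield_comb A (f : M -> R) X Y : open A -> smooth_fun A f ->
  smooth_vfield A X -> smooth_vfield A Y ->
  smooth_vfield A (fun q => f q *: X q + Y q).
Proof.
move=> oA sf sX sY c cM; have oI := chart_open_image hM cM oA.
have := smoothD oI (smoothZ oI (sf c cM) (sX c cM)) (sY c cM).
by apply: (smooth_eq oI) => _ [q [cq Aq] <-]; rewrite !in_atlasE.
Qed.

Lemma smooth_vfield_sum A (I : Type) (r : seq I) (f : I -> M -> R) (X : I -> vfield M) :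
  open A -> (forall i, smooth_fun A (f i)) -> (forall i, smooth_vfield A (X i)) ->
  smooth_vfield A (fun q => \sum_(i <- r) f i q *: X i q).
Proof.
move=> oA sf sX; elim: r => [|i r IH].
  by apply: smooth_vfield_eq (smooth_vfield0 oA) => // q _; rewrite big_nil.
apply: smooth_vfield_eq (smooth_vfield_comb oA (sf i) (sX i) IH) => // q _.
by rewrite big_cons.
Qed.

Lemma smooth_component A X c j : open A -> A `<=` cdom c -> charts c ->
  smooth_vfield A X -> smooth_fun A (fun q => X q c 0 j).
Proof.
move=> oA Ac cM sX; apply: (smooth_fun_in cM oA Ac).
have EA : cdom c `&` A = A by rewrite setIidr.
have oI : open (c @` A) by rewrite -EA; exact: chart_open_image.
have := sX c cM; rewrite EA => sXc.
apply: (smooth_eq oI _ (smooth_coord oI 0 j sXc)) => _ [q Aq <-].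
by rewrite !in_atlasE //; exact: Ac.
Qed.

Lemma tangent_in_smooth c w : charts c -> smooth_vfield (cdom c) (fun q => tangent_in c q w).
Proof.
move=> cM; have [_ oc] := atlas_chart hM cM.
apply: (smooth_vfield_in cM) => //; first exact: cdom_open.
apply: (smooth_eq oc _ (smooth_cst _ w)) => _ [q cq <-].
by rewrite in_atlasE // tangent_inK.
Qed.

Lemma coord_vfieldK c i p : chart_around p c -> coord_vfield c i p c = delta_mx 0 i.
Proof. exact: tangent_inK. Qed.

Lemma coord_vfield_smooth c i : charts c -> smooth_vfield (cdom c) (coord_vfield c i).
Proof. exact: tangent_in_smooth. Qed.

Lemma vfield_coord_sum c p (v : tangent p) : chart_around p c ->
  v = \sum_i v c 0 i *: coord_vfield c i p.
Proof.
move=> pc; apply: (tangent_ext pc); rewrite tangent_sumE.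
rewrite [LHS]row_sum_delta; apply: eq_bigr => i _.
by rewrite tangentZE coord_vfieldK.
Qed.

Lemma is_diff_component X c j p : chart_around p c ->
  differentiable (in_chart c (fun q => X q c)) (c p) ->
  is_diff (c p) (in_chart c (fun q => X q c 0 j))
    (fun h => 'd (in_chart c (fun q => X q c)) (c p) h 0 j).
Proof.
move=> [cM cp] dX.
have nr : \forall x \near c p,
    in_chart c (fun q => X q c) x 0 j = in_chart c (fun q => X q c 0 j) x.
  apply: near_mono (chart_near hM cM cp (cdom_open hM cM) cp) => _ [q [cq _] <-].
  by rewrite !in_atlasE.
exact: near_is_diff nr (is_diff_coord 0 j dX).
Qed.

Lemma tangent_of_eq0 p (u : chart R M n -> 'rV[R]_n) c : chart_around p c ->
  u c = 0 -> tangent_of p u = 0.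
Proof.
move=> pc uc; apply: (tangent_ext pc); rewrite tangent0E /tangent_of /insubd.
case: insubP => [v _ vE|_] //=.
by rewrite [LHS](congr1 (@^~ c) vE) asboolT.
Qed.

(** Both fields have constant components in the chart [c], so the component of
    the bracket there is 0, which determines a tangent vector; the default value
    of [tangent_of] is 0 too. *)
Lemma bracket_coord c i j p : chart_around p c ->
  bracket (coord_vfield c i) (coord_vfield c j) p = 0.
Proof.
move=> pc; have [cM cp] := pc; apply: (tangent_of_eq0 pc).
have dc k : is_diff (c p) (in_chart c (fun q => coord_vfield c k q c)) 0.
  have nr : \forall x \near c p, cst (delta_mx 0 k) x = in_chart c (fun q => coord_vfield c k q c) x.
    apply: near_mono (chart_near hM cM cp (cdom_open hM cM) cp) => _ [q [cq _] <-].
    by rewrite in_atlasE // coord_vfieldK.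
  exact: near_is_diff nr (is_diff_cst _ _).
have dE k (v : tangent p) : dfun v (fun q => coord_vfield c k q c) = 0.
  have [d _] := dc k.
  by apply: (etrans (dfunE hM v pc d)); exact: is_diffE (dc k).
by rewrite !dE subrr.
Qed.

End SmoothFields.

Section ConnectionsInCharts.
Variables (R : realType) (n : nat) (M : manifold R n) (D : connection M).
Implicit Types (c d : chart R M n) (A : set M) (X Y : vfield M).

Let hM := manifold_is_atlas M.

(** The axiom speaks of [f *: X + X'] only; with [f = 1] and [X = X' = 0] it says
    that the value at the zero field is its own double. *)
Lemma nabla0l A Y p : open A -> smooth_vfield A Y -> A p -> D (fun=> 0) Y p = 0.
Proof.
move=> oA sY Ap; have s0 := smooth_vfield0 hM oA.
have := nabla_linear D oA (smooth_fun_cst hM (1 : R) oA) s0 s0 sY Ap.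
have -> : (fun q => (1 : R) *: (0 : tangent q) + 0) = (fun=> 0) :> vfield M.
  by apply: functional_extensionality_dep => q; rewrite scaler0 addr0.
by rewrite scale1r -[LHS]addr0 => /addrI.
Qed.

Lemma nabla0r A X p : open A -> smooth_vfield A X -> A p -> D X (fun=> 0) p = 0.
Proof.
move=> oA sX Ap; have s0 := smooth_vfield0 hM oA.
have := nabla_leibniz D oA (smooth_fun_cst hM (1 : R) oA) sX s0 s0 Ap.
have -> : (fun q => (1 : R) *: (0 : tangent q) + 0) = (fun=> 0) :> vfield M.
  by apply: functional_extensionality_dep => q; rewrite scaler0 addr0.
by rewrite scaler0 add0r scale1r -[LHS]addr0 => /addrI.
Qed.

Lemma nabla_suml A (I : Type) (r : seq I) (f : I -> M -> R) (X : I -> vfield M) Y p :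
  open A -> (forall i, smooth_fun A (f i)) -> (forall i, smooth_vfield A (X i)) ->
  smooth_vfield A Y -> A p ->
  D (fun q => \sum_(i <- r) f i q *: X i q) Y p = \sum_(i <- r) f i p *: D (X i) Y p.
Proof.
move=> oA sf sX sY Ap; elim: r => [|i r IH].
  rewrite big_nil -(nabla0l oA sY Ap); congr (D _ Y p).
  by apply: functional_extensionality_dep => q; rewrite big_nil.
rewrite big_cons -IH -(nabla_linear D oA) //; last exact: smooth_vfield_sum.
by congr (D _ Y p); apply: functional_extensionality_dep => q; rewrite big_cons.
Qed.

Lemma nabla_sumr A (I : Type) (r : seq I) (f : I -> M -> R) X (Y : I -> vfield M) p :
  open A -> (forall i, smooth_fun A (f i)) -> smooth_vfield A X ->
  (forall i, smooth_vfield A (Y i)) -> A p ->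
  D X (fun q => \sum_(i <- r) f i q *: Y i q) p
  = \sum_(i <- r) (dfun (X p) (f i) *: Y i p + f i p *: D X (Y i) p).
Proof.
move=> oA sf sX sY Ap; elim: r => [|i r IH].
  rewrite big_nil -(nabla0r oA sX Ap); congr (D X _ p).
  by apply: functional_extensionality_dep => q; rewrite big_nil.
rewrite big_cons -IH -(nabla_leibniz D oA) //; last exact: smooth_vfield_sum.
by congr (D X _ p); apply: functional_extensionality_dep => q; rewrite big_cons.
Qed.

(** The Christoffel symbols, collected over the upper index. *)
Definition christoffel c i j x : 'rV[R]_n :=
  in_chart c (fun q => D (coord_vfield c i) (coord_vfield c j) q c) x.

(** Both fields are combinations of coordinate fields near [p], and the axioms
    of a connection apply to such combinations. *)
Lemma nabla_chart c A X Y p : charts c -> open A -> A `<=` cdom c ->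
  smooth_vfield A X -> smooth_vfield A Y -> A p ->
  D X Y p c = 'd (in_chart c (fun q => Y q c)) (c p) (X p c)
    + \sum_i \sum_j (X p c 0 i * Y p c 0 j) *: christoffel c i j (c p).
Proof.
move=> cM oA Ac sX sY Ap; have cp := Ac p Ap.
have pc : chart_around p c by [].
have sC i : smooth_vfield A (coord_vfield c i).
  exact: smooth_vfield_sub Ac (coord_vfield_smooth hM i cM).
have sXi i := smooth_component hM i oA Ac cM sX.
have sYj j := smooth_component hM j oA Ac cM sY.
pose X' : vfield M := fun q => \sum_i X q c 0 i *: coord_vfield c i q.
pose Y' : vfield M := fun q => \sum_i Y q c 0 i *: coord_vfield c i q.
have XE q : A q -> X q = X' q by move=> Aq; apply: vfield_coord_sum => //; split=> //; exact: Ac.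
have YE q : A q -> Y q = Y' q by move=> Aq; apply: vfield_coord_sum => //; split=> //; exact: Ac.
have sX' := smooth_vfield_eq hM oA XE sX.
have sY' := smooth_vfield_eq hM oA YE sY.
rewrite (nabla_local D oA sX sX' sY sY' XE YE Ap).
rewrite (nabla_suml _ oA sXi sC sY' Ap) tangent_sumE.
have dY : differentiable (in_chart c (fun q => Y q c)) (c p).
  by apply: smooth_differentiable (sY c cM) _; exists p.
transitivity (\sum_i X p c 0 i *: ('d (in_chart c (fun q => Y q c)) (c p) (delta_mx 0 i)
    + \sum_j Y p c 0 j *: christoffel c i j (c p))).
  apply: eq_bigr => i _; rewrite tangentZE; congr (_ *: _).
  rewrite (nabla_sumr _ oA sYj (sC i) sC Ap) tangent_sumE.
  under eq_bigr do rewrite tangentDE 2!tangentZE.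
  rewrite big_split /=; congr (_ + _).
    rewrite [RHS]row_sum_delta; apply: eq_bigr => j _.
    rewrite coord_vfieldK //; congr (_ *: _).
    have dj := is_diff_component hM j pc dY.
    have [d _] := dj.
    apply: (etrans (dfunE hM _ pc d)); rewrite coord_vfieldK //.
    exact: is_diffE dj.
  by apply: eq_bigr => j _; rewrite /christoffel in_atlasE.
under eq_bigr do rewrite scalerDr scaler_sumr.
rewrite big_split /=; congr (_ + _).
  exact: esym (diff_sum_coord ('d (in_chart c (fun q => Y q c)) (c p)) (X p c)).
by apply: eq_bigr => i _; apply: eq_bigr => j _; rewrite scalerA.
Qed.

Lemma christoffel_smooth c i j : charts c ->
  smooth_on (c @` cdom c) (christoffel c i j).
Proof.
move=> cM; have oc := cdom_open hM cM.
have := nabla_smooth D oc (coord_vfield_smooth hM i cM) (coord_vfield_smooth hM j cM) cM.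
by rewrite setIid.
Qed.

Hypothesis flatD : flat D.

Lemma christoffel_sym c i j x : charts c -> (c @` cdom c) x ->
  christoffel c i j x = christoffel c j i x.
Proof.
move=> cM [p cp <-]; have pc : chart_around p c by [].
have sC k := coord_vfield_smooth hM k cM.
have [tor _] := flatD (cdom_open hM cM) (sC i) (sC j) (sC j) cp.
rewrite /christoffel !in_atlasE //; congr (components _ c).
by move: tor; rewrite /torsion bracket_coord // subr0 => /eqP; rewrite subr_eq0 => /eqP.
Qed.

Lemma christoffel_curvature c l i j x : charts c -> (c @` cdom c) x ->
  'd (christoffel c i j) x (delta_mx 0 l)
    + \sum_k christoffel c i j x 0 k *: christoffel c l k x
  = 'd (christoffel c l j) x (delta_mx 0 i)
    + \sum_k christoffel c l j x 0 k *: christoffel c i k x.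
Proof.
move=> cM [p cp <-]; have pc : chart_around p c by [].
have oc := cdom_open hM cM.
have sC k := coord_vfield_smooth hM k cM.
have [_ cur] := flatD oc (sC l) (sC i) (sC j) cp.
have E a b : D (coord_vfield c a) (D (coord_vfield c b) (coord_vfield c j)) p c
    = 'd (christoffel c b j) (c p) (delta_mx 0 a)
      + \sum_k christoffel c b j (c p) 0 k *: christoffel c a k (c p).
  rewrite (nabla_chart cM oc _ (sC a) (nabla_smooth D oc (sC b) (sC j)) cp) //.
  rewrite coord_vfieldK //; congr (_ + _).
  rewrite (bigD1 a) //= [X in _ + X]big1 => [|a' aa']; last first.
    by apply: big1 => k _; rewrite mxE eqxx (negbTE aa') mul0r scale0r.
  rewrite addr0; apply: eq_bigr => k _; rewrite mxE !eqxx mul1r.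
  by congr (_ *: _); rewrite /christoffel in_atlasE.
have s0 := smooth_vfield0 hM oc.
have b0 q : cdom c q -> (0 : tangent q) = bracket (coord_vfield c l) (coord_vfield c i) q.
  by move=> cq; rewrite bracket_coord.
have sb := smooth_vfield_eq hM oc b0 s0.
have Db : D (bracket (coord_vfield c l) (coord_vfield c i)) (coord_vfield c j) p = 0.
  rewrite -(nabla_local D oc s0 sb (sC j) (sC j) b0 (fun q _ => erefl) cp).
  exact: nabla0l oc (sC j) cp.
move: cur; rewrite /curvature Db subr0 => /eqP; rewrite subr_eq0 => /eqP cur.
by rewrite -!E cur.
Qed.

End ConnectionsInCharts.

(** * Existence of affine charts *)

Section ReparametrizedCharts.
Variables (R : realType) (n : nat) (M : manifold R n).
Implicit Types (c d : chart R M n).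

Let hM := manifold_is_atlas M.

Variables (c : chart R M n) (V : set 'rV[R]_n) (phi psi : 'rV[R]_n -> 'rV[R]_n).
Hypotheses (cM : charts c) (oV : open V) (Vc : V `<=` c @` cdom c)
  (sphi : smooth_on V phi) (oW : open (phi @` V)) (spsi : smooth_on (phi @` V) psi)
  (psiK : forall x, V x -> psi (phi x) = x).

Definition reparam_chart : chart R M n :=
  Chart (cdom c `&` [set p | V (c p)]) (fun p => phi (c p)).

Lemma reparam_image : c @` cdom reparam_chart = V.
Proof.
apply/seteqP; split=> [_ [p [_ Vp] <-] //|x Vx].
by have [p cp px] := Vc Vx; exists p => //; split=> //=; rewrite px.
Qed.

Lemma reparam_open : open (cdom reparam_chart).
Proof. by apply: (chart_open hM cM) => [p []|]; rewrite ?reparam_image. Qed.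

Lemma reparam_is_chart : is_chart reparam_chart.
Proof.
split=> [p q|].
  rewrite !inE => -[cp Vp] [cq Vq] /= pq.
  by apply: (chart_inj hM cM cp cq); rewrite -(psiK Vp) pq psiK.
rewrite (_ : reparam_chart @` cdom reparam_chart = phi @` V) //.
rewrite -[in RHS]reparam_image; apply/seteqP; split=> [_ [p dp <-]|_ [_ [p dp <-] <-]].
  by exists (c p) => //; exists p.
by exists p.
Qed.

(** By maximality of the atlas; [psi] gives the transition maps out of the new
    chart. *)
Lemma reparam_in_charts : charts (a := M) reparam_chart.
Proof.
apply: (manifold_maximal reparam_is_chart) => d dM.
have od := cdom_open hM dM.
have oA : open (cdom reparam_chart `&` cdom d) by apply: openI => //; exact: reparam_open.
have Wimg : reparam_chart @` (cdom reparam_chart `&` cdom d)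
    = (phi @` V) `&` psi @^-1` (c @` (cdom reparam_chart `&` cdom d)).
  apply/seteqP; split=> [_ [p [[cp Vp] dp] <-]|_ [[x Vx <-]]] /=.
    by split; [exists (c p)|rewrite psiK //; exists p].
  by rewrite psiK // => -[p hp px]; exists p => //=; rewrite px.
have oC : open (c @` (cdom reparam_chart `&` cdom d)).
  rewrite (_ : _ `&` _ = cdom c `&` (cdom reparam_chart `&` cdom d)).
    exact: chart_open_image.
  by rewrite [RHS]setIidr // => q [[]].
have oI : open (reparam_chart @` (cdom reparam_chart `&` cdom d)).
  rewrite Wimg openE => z [Wz Cz].
  have ct := smooth_continuous spsi Wz.
  have n1 := ct _ (near_open oC Cz).
  by apply: near_mono2 (near_open oW Wz) n1 => y.
have oJ : open (d @` (cdom reparam_chart `&` cdom d)).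
  rewrite (_ : _ `&` _ = cdom d `&` (cdom reparam_chart `&` cdom d)).
    exact: chart_open_image.
  by rewrite [RHS]setIidr // => q [].
split=> //.
- have IB z : (reparam_chart @` (cdom reparam_chart `&` cdom d)) z ->
      (c @` (cdom c `&` cdom d)) (psi z).
    by move=> [p [[cp Vp] dp] <-] /=; rewrite psiK //; exists p.
  have spsi' : smooth_on (reparam_chart @` (cdom reparam_chart `&` cdom d)) psi.
    by apply: smooth_sub spsi; rewrite Wimg => z [].
  have := smooth_comp oI IB spsi' (transition_smooth hM cM dM).
  apply: (smooth_eq oI) => _ [p [[cp Vp] dp] <-].
  rewrite (in_chartE _ reparam_is_chart) //= psiK // (in_atlasE hM) //.
- have st : smooth_on (d @` (cdom reparam_chart `&` cdom d)) (in_chart d c).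
    apply: smooth_sub (transition_smooth hM dM cM).
    by move=> _ [p [[cp Vp] dp] <-]; exists p.
  have JV z : (d @` (cdom reparam_chart `&` cdom d)) z -> V (in_chart d c z).
    by move=> [p [[cp Vp] dp] <-]; rewrite (in_atlasE hM).
  have := smooth_comp oJ JV st sphi.
  by apply: (smooth_eq oJ) => _ [p [[cp Vp] dp] <-]; rewrite !(in_atlasE hM).
Qed.

End ReparametrizedCharts.

Section AffineCharts.
Variables (R : realType) (n : nat) (M : manifold R n) (D : connection M).
Hypothesis flatD : flat D.

Let hM := manifold_is_atlas M.

(** Compose a chart with flat coordinates [phi] for its Christoffel symbols. The
    new coordinate fields have components [E j] with [d phi (E j)] constant.
    Differentiating this identity along [E i] and inserting the equation for the
    second derivatives of [phi] yields [d phi (nabla_(E i) (E j)) = 0]. *)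
Lemma affine_chart_exists (p : M) : exists c, affine_chart D c /\ cdom c p.
Proof.
have [c [cM cp]] := atlas_cover hM p.
have [_ oc] := atlas_chart hM cM.
have hp : (c @` cdom c) (c p) by exists p.
have [V [phi [psi [[oV Vp] Vc sphi [oW spsi psiK Ju] dd]]]] := flat_coordinates oc hp
  (fun i j => christoffel_smooth D i j cM)
  (fun i j x Ux => christoffel_sym flatD i j cM Ux)
  (fun l i j x Ux => christoffel_curvature flatD l i j cM Ux).
pose c' := reparam_chart c V phi.
have c'M : charts c' := reparam_in_charts cM oV Vc sphi oW spsi psiK.
have oA : open (cdom c') := cdom_open hM c'M.
have Ac : cdom c' `<=` cdom c by move=> q [].
exists c'; split=> //; split=> // q c'q i j.
have [cq Vq] := c'q.
have qc : chart_around q c by []; have qc' : chart_around q c' by [].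
apply: (tangent_ext qc); rewrite tangent0E.
have sE k : smooth_vfield (cdom c') (coord_vfield c' k) := coord_vfield_smooth hM k c'M.
rewrite (nabla_chart D cM oA Ac (sE i) (sE j) c'q).
pose E k := in_chart c (fun p => coord_vfield c' k p c).
have phiE k (r : M) : cdom c' r -> 'd phi (c r) (coord_vfield c' k r c) = delta_mx 0 k.
  move=> c'r; have [cr Vr] := c'r; have rc : chart_around r c by [].
  have nr : \forall x \near c r, phi x = in_chart c c' x.
    apply: near_mono (chart_near hM cM cr oA c'r) => _ [s [cs _] <-].
    by rewrite (in_atlasE hM).
  have dphi := smooth_differentiable sphi Vr.
  rewrite -(coord_vfieldK hM k (conj c'M c'r)) (tangentE (coord_vfield c' k r) rc (conj c'M c'r)).
  exact: esym (is_diffE _ (near_eq_is_diff nr dphi)).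
have EE k : E k (c q) = coord_vfield c' k q c by rewrite /E (in_atlasE hM).
have dE : differentiable (E j) (c q).
  by apply: smooth_differentiable (sE j c cM) _; exists q.
have dphib b : is_diff (c q) (fun y => 'd phi y (delta_mx 0 b))
    ('d (fun y => 'd phi y (delta_mx 0 b)) (c q)).
  exact: differentiableP (smooth_differentiable (smooth_diff (delta_mx 0 b) sphi) Vq).
have d1 : is_diff (c q) (fun y => \sum_b E j y 0 b *: 'd phi y (delta_mx 0 b))
   (fun v => \sum_b (E j (c q) 0 b *: 'd (fun y => 'd phi y (delta_mx 0 b)) (c q) v
      + 'd (E j) (c q) v 0 b *: 'd phi (c q) (delta_mx 0 b))).
  apply: is_diff_sum => b.
  exact: is_diff_mul_fun (is_diff_coord 0 b dE) (dphib b).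
have nr : \forall x \near c q, cst (delta_mx 0 j) x = \sum_b E j x 0 b *: 'd phi x (delta_mx 0 b).
  apply: near_mono (chart_near hM cM cq oA c'q) => _ [r [cr c'r] <-].
  rewrite /E (in_atlasE hM) //.
  by apply: (etrans (esym (phiE j r c'r))); exact: diff_sum_coord.
have d0 := near_is_diff nr (is_diff_cst (delta_mx 0 j : 'rV[R]_n) (c q)).
have key v := is_diff_unique d1 d0 v.
set v := coord_vfield c' i q c; set w := coord_vfield c' j q c.
have injd (u : 'rV[R]_n) : 'd phi (c q) u = 0 -> u = 0.
  move=> h; apply: (etrans (esym (mulmxK (Ju _ Vq) u))).
  have -> : u *m jac phi (c q) = 0 by exact: etrans (mul_jac phi (c q) u) h.
  exact: mul0mx.
apply: injd.
apply: (etrans (linearD ('d phi (c q)) _ _)).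
have := key v; rewrite big_split /= => kv.
apply: (etrans _ kv); rewrite addrC.
apply: (congr2 +%R); first exact: (diff_sum_coord ('d phi (c q)) ('d (E j) (c q) v)).
apply: (etrans (linear_sum ('d phi (c q)) _ _ _)).
transitivity (\sum_a \sum_b (v 0 a * w 0 b) *: 'd phi (c q) (christoffel D c a b (c q))).
  apply: eq_bigr => a _; apply: (etrans (linear_sum ('d phi (c q)) _ _ _)).
  by apply: eq_bigr => b _; exact: (linearZZ ('d phi (c q))).
rewrite exchange_big /=; apply: eq_bigr => b _; rewrite EE -/w.
have db := diff_sum_coord ('d (fun y => 'd phi y (delta_mx 0 b)) (c q)) v.
apply: (etrans _ (congr1 (fun u => w 0 b *: u) (esym db))).
rewrite scaler_sumr; apply: eq_bigr => a _; rewrite scalerA mulrC; congr (_ *: _).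
exact: esym (dd _ Vq a b).
Qed.

End AffineCharts.

(** * Dombrowski's construction in affine charts *)

Section AffineChartNabla.
Variables (R : realType) (n : nat) (M : manifold R n) (D : connection M).
Implicit Types (c : chart R M n) (A : set M) (X Y : vfield M).

Let hM := manifold_is_atlas M.

Lemma nabla_affine_chart c A X Y p : affine_chart D c -> open A ->
  smooth_vfield A X -> smooth_vfield A Y -> A p -> cdom c p ->
  D X Y p c = 'd (in_chart c (fun q => Y q c)) (c p) (X p c).
Proof.
move=> [cM aff] oA sX sY Ap cp.
have oB : open (A `&` cdom c) by apply: openI => //; exact: cdom_open.
have BA : A `&` cdom c `<=` A by move=> q [].
have Bc : A `&` cdom c `<=` cdom c by move=> q [].
have Bp : (A `&` cdom c) p by [].
rewrite (nabla_chart D cM oB Bc (smooth_vfield_sub BA sX) (smooth_vfield_sub BA sY) Bp).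
rewrite big1 ?addr0 // => i _; rewrite big1 // => j _.
by rewrite /christoffel (in_atlasE hM) // aff // scaler0.
Qed.

Lemma affine_chart_restrict c (V : set 'rV[R]_n) : affine_chart D c -> open V ->
  V `<=` c @` cdom c -> affine_chart D (reparam_chart c V id).
Proof.
move=> [cM aff] oV Vc; set c' := reparam_chart c V id.
have E : id @` V = V by rewrite image_id.
have oW : open ((fun x : 'rV[R]_n => x) @` V) by rewrite E.
have sW : smooth_on ((fun x : 'rV[R]_n => x) @` V) id by exact: smooth_id.
have c'M : charts c'.
  exact: (reparam_in_charts cM oV Vc (smooth_id V) oW sW (fun _ _ => erefl)).
split=> // p c'p i j; have [cp Vp] := c'p.
have eqf k q : cdom c' q -> coord_vfield c' k q = coord_vfield c k q.
  move=> c'q; have [cq Vq] := c'q.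
  have qc : chart_around q c by []; have qc' : chart_around q c' by [].
  apply: (tangent_ext qc); apply: (etrans _ (esym (coord_vfieldK hM k qc))).
  apply: (etrans (tangent_inE hM (delta_mx 0 k) qc' qc)).
  have nr : \forall x \near c' q, id x = in_chart c' c x.
    apply: near_mono (chart_near hM c'M c'q (cdom_open hM c'M) c'q) => _ [r [c'r _] <-].
    by rewrite (in_atlasE hM).
  exact: is_diffE (near_is_diff nr (is_diff_id (c' q))).
have oc' := cdom_open hM c'M.
have sub : cdom c' `<=` cdom c by move=> q [].
have s1 k := coord_vfield_smooth hM k c'M.
have s2 k := smooth_vfield_sub sub (coord_vfield_smooth hM k cM).
rewrite (nabla_local D oc' (s1 i) (s2 i) (s1 j) (s2 j) (eqf i) (eqf j) c'p).
exact: aff.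
Qed.

End AffineChartNabla.

Section Dombrowski.
Variables (R : realType) (n : nat) (M : manifold R n) (D : connection M).
Hypothesis flatD : flat D.
Local Notation TM := (tangent_bundle M).
Implicit Types (c : chart R M n) (u : TM).

Let hM := manifold_is_atlas M.
Let hTM := tangent_bundle_is_atlas hM.

(** Near each vector, the vertical part in some affine chart at its foot point
    has the property required of a connector. *)
Lemma connectorP : is_connector D (connector D).
Proof.
have ex (u : TM) := affine_chart_exists flatD (TM_proj u).
pose c (u : TM) := sval (cid (ex u)).
have cP u : affine_chart D (c u) /\ cdom (c u) (TM_proj u) by rewrite /c; case: cid.
have ca u : chart_around (TM_proj u) (c u) by have [[]] := cP u.
pose K u (a : tangent u) : tangent (TM_proj u) :=
  tangent_in (c u) (TM_proj u) (rsubmx (a (tangent_chart (c u)))).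
rewrite /connector; apply: (xgetPex (fun _ _ => 0)); exists K; split.
  move=> u k a b; apply: (tangent_ext (ca u)).
  by rewrite tangentDE tangentZE !tangent_inK // tangentDE tangentZE linearP.
move=> A X Y oA sX sY p Ap; set u := TM_section Y p.
have [ac cp] := cP u; apply: (tangent_ext (ca u)); rewrite tangent_inK //.
rewrite (pushforward_TM_section hM oA sY (X p) Ap (ca u)) row_mxKr.
exact: esym (nabla_affine_chart ac oA sX sY Ap cp).
Qed.

Lemma matrix_through (v b : 'rV[R]_n) : v != 0 -> exists B : 'M[R]_n, v *m B = b.
Proof.
move=> /rV0Pn[i vi]; exists (\matrix_(k, j) (if k == i then b 0 j / v 0 i else 0)).
apply/rowP => j; rewrite mxE (bigD1 i) //= big1 => [|k ki]; last first.
  by rewrite mxE (negbTE ki) mulr0.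
by rewrite mxE eqxx addr0 mulrCA mulfV // mulr1.
Qed.

(** The defining property of the connector reaches all tangent vectors that are
    not vertical: they are the images [Y_* X] for affine [Y] and constant [X]. *)
Lemma connector_non_vertical u (a : tangent u) c : affine_chart D c ->
  cdom c (TM_proj u) -> lsubmx (a (tangent_chart c)) != 0 ->
  connector D a c = rsubmx (a (tangent_chart c)).
Proof.
move=> ac; have [cM _] := ac; case: u a => p r a /= cp v0.
have pc : chart_around p c by [].
have [B vB] := matrix_through (rsubmx (a (tangent_chart c))) v0.
have aE : a (tangent_chart c) = row_mx (lsubmx (a (tangent_chart c)))
    (lsubmx (a (tangent_chart c)) *m B) by rewrite vB hsubmxK.
rewrite -vB; move: (lsubmx _) aE => v aE {v0 vB}.
(* [Y] is to be built from the components of [r], so that [r] can be replaced by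
   [Y p] in the type of [a]. *)
have : r = tangent_in c p (r c) by rewrite tangent_in_components.
move: (r c) => w rE.
pose Y : vfield M := fun q => tangent_in c q (w + (c q - c p) *m B).
pose X : vfield M := fun q => tangent_in c q v.
have {rE} rY : r = Y p by rewrite rE /Y subrr mul0mx addr0.
subst r.
have oc := cdom_open hM cM; have [_ oi] := atlas_chart hM cM.
have sX : smooth_vfield (cdom c) X by exact: tangent_in_smooth.
pose G (x : 'rV[R]_n) := w + (x - c p) *m B.
have sG S : open S -> smooth_on S G.
  move=> oS; apply: (smoothD oS (smooth_cst _ w)); apply: (smooth_mulmxr oS).
  exact: (smoothB oS (smooth_id _) (smooth_cst _ (c p))).
have inG q : cdom c q -> G (c q) = in_chart c (fun q => Y q c) (c q).
  by move=> cq; rewrite (in_atlasE hM) // tangent_inK.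
have sY : smooth_vfield (cdom c) Y.
  apply: (smooth_vfield_in hM cM oc) => //.
  by apply: (smooth_eq oi _ (sG _ oi)) => _ [q cq <-]; exact: inG.
have nr : \forall x \near c p, G x = in_chart c (fun q => Y q c) x.
  by apply: near_mono (chart_near hM cM cp oc cp) => _ [q [cq _] <-]; exact: inG.
have dG : is_diff (c p) G (mulmxr B).
  have d1 := is_diffB (is_diff_id (c p)) (is_diff_cst (c p) (c p)).
  have d2 := is_diff_comp d1 (is_diff_linear (mulmxr B) _).
  have d3 := is_diffD (is_diff_cst w (c p)) d2.
  by apply: is_diff_eq d3 _; rewrite add0r subr0.
have dY z : 'd (in_chart c (fun q => Y q c)) (c p) z = z *m B.
  exact: is_diffE (near_is_diff nr dG).
have Xc : X p c = v by rewrite tangent_inK.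
have -> : a = pushforward (TM_section Y) (X p).
  have tc : chart_around (M := TM) (TM_section Y p) (tangent_chart c).
    exact: (@tangent_chart_around _ _ _ (TM_section Y p) c pc).
  apply: (tangent_ext tc); rewrite (pushforward_TM_section hM oc sY (X p) cp pc).
  by rewrite dY Xc.
have [_ KP] := connectorP.
rewrite (KP (cdom c) X Y oc sX sY p cp).
by rewrite (nabla_affine_chart ac oc sX sY cp cp) dY Xc.
Qed.

(** The connector is linear, and a vertical vector is the difference of two
    vectors that are not vertical. *)
Lemma verticalE u (a : tangent u) c : affine_chart D c -> cdom c (TM_proj u) ->
  vertical D a c = rsubmx (a (tangent_chart c)).
Proof.
move=> ac cu; have [cM _] := ac.
have uc := @tangent_chart_around _ _ _ u c (conj cM cu).
have [v0|] := eqVneq (lsubmx (a (tangent_chart c))) 0; last exact: connector_non_vertical.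
apply/rowP => i.
have e0 : (delta_mx 0 i : 'rV[R]_n) != 0.
  by apply/rV0Pn; exists i; rewrite mxE !eqxx oner_eq0.
pose lift b : tangent u := tangent_in (M := TM) (tangent_chart c) u (row_mx (delta_mx 0 i) b).
have liftE b : lift b (tangent_chart c) = row_mx (delta_mx 0 i) b by exact: tangent_inK.
pose b := rsubmx (a (tangent_chart c)).
have aE : a = -1 *: lift 0 + lift b.
  apply: (tangent_ext uc); rewrite tangentDE tangentZE !liftE scaleN1r.
  by rewrite opp_row_mx add_row_mx addNr oppr0 add0r -v0 hsubmxK.
have [linK _] := connectorP.
rewrite {1}/vertical {1}aE linK tangentDE tangentZE.
by rewrite !(connector_non_vertical ac cu) ?liftE ?row_mxKl // !row_mxKr scaler0 add0r.
Qed.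

Lemma horizontalE u (a : tangent u) c : chart_around (TM_proj u) c ->
  horizontal a c = lsubmx (a (tangent_chart c)).
Proof. exact: pushforward_TM_proj. Qed.

Lemma horizontal_vertical_ext u (a b : tangent u) :
  horizontal a = horizontal b -> vertical D a = vertical D b -> a = b.
Proof.
move=> hab vab; have [c [ac cu]] := affine_chart_exists flatD (TM_proj u).
have pc : chart_around (TM_proj u) c by have [] := ac.
apply: (tangent_ext (tangent_chart_around pc)).
rewrite -[LHS]hsubmxK -[RHS]hsubmxK -!horizontalE // -!verticalE //.
by rewrite hab vab.
Qed.

Lemma horizontal_vertical_exists u (v w : tangent (TM_proj u)) :
  exists a : tangent u, horizontal a = v /\ vertical D a = w.
Proof.
have [c [ac cu]] := affine_chart_exists flatD (TM_proj u).
have pc : chart_around (TM_proj u) c by have [] := ac.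
have uc := @tangent_chart_around _ _ _ u c pc.
exists (tangent_in (M := TM) (tangent_chart c) u (row_mx (v c) (w c))).
split; apply: (tangent_ext pc); rewrite ?horizontalE ?verticalE //.
  by rewrite tangent_inK // row_mxKl.
by rewrite tangent_inK // row_mxKr.
Qed.

Lemma dombrowski_JP u (a : tangent u) :
  horizontal (dombrowski_J D a) = - vertical D a /\
  vertical D (dombrowski_J D a) = horizontal a.
Proof.
have [b hb] := horizontal_vertical_exists (- vertical D a) (horizontal a).
exact: (@xgetPex _ (0 : tangent u)
  [set b | horizontal b = - vertical D a /\ vertical D b = horizontal a]
  (ex_intro _ b hb)).
Qed.

End Dombrowski.

(** * Affine, holomorphic and isometric maps *)

(** The mean value inequality on a ball, first for the derivatives of [F], then
    for [F]. *)
Lemma affine_of_second_derivative0 (R : realType) m n (F : 'rV[R]_m -> 'rV[R]_n)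
    (x0 : 'rV[R]_m) (r : R) (V := [set x | `|x - x0| < r]) : 0 < r ->
  smooth_on V F -> (forall x v w, V x -> 'd (fun y => 'd F y w) x v = 0) ->
  forall x, V x -> F x = F x0 + (x - x0) *m lin1_mx ('d F x0).
Proof.
move=> r0 sF d0 x Vx.
have seg y (t : R) : V y -> 0 <= t <= 1 -> V (x0 + t *: (y - x0)).
  move=> Vy /andP[t0 t1]; rewrite /V /= addrAC subrr add0r normrZ ger0_norm //.
  by apply: le_lt_trans Vy; rewrite ler_piMl.
have Vx0 : V x0 by rewrite /V /= subrr normr0.
have eq0 (a b : R) : `|a - b - 0| <= 0 -> a = b.
  by rewrite subr0 normr_le0 subr_eq0 => /eqP.
have dF y w : V y -> 'd F y w = 'd F x0 w.
  move=> Vy; apply/rowP => j; apply: eq0.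
  have dw z : V z -> is_diff z (fun y => 'd F y w 0 j) (fun v => 'd (fun y => 'd F y w) z v 0 j).
    by move=> Vz; exact: is_diff_coord 0 j (smooth_differentiable (smooth_diff w sF) Vz).
  have := @mean_value_ineq _ _ (fun y => 'd F y w 0 j) x0 (y - x0) 0 0.
  rewrite [x0 + (y - x0)]addrC subrK; apply=> t tI; have Vz := seg y t Vy tI.
    by have [] := dw _ Vz.
  rewrite subr0 normr_le0; apply/eqP; apply: (etrans (is_diffE _ (dw _ Vz))).
  by apply: (etrans (congr1 (fun u : 'rV[R]_n => u 0 j) (d0 _ _ _ Vz))); rewrite mxE.
apply/rowP => j; apply/eqP; rewrite -subr_eq0 -normr_le0 mul_rV_lin1.
have := @mean_value_ineq _ _ (fun y => F y 0 j) x0 (x - x0) ('d F x0 (x - x0) 0 j) 0.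
rewrite [x0 + (x - x0)]addrC subrK !mxE opprD addrA; apply=> t tI; have Vz := seg x t Vx tI.
  by have [] := is_diff_coord 0 j (smooth_differentiable sF Vz).
rewrite normr_le0 subr_eq0; apply/eqP.
apply: (etrans (is_diffE _ (is_diff_coord 0 j (smooth_differentiable sF Vz)))).
exact: (congr1 (fun u : 'rV[R]_n => u 0 j) (dF _ _ Vz)).
Qed.

Lemma metric0r (R : realType) n (M : manifold R n) (h : metric M) (p : M)
    (v : tangent p) : h p v 0 = 0.
Proof.
have := metricP h 1 (0 : tangent p) 0 v; rewrite scaler0 addr0 mul1r metricC.
by rewrite -[LHS]addr0 => /addrI.
Qed.

Section Main.
Variables (R : realType) (n n' : nat) (M : manifold R n) (M' : manifold R n').
Variables (D : connection M) (D' : connection M').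
Hypotheses (flatD : flat D) (flatD' : flat D').
Variables (f : M -> M') (sf : smooth_map f).
Local Notation TM := (tangent_bundle M).
Local Notation TM' := (tangent_bundle M').

Let hM := manifold_is_atlas M.
Let hM' := manifold_is_atlas M'.

Lemma horizontal_tangent_map (u : TM) (a : tangent u) :
  horizontal (pushforward (tangent_map f) a) = pushforward f (horizontal a).
Proof.
have [c pc] := atlas_cover hM (TM_proj u).
have [d pd] := atlas_cover hM' (f (TM_proj u)).
apply: (tangent_ext pd).
rewrite (@horizontalE _ _ M' (tangent_map f u) _ d pd).
rewrite (pushforward_tangent_map hM hM' sf a pc pd) row_mxKl.
rewrite (pushforwardE hM hM' (horizontal a) (smooth_map_near hM' sf) pc pd).
by rewrite horizontalE.
Qed.

Lemma vertical_tangent_map (u : TM) (a : tangent u) c d :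
  affine_chart D c -> affine_chart D' d ->
  cdom c (TM_proj u) -> cdom d (f (TM_proj u)) ->
  vertical D' (pushforward (tangent_map f) a) d
  = 'd (fun x => 'd (in_chart c (d \o f)) x (projT2 u c)) (c (TM_proj u)) (horizontal a c)
    + pushforward f (vertical D a) d.
Proof.
move=> ac ad cu du; have [cM _] := ac; have [dM _] := ad.
have pc : chart_around (TM_proj u) c by [].
have pd : chart_around (f (TM_proj u)) d by [].
rewrite (@verticalE _ _ M' D' flatD' (tangent_map f u) _ d ad du).
rewrite (pushforward_tangent_map hM hM' sf a pc pd) row_mxKr.
rewrite (pushforwardE hM hM' (vertical D a) (smooth_map_near hM' sf) pc pd).
by rewrite horizontalE // (verticalE flatD).
Qed.

(** In affine charts the defect between the two sides is the second derivative
    of the local expression of the map. *)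
Lemma vertical_affine (u : TM) (a : tangent u) : affine_map D D' f ->
  vertical D' (pushforward (tangent_map f) a) = pushforward f (vertical D a).
Proof.
move=> [_ aff]; have [c [d [ac ad cu sub [A [B AB]]]]] := aff (TM_proj u).
have [cM _] := ac; have [dM _] := ad.
have du : cdom d (f (TM_proj u)) by apply: sub; exists (TM_proj u).
have pd : chart_around (f (TM_proj u)) d by [].
apply: (tangent_ext pd); rewrite (vertical_tangent_map a ac ad cu du).
pose F := in_chart c (d \o f).
have [_ oc] := atlas_chart hM cM.
have dF x w : (c @` cdom c) x -> 'd F x w = w *m A.
  move=> cx; have nr : \forall y \near x, y *m A + B = F y.
    apply: near_mono (near_open oc cx) => _ [q cq <-].
    by rewrite /F (in_atlasE hM) //= AB.
  have dA := is_diffD (is_diff_linear (mulmxr A) x) (is_diff_cst B x).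
  by apply: (etrans (is_diffE w (near_is_diff nr dA))); rewrite /= addr0.
have cx : (c @` cdom c) (c (TM_proj u)) by exists (TM_proj u).
have nr : \forall y \near c (TM_proj u), cst (projT2 u c *m A) y = 'd F y (projT2 u c).
  by apply: near_mono (near_open oc cx) => y cy; exact: esym (dF y _ cy).
have -> : 'd (fun x => 'd F x (projT2 u c)) (c (TM_proj u)) (horizontal a c) = 0.
  exact: is_diffE (near_is_diff nr (is_diff_cst _ _)).
by rewrite add0r.
Qed.

Lemma pushforwardN p (v : tangent p) : pushforward f (- v) = - pushforward f v.
Proof.
have [c pc] := atlas_cover hM p; have [d pd] := atlas_cover hM' (f p).
have sp := @smooth_map_near _ _ _ _ _ hM' f p sf.
apply: (tangent_ext pd); rewrite tangentNE !(pushforwardE hM hM' _ sp pc pd).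
by rewrite tangentNE linearN.
Qed.

Lemma pushforward0 p : pushforward f (0 : tangent p) = 0.
Proof.
have [c pc] := atlas_cover hM p; have [d pd] := atlas_cover hM' (f p).
have sp := @smooth_map_near _ _ _ _ _ hM' f p sf.
apply: (tangent_ext pd); rewrite (pushforwardE hM hM' _ sp pc pd).
by rewrite !tangent0E linear0.
Qed.

Lemma holomorphic_of_affine : affine_map D D' f ->
  holomorphic (@dombrowski_J R n M D) (@dombrowski_J R n' M' D') (tangent_map f).
Proof.
move=> aff; split; first exact: tangent_map_smooth.
move=> u a; have [hJ vJ] := dombrowski_JP flatD a.
have [hJ' vJ'] := dombrowski_JP flatD' (pushforward (tangent_map f) a).
apply: (horizontal_vertical_ext flatD').
  by rewrite hJ' horizontal_tangent_map hJ vertical_affine // pushforwardN.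
by rewrite vJ' vertical_affine // vJ horizontal_tangent_map.
Qed.

(** The tangent map sends [J a], for [a] without vertical part, to a vector
    without horizontal part. Compatibility with [J] then says that the image of [a]
    has no vertical part either. *)
Lemma second_derivative_of_holomorphic c d q v w :
  holomorphic (@dombrowski_J R n M D) (@dombrowski_J R n' M' D') (tangent_map f) ->
  affine_chart D c -> affine_chart D' d -> cdom c q -> cdom d (f q) ->
  'd (fun x => 'd (in_chart c (d \o f)) x w) (c q) v = 0.
Proof.
move=> [_ hol] ac ad cq dq; have [cM _] := ac.
have qc : chart_around q c by [].
pose u : TM := existT _ q (tangent_in c q w).
have [a [ha va]] := horizontal_vertical_exists flatD (u := u) (tangent_in c q v) 0.
have [hJ _] := dombrowski_JP flatD a.
have [hJ' _] := dombrowski_JP flatD' (pushforward (tangent_map f) a).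
have := congr1 (@horizontal _ _ _ _) (hol u a).
rewrite horizontal_tangent_map hJ hJ' va oppr0 pushforward0 => /esym/eqP.
rewrite oppr_eq0 => /eqP vP.
have := vertical_tangent_map a ac ad cq dq.
have uw : projT2 u c = w by exact: (tangent_inK hM w qc).
rewrite vP va pushforward0 ha uw (tangent_inK hM v qc) => E.
exact: esym (etrans E (addr0 _)).
Qed.

Lemma affine_of_holomorphic :
  holomorphic (@dombrowski_J R n M D) (@dombrowski_J R n' M' D') (tangent_map f) ->
  affine_map D D' f.
Proof.
move=> hol; split=> // p.
have [c [ac cp]] := affine_chart_exists flatD p.
have [d [ad dp]] := affine_chart_exists flatD' (f p).
have [cM _] := ac; have [dM _] := ad.
have oI := chart_overlap_open hM hM' sf cM dM.
have Ip : chart_overlap f c d (c p) by exists p.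
have [r r0 hr] := near_norm (near_open oI Ip).
pose V := [set x | `|x - c p| < r].
have VI : V `<=` chart_overlap f c d by move=> x; exact: hr.
have oV : open V.
  rewrite (_ : V = ball (c p) r); first exact: ball_open.
  by apply/seteqP; split=> x; rewrite -ball_normE /V /= distrC.
have Vc : V `<=` c @` cdom c by move=> x /VI[q [cq _] <-]; exists q.
have sV : smooth_on V (in_chart c (d \o f)).
  exact: smooth_sub VI (chart_overlap_smooth sf cM dM).
have d2 x v w : V x -> 'd (fun y => 'd (in_chart c (d \o f)) y w) x v = 0.
  by move=> /VI[q [cq dq] <-]; exact: second_derivative_of_holomorphic.
have FE := affine_of_second_derivative0 r0 sV d2.
pose A := lin1_mx ('d (in_chart c (d \o f)) (c p)).
have Vdom q : cdom (reparam_chart c V id) q -> cdom d (f q).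
  move=> [cq /VI[q' [cq' dq'] qq']].
  by have <- : q' = q := chart_inj hM cM cq' cq qq'.
exists (reparam_chart c V id), d; split=> //.
- exact: affine_chart_restrict.
- by split=> //; rewrite /V /= subrr normr0.
- by move=> _ [q hq <-]; exact: Vdom.
exists A, (d (f p) - c p *m A) => q [cq Vq].
have := FE _ Vq; rewrite !(in_atlasE hM) //= => E.
by apply: (etrans E); rewrite mulmxBl; exact: addrCA.
Qed.

Variables (h : metric M) (h' : metric M').

(** The tangent map acts as the push-forward by [f] on horizontal and on vertical
    parts. For the converse, the metric of [M] is recovered from horizontal
    vectors tangent to the bundle at zero vectors. *)
Lemma isometric_tangent_map : affine_map D D' f ->
  isometric (dombrowski_g h D) (dombrowski_g h' D') (tangent_map f)
  <-> isometric h h' f.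
Proof.
move=> aff; split=> [[_ iso]|[_ iso]]; last first.
  split; first exact: tangent_map_smooth.
  move=> u a b; rewrite /dombrowski_g !horizontal_tangent_map !vertical_affine //.
  by rewrite !iso.
split=> // p v w; pose u : TM := existT _ p (0 : tangent p).
have [a [ha va]] := horizontal_vertical_exists flatD (u := u) v 0.
have [b [hb vb]] := horizontal_vertical_exists flatD (u := u) w 0.
have := iso u a b.
rewrite /dombrowski_g !horizontal_tangent_map !vertical_affine // ha hb va vb.
by rewrite pushforward0 !metric0r !addr0.
Qed.

Lemma immersion_tangent_map : affine_map D D' f ->
  immersion (tangent_map f : TM -> TM') <-> immersion f.
Proof.
move=> aff; split=> [[_ inj]|[_ inj]]; split=> //; last first.
- move=> u a b ab; apply: (horizontal_vertical_ext flatD).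
    by apply: inj; rewrite -!horizontal_tangent_map ab.
  by apply: inj; rewrite -!vertical_affine // ab.
- exact: tangent_map_smooth.
move=> p v w vw; pose u : TM := existT _ p (0 : tangent p).
have [a [ha va]] := horizontal_vertical_exists flatD (u := u) v 0.
have [b [hb vb]] := horizontal_vertical_exists flatD (u := u) w 0.
suff ab : a = b by rewrite -ha -hb ab.
apply: (inj u); apply: (horizontal_vertical_ext flatD').
  by rewrite !horizontal_tangent_map ha hb.
by rewrite !vertical_affine // va vb.
Qed.

End Main.

(** * The theorem *)

Theorem proposition2p19 (R : realType) (n n' : nat)
    (M : manifold R n) (h : metric M) (D : connection M)
    (M' : manifold R n') (h' : metric M') (D' : connection M')
    (connM : connected_manifold M) (flatM : dually_flat h D)
    (connM' : connected_manifold M') (flatM' : dually_flat h' D')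
    (f : M -> M') (smooth_f : smooth_map f) :
  [/\ holomorphic (kahler_J (dombrowski h D)) (kahler_J (dombrowski h' D'))
        (tangent_map f) <-> affine_map D D' f,
      affine_map D D' f ->
        (isometric (kahler_g (dombrowski h D)) (kahler_g (dombrowski h' D'))
           (tangent_map f) <-> isometric h h' f) &
      kahler_immersion (dombrowski h D) (dombrowski h' D') (tangent_map f) <->
        [/\ isometric h h' f, affine_map D D' f & immersion f]].
Proof.
have [flatD _] := flatM; have [flatD' _] := flatM'.
have hol_aff : holomorphic (kahler_J (dombrowski h D)) (kahler_J (dombrowski h' D'))
    (tangent_map f) <-> affine_map D D' f.
  split; first exact: affine_of_holomorphic.
  exact: holomorphic_of_affine.
split=> [//|aff|]; first exact: isometric_tangent_map.
split=> [[/hol_aff aff iso imm]|[iso aff imm]]; split=> //.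
- exact/(isometric_tangent_map flatD flatD' smooth_f h h' aff).
- exact/(immersion_tangent_map flatD flatD' smooth_f aff).
- exact/hol_aff.
- exact/(isometric_tangent_map flatD flatD' smooth_f h h' aff).
- exact/(immersion_tangent_map flatD flatD' smooth_f aff).
Qed.
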